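(* For density matrices $\sigma$ and $\rho$, and elementary density matrices $\nu$ and $\xi$, all over $n$ qubits, $\mathbf{I}(\sigma\otimes\nu:\rho\otimes\xi)<^{+}\mathbf{I}(\sigma:\rho)+2\mathbf{K}(\nu/n)+2\mathbf{K}(\xi/n)$.
   Context: $U$ is a fixed universal prefix Turing machine; $\mathbf{K}(x/y)$ is prefix Kolmogorov complexity and $\mathbf{m}(x/y)=\sum_p 2^{-\|p\|}[U_y(p)=x]$ the universal probability. An object is elementary if its entries have rational real and imaginary parts. A program $q$ lower computes a positive semidefinite matrix $\nu$ if $U(q)$ outputs an increasing sequence of elementary semi-density matrices converging to $\nu$; $\underline{\mathbf{m}}(\nu/x)=\sum\{\mathbf{m}(q/x): q\text{ lower computes }\nu\}$. The universal semi-density matrix on $k$ qubits is $\boldsymbol{\mu}_k=\sum_{\text{elementary }|\phi\rangle}\mathbf{m}(|\phi\rangle/k)|\phi\rangle\langle\phi|$. Let $\mathcal{C}_{C\otimes D}$ be the set of lower computable matrices $E\otimes F$ with $\mathrm{Tr}(E\otimes F)(C\otimes D)\le1$, $\mathfrak{C}_{C\otimes D}=\sum_{E\otimes F\in\mathcal{C}_{C\otimes D}}\underline{\mathbf{m}}(E\otimes F/k)E\otimes F$, and for $k$-qubit states $\mathbf{I}(\sigma:\rho)=\log\mathrm{Tr}\,\mathfrak{C}_{\boldsymbol{\mu}_k\otimes\boldsymbol{\mu}_k}(\sigma\otimes\rho)$ (here $k=2n$ on the left side and $k=n$ on the right). $f<^{+}g$ means $f<g+O(1)$. *)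

(* Defs.v *)
(* MathComp / MathComp-Analysis, with mathcomp-real-closed for the complex
   numbers R[i] and the Kronecker product *t. *)
From HB Require Import structures.
From mathcomp Require Import all_boot all_order all_algebra.
From mathcomp Require Import all_classical all_reals all_analysis.
From mathcomp Require Import complex mxtens.

Set Implicit Arguments.
Unset Strict Implicit.
Unset Printing Implicit Defensive.

Import Order.TTheory GRing.Theory Num.Theory.
Import numFieldNormedType.Exports.

Local Open Scope classical_set_scope.
Local Open Scope sesquilinear_scope.
Local Open Scope ring_scope.

(* Kleene's total recursive functions; minimization is restricted to regular
   functions, so that only total functions occur. *)
Inductive recursive : forall n, (n.-tuple nat -> nat) -> Prop :=
| recursive_zero n : recursive (fun _ : n.-tuple nat => 0%N)
| recursive_succ : recursive (fun v : 1.-tuple nat => (thead v).+1)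
| recursive_proj n (i : 'I_n) : recursive (fun v : n.-tuple nat => tnth v i)
| recursive_comp n k (f : k.-tuple nat -> nat)
    (g : 'I_k -> n.-tuple nat -> nat) :
    recursive f -> (forall i, recursive (g i)) ->
    recursive (fun v : n.-tuple nat => f [tuple g i v | i < k])
| recursive_prec n (f : n.-tuple nat -> nat) (g : n.+2.-tuple nat -> nat) :
    recursive f -> recursive g ->
    recursive (fun v : n.+1.-tuple nat =>
      iteri (thead v) (fun i r => g [tuple of i :: r :: behead v])
            (f [tuple of behead v]))
| recursive_mu n (f : n.+1.-tuple nat -> nat)
    (regular : forall v : n.-tuple nat,
       exists i, f [tuple of i :: v] == 0%N) :
    recursive f ->
    recursive (fun v : n.-tuple nat => ex_minn (regular v)).

Definition bits := seq bool.

(* The usual bijection between binary strings and natural numbers (bijective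
   base 2, least significant digit first), and its inverse. *)
Fixpoint nat_of_bits (s : bits) : nat :=
  if s is b :: s' then (b + (nat_of_bits s').*2)%N.+1 else 0%N.

Fixpoint incr_bits (s : bits) : bits :=
  match s with
  | [::] => [:: false]
  | false :: s' => true :: s'
  | true :: s' => false :: incr_bits s'
  end.

Definition bits_of_nat (n : nat) : bits := iter n incr_bits [::].

(* Prefix machines. A machine has a one-way read-only input tape, an auxiliary
   tape and a one-way write-only output tape, and runs deterministically. For
   a Turing machine, the next input/output action is a recursive function of
   the number of steps made, of the auxiliary string, of the input bits read so
   far and of the output bits written so far (simulate the machine), and
   conversely a Turing machine with work tapes carries out any such recursive
   control. The finite control and the work tapes are therefore represented by
   this recursive function, all strings being coded by [nat_of_bits]. *)
Record machine := Machine {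
  control : 4.-tuple nat -> nat;
  control_recursive : recursive control }.

Variant action := Halt | Read | Emit of bool | Idle.

Definition action_of_nat (k : nat) : action :=
  match k with
  | 0 => Halt
  | 1 => Read
  | 2 => Emit false
  | 3 => Emit true
  | _ => Idle
  end%N.

Record config := Config { clock : nat; consumed : bits; written : bits }.

Definition next_action (M : machine) (y : bits) (c : config) : action :=
  action_of_nat (control M [tuple clock c; nat_of_bits y;
    nat_of_bits (consumed c); nat_of_bits (written c)]).

(* A machine that tries to read past the end of its input is blocked forever:
   its configuration, clock included, no longer changes. Hence a machine
   cannot detect the end of its input, and its halting inputs (entirely read)
   form a prefix-free set for each auxiliary string. *)
Definition step (M : machine) (y p : bits) (c : config) : config :=
  match next_action M y c with
  | Halt => c
  | Read => if (size (consumed c) < size p)%N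
            then Config (clock c).+1 (take (size (consumed c)).+1 p) (written c)
            else c
  | Emit b => Config (clock c).+1 (consumed c) (rcons (written c) b)
  | Idle => Config (clock c).+1 (consumed c) (written c)
  end.

Definition run (M : machine) (y p : bits) (t : nat) : config :=
  iter t (step M y p) (Config 0%N [::] [::]).

(* M_y(p) = x *)
Definition computes (M : machine) (y p x : bits) : Prop :=
  exists t, [/\ next_action M y (run M y p t) = Halt,
                consumed (run M y p t) = p & written (run M y p t) = x].

(* The possibly infinite output of M_y on p, halting or not, begins with w. *)
Definition emits (M : machine) (y p w : bits) : Prop :=
  exists t, prefix w (written (run M y p t)).

Definition universal (U : machine) : Prop :=
  forall M : machine, exists s : bits, forall y p : bits,
    (forall x, computes U y (s ++ p) x <-> computes M y p x) /\
    (forall w, emits U y (s ++ p) w <-> emits M y p w).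

(* x is in general a code of an object, y a code of side information. *)
Definition complexity (R : realType) (U : machine) (x y : bits) : \bar R :=
  ereal_inf [set ((size p)%:R)%:E | p in [set p | computes U y p x]].

Definition univ_prob (R : realType) (U : machine) (x y : bits) : \bar R :=
  \esum_(p in [set p | computes U y p x]) ((2 ^- size p)%:E).

(* Elementary matrices are matrices over rat[i]. They are coded by their
   dimensions followed by their entries, row by row, in a self-delimiting way,
   so that a concatenation of codes can be read back. *)
Definition code_nat (n : nat) : bits := nseq n true ++ [:: false].

Definition code_int (z : int) : bits :=
  match z with
  | Posz n => false :: code_nat n
  | Negz n => true :: code_nat n
  end.

Definition code_rat (q : rat) : bits := code_int (numq q) ++ code_int (denq q).

Definition code_crat (z : rat[i]) : bits :=
  code_rat (complex.Re z) ++ code_rat (complex.Im z).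

Definition code_mx m n (A : 'M[rat[i]]_(m, n)) : bits :=
  code_nat m ++ code_nat n ++
  flatten [seq flatten [seq code_crat (A i j) | j <- enum 'I_n]
          | i <- enum 'I_m].

Definition emb_mx (R : realType) m n (A : 'M[rat[i]]_(m, n)) : 'M[R[i]]_(m, n) :=
  map_mx (fun z => Complex (ratr (complex.Re z)) (ratr (complex.Im z))) A.

(* In the order of R[i], 0 <= z means that z is real and nonnegative. *)
Definition psd (R : realType) d (A : 'M[R[i]]_d) : Prop :=
  forall v : 'cV[R[i]]_d, 0 <= (v ^t* *m A *m v) ord0 ord0.

Definition density (R : realType) d (A : 'M[R[i]]_d) : Prop :=
  psd A /\ \tr A = 1.

Definition semi_density (R : realType) d (A : 'M[R[i]]_d) : Prop :=
  psd A /\ \tr A <= 1.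

(* Tensor product of an operator on k qubits and an operator on l qubits. *)
Definition qtens (R : realType) k l
    (A : 'M[R[i]]_(2 ^ k)) (B : 'M[R[i]]_(2 ^ l)) : 'M[R[i]]_(2 ^ (k + l)) :=
  castmx (esym (expnD 2 k l), esym (expnD 2 k l)) (A *t B).

(* Unconditional sums of real families, then entrywise of matrix families. *)
Definition real_sum (R : realType) (T : choiceType) (D : set T) (f : T -> R) : R :=
  fine (\esum_(t in D) (Num.max (f t) 0)%:E) -
  fine (\esum_(t in D) (Num.max (- f t) 0)%:E).

Definition mx_sum (R : realType) (T : choiceType) m n (D : set T)
    (F : T -> 'M[R[i]]_(m, n)) : 'M[R[i]]_(m, n) :=
  \matrix_(i, j) Complex (real_sum D (fun t => complex.Re (F t i j)))
                         (real_sum D (fun t => complex.Im (F t i j))).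

Definition mx_cvg (R : realType) m n
    (A : nat -> 'M[R[i]]_(m, n)) (X : 'M[R[i]]_(m, n)) : Prop :=
  forall i j,
    (fun t => complex.Re (A t i j)) @ \oo --> complex.Re (X i j) /\
    (fun t => complex.Im (A t i j)) @ \oo --> complex.Im (X i j).

(* On input q, without side information, U writes the codes of A 0, A 1, ... *)
Definition lower_computes (R : realType) (U : machine) (q : bits) d
    (X : 'M[R[i]]_d) : Prop :=
  exists A : nat -> 'M[rat[i]]_d,
    [/\ forall N, emits U [::] q (flatten [seq code_mx (A i) | i <- iota 0%N N]),
        forall i, semi_density (emb_mx R (A i)),
        forall i, psd (emb_mx R (A i.+1) - emb_mx R (A i))
      & mx_cvg (fun i => emb_mx R (A i)) X].

Definition lower_univ_prob (R : realType) (U : machine) d (X : 'M[R[i]]_d)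
    (y : bits) : \bar R :=
  \esum_(q in [set q | lower_computes U q X]) univ_prob R U q y.

(* mu_k; a pure state is a unit vector. *)
Definition univ_semi_density (R : realType) (U : machine) (k : nat) :
    'M[R[i]]_(2 ^ k) :=
  mx_sum [set phi : 'cV[rat[i]]_(2 ^ k) |
            (emb_mx R phi) ^t* *m emb_mx R phi = 1%:M]
    (fun phi => Complex (fine (univ_prob R U (code_mx phi) (bits_of_nat k))) 0
                *: (emb_mx R phi *m (emb_mx R phi) ^t*)).

Definition product_tests (R : realType) (U : machine) (k : nat)
    (C D : 'M[R[i]]_(2 ^ k)) : set 'M[R[i]]_(2 ^ (k + k)) :=
  [set X | [/\ exists q, lower_computes U q X,
               exists E F : 'M[R[i]]_(2 ^ k), X = qtens E F
             & \tr (X *m qtens C D) <= 1]].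

Definition universal_test (R : realType) (U : machine) (k : nat)
    (C D : 'M[R[i]]_(2 ^ k)) : 'M[R[i]]_(2 ^ (k + k)) :=
  mx_sum (product_tests U C D)
    (fun X => Complex (fine (lower_univ_prob U X (bits_of_nat k))) 0 *: X).

(* The logarithm is in base 2; the trace is a nonnegative real. *)
Definition mutual_info (R : realType) (U : machine) (k : nat)
    (sigma rho : 'M[R[i]]_(2 ^ k)) : \bar R :=
  let mu := univ_semi_density R U k in
  (lne (complex.Re (\tr (universal_test U mu mu *m qtens sigma rho)))%:E
   * ((ln 2)^-1)%:E)%E.

(* Main.v *)
Require Import Defs.
From HB Require Import structures.
From mathcomp Require Import all_boot all_order all_algebra.
From mathcomp Require Import all_classical all_reals all_analysis.
From mathcomp Require Import complex mxtens.
From mathcomp Require Import zify ring lra.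

Set Implicit Arguments.
Unset Strict Implicit.
Unset Printing Implicit Defensive.

Import Order.TTheory GRing.Theory Num.Theory.

(* Let t be the trace whose logarithm is the mutual information. Rearranging
   nonnegative sums, t is a sum over triples (X, q, p), where p is a program of q
   and q lower computes the product test X, with weight 2^-|p| Tr X(. (x) .);
   Kraft's inequality makes every such sum finite. A test X for
   mu_2n (x) mu_2n is turned into the test
     X' = 2^-e Tr_anc X (1 (x) nu (x) 1 (x) xi)
   on n + n qubits. It is again a lower computable product, by a program q'
   built from q, nu and xi, and Tr X' (sigma (x) rho) is 2^-e times
   Tr X ((sigma (x) nu) (x) (rho (x) xi)). The trace condition on X' follows,
   for e = K(nu/n) + K(xi/n) + O(1), from mu_n (x) nu <= 2^(K(nu/n) + O(1)) mu_2n.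
   A program of q' is obtained by appending shortest programs of nu and xi to
   p, so the weights lose another factor 2^(K(nu/n) + K(xi/n) + O(1)): hence
   twice the complexities in the bound.

   For mu_n (x) nu <= 2^(K(nu/n) + O(1)) mu_2n, a search on input nu finds a
   rational mixture 2^-L sum_k phi_k phi_k^* of 2^L elementary pure states with
   nu <= 16 times the mixture. Rational square roots need not exist, but 16
   leaves room for rational points of the unit sphere. Then programs of nu
   and phi followed by L bits give a program of phi (x) phi_k. *)

(** * Recursive functions *)

(** Distinct tests may have the same slice, and one test may have many programs. The map is
    therefore defined on triples: since p determines q and q determines X, it is injective, and only
    the weights of p and of its extension have to be compared. The lengths of q and q' never enter,
    so q' may carry n, e and both ancilla states in unary. The exponent e cannot be computed from nu
    and xi, complexity being uncomputable; the program of q' takes it from the lengths of the two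
    programs that it has just read. The number of qubits doubles on the left, so programs given 2n
    are simulated from n, and conversely for the domination of mu. A machine never sees the end of
    its input, hence the care about when a simulation may ask for one more bit. In the mixture, the
    factor 2^-L lost for L extra bits is exactly the weight of one vector, so it costs nothing. The
    factor 16 is 8, for moving vectors to rational points of the sphere, times 2, for rounding the
    number of vectors up to a power of two. *)

Lemma recursive_eq n (f g : n.-tuple nat -> nat) :
  f =1 g -> recursive f -> recursive g.
Proof. by move=> /funext ->. Qed.

Lemma recursive_app1 n (f : 1.-tuple nat -> nat) (a : n.-tuple nat -> nat) :
  recursive f -> recursive a -> recursive (fun v => f [tuple a v]).
Proof.
move=> rf ra; have := recursive_comp rf (fun=> ra).
by apply: recursive_eq => v; congr f; apply/eq_from_tnth => i;
  rewrite tnth_mktuple (tnth_nth 0%N) ord1.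
Qed.

Lemma recursive_app2 n (f : 2.-tuple nat -> nat) (a b : n.-tuple nat -> nat) :
  recursive f -> recursive a -> recursive b ->
  recursive (fun v => f [tuple a v; b v]).
Proof.
move=> rf ra rb.
have := @recursive_comp n 2 f (fun i => if val i is 0%N then a else b) rf _.
move=> H; apply: recursive_eq (H _); last by case=> [[|i] ?].
by move=> v; congr f; apply/eq_from_tnth => -[[|[|i]] ?] //;
  rewrite tnth_mktuple (tnth_nth 0%N).
Qed.

Lemma recursive_app4 n (f : 4.-tuple nat -> nat)
    (a b c d : n.-tuple nat -> nat) :
  recursive f -> recursive a -> recursive b -> recursive c -> recursive d ->
  recursive (fun v => f [tuple a v; b v; c v; d v]).
Proof.
move=> rf ra rb rc rd.
have := @recursive_comp n 4 f (fun i =>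
  match val i with 0%N => a | 1%N => b | 2%N => c | _ => d end) rf _.
move=> H; apply: recursive_eq (H _); last by case=> [[|[|[|i]]] ?].
by move=> v; congr f; apply/eq_from_tnth => -[[|[|[|[|i]]]] ?] //;
  rewrite tnth_mktuple (tnth_nth 0%N).
Qed.

Definition rec1 (f : nat -> nat) := recursive (fun v : 1.-tuple nat => f (thead v)).
Definition rec2 (f : nat -> nat -> nat) :=
  recursive (fun v : 2.-tuple nat => f (tnth v ord0) (tnth v ord_max)).

Lemma rec1_app n f (a : n.-tuple nat -> nat) :
  rec1 f -> recursive a -> recursive (fun v => f (a v)).
Proof. exact: recursive_app1. Qed.

Lemma rec2_app n f (a b : n.-tuple nat -> nat) :
  rec2 f -> recursive a -> recursive b -> recursive (fun v => f (a v) (b v)).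
Proof. exact: recursive_app2. Qed.

Lemma recursive_succ_app n (a : n.-tuple nat -> nat) :
  recursive a -> recursive (fun v => (a v).+1).
Proof. exact: (recursive_app1 recursive_succ). Qed.

Lemma recursive_const n k : recursive (fun _ : n.-tuple nat => k).
Proof.
by elim: k => [|k IH]; [exact: recursive_zero | exact: recursive_succ_app].
Qed.

(* [recursive_prec] with the recursion argument and the parameter computed from
   the variables; the step may use the counter, the accumulator and the
   parameter. *)
Lemma recursive_iteri n (m a : n.-tuple nat -> nat) (f : nat -> nat)
    (g : nat -> nat -> nat -> nat) :
  recursive m -> recursive a -> rec1 f ->
  recursive (fun v : 3.-tuple nat =>
    g (tnth v (inord 0)) (tnth v (inord 1)) (tnth v (inord 2))) ->
  recursive (fun v => iteri (m v) (fun i r => g i r (a v)) (f (a v))).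
Proof.
move=> rm ra rf rg.
have := @recursive_prec 1 _ _ rf rg.
move=> /recursive_app2 /(_ rm ra); apply: recursive_eq => v /=.
rewrite /thead /= (tnth_nth 0%N) /=.
have -> : tnth [tuple of behead [tuple m v; a v]] ord0 = a v
  by rewrite (tnth_nth 0%N).
by apply: eq_iteri => i r; congr g; rewrite (tnth_nth 0%N) inordK.
Qed.

Lemma recursive_iteri0 n (m : n.-tuple nat -> nat) k (g : nat -> nat -> nat) :
  recursive m -> rec2 g -> recursive (fun v => iteri (m v) g k).
Proof.
move=> rm rg.
apply: (@recursive_iteri _ m (fun=> 0%N) (fun=> k) (fun i r _ => g i r)) => //.
- exact: recursive_zero.
- exact: recursive_const.
- exact: rec2_app rg (recursive_proj _) (recursive_proj _).
Qed.

Ltac rec_proj := first [exact: recursive_proj | exact: recursive_const].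

Lemma rec2_add : rec2 addn.
Proof.
apply: (@recursive_eq _ (fun v : 2.-tuple nat =>
  iteri (tnth v ord0) (fun _ r => r.+1) (tnth v ord_max))).
  by move=> v; elim: (tnth v ord0) => //= k ->.
apply: (@recursive_iteri _ _ _ id (fun i r _ => r.+1)); try rec_proj.
apply: recursive_succ_app; rec_proj.
Qed.

Lemma rec2_mul : rec2 muln.
Proof.
apply: (@recursive_eq _ (fun v : 2.-tuple nat =>
  iteri (tnth v ord0) (fun _ r => r + tnth v ord_max)%N 0%N)).
  by move=> v; elim: (tnth v ord0) => //= k ->; rewrite mulSn addnC.
apply: (@recursive_iteri _ _ _ (fun=> 0%N) (fun i r a => (r + a)%N)); try rec_proj.
apply: (rec2_app rec2_add); rec_proj.
Qed.

Lemma rec1_pred : rec1 predn.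
Proof.
apply: (@recursive_eq _ (fun v : 1.-tuple nat =>
  iteri (thead v) (fun i _ => i) 0%N)).
  by move=> v; case: (thead v).
by apply: (@recursive_iteri0 _ _ 0%N (fun i _ => i)); rec_proj.
Qed.

Lemma rec2_sub : rec2 subn.
Proof.
apply: (@recursive_eq _ (fun v : 2.-tuple nat =>
  iteri (tnth v ord_max) (fun _ r => r.-1) (tnth v ord0))).
  by move=> v; elim: (tnth v ord_max) => [|k /= ->]; rewrite ?subn0 // subnS.
apply: (@recursive_iteri _ _ _ id (fun i r _ => r.-1)); try rec_proj.
apply: (rec1_app rec1_pred); rec_proj.
Qed.

(** * Cantor's pairing function and its projections *)

Definition triangle (n : nat) : nat := iteri n (fun i r => r + i.+1)%N 0%N.

Lemma rec1_triangle : rec1 triangle.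
Proof.
apply: (@recursive_iteri0 _ _ 0%N (fun i r => (r + i.+1)%N)); first rec_proj.
by apply: (rec2_app rec2_add); [|apply: recursive_succ_app]; rec_proj.
Qed.

Lemma leq_triangle n : (n <= triangle n)%N.
Proof. by case: n => // n /=; rewrite -/(triangle n) leq_addl. Qed.

Lemma triangle_mono m n : (m <= n)%N -> (triangle m <= triangle n)%N.
Proof.
by move=> /subnK <-; elim: (n - m)%N => // k /leq_trans; apply; exact: leq_addr.
Qed.

(** The wanted [w] is the last one with [triangle w <= n]. It is also the least one with
    [n < triangle w.+1], written as a vanishing difference because [recursive_mu] searches for
    zeros. *)
Lemma diagonal_proof n : exists w, (n.+1 - triangle w.+1 == 0)%N.
Proof. by exists n; rewrite subn_eq0 leq_triangle. Qed.

Definition diagonal n := ex_minn (diagonal_proof n).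

Lemma rec1_diagonal : rec1 diagonal.
Proof.
pose f (v : 2.-tuple nat) := ((tnth v ord_max).+1 - triangle (tnth v ord0).+1)%N.
have rf : recursive f.
  apply: (rec2_app rec2_sub); first by apply: recursive_succ_app; rec_proj.
  apply: (rec1_app rec1_triangle); apply: recursive_succ_app; rec_proj.
have reg (v : 1.-tuple nat) : exists i, f [tuple of i :: v] == 0%N.
  exists (thead v); rewrite /f /= subn_eq0.
  by rewrite (tuple_eta v) !(tnth_nth 0%N) /= leq_triangle.
apply: recursive_eq (recursive_mu reg rf) => v; rewrite /diagonal.
apply: eq_ex_minn => i; rewrite /f.
by rewrite (tuple_eta v) !(tnth_nth 0%N).
Qed.

Definition pairn a b := (triangle (a + b) + a)%N.
Definition fstn n := (n - triangle (diagonal n))%N.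
Definition sndn n := (diagonal n - fstn n)%N.

Lemma diagonal_pairn a b : diagonal (pairn a b) = (a + b)%N.
Proof.
rewrite /diagonal; case: ex_minnP => w; rewrite subn_eq0 => h hmin.
apply/eqP; rewrite eqn_leq; apply/andP; split.
  apply: hmin; rewrite subn_eq0 /pairn /=.
  by rewrite -/(triangle _) -addnS leq_add2l ltnS leq_addr.
rewrite leqNgt; apply/negP => /triangle_mono; move: h; rewrite /pairn; lia.
Qed.

Lemma pairnK1 a b : fstn (pairn a b) = a.
Proof. by rewrite /fstn diagonal_pairn /pairn addKn. Qed.

Lemma pairnK2 a b : sndn (pairn a b) = b.
Proof. by rewrite /sndn pairnK1 diagonal_pairn addKn. Qed.

Lemma leq_pairn2 a b : (b <= pairn a b)%N.
Proof.
apply: leq_trans (leq_addr _ _); apply: leq_trans (leq_triangle _).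
exact: leq_addl.
Qed.

Lemma sndn0 : sndn 0 = 0%N. Proof. exact: (pairnK2 0 0). Qed.

Lemma rec2_pairn : rec2 pairn.
Proof.
apply: (rec2_app rec2_add); last rec_proj.
by apply: (rec1_app rec1_triangle); apply: (rec2_app rec2_add); rec_proj.
Qed.

Lemma rec1_fstn : rec1 fstn.
Proof.
apply: (rec2_app rec2_sub); first rec_proj.
apply: (rec1_app rec1_triangle); apply: (rec1_app rec1_diagonal); rec_proj.
Qed.

Lemma rec1_sndn : rec1 sndn.
Proof.
apply: (rec2_app rec2_sub); last by apply: (rec1_app rec1_fstn); rec_proj.
apply: (rec1_app rec1_diagonal); rec_proj.
Qed.

Lemma rec1_id : rec1 id. Proof. rec_proj. Qed.
Lemma rec1_const k : rec1 (fun=> k). Proof. rec_proj. Qed.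

Lemma rec1_iter (m f : nat -> nat) (g : nat -> nat -> nat) :
  rec1 m -> rec1 f -> rec2 g -> rec1 (fun c => iter (m c) (g c) (f c)).
Proof.
move=> rm rf rg; apply: (@recursive_eq _ (fun v : 1.-tuple nat =>
  iteri (m (thead v)) (fun _ r => g (thead v) r) (f (thead v)))).
  by move=> v; elim: (m _) => //= k ->.
apply: (@recursive_iteri _ _ _ f (fun i r a => g a r)) => //; try rec_proj.
by apply: (rec2_app rg); rec_proj.
Qed.

(** * Computable functions on coded types *)

(** Only an encoding is recorded: a computable function is tracked by a recursive function whose
    values off the codes are arbitrary. Injectivity is proved separately, for the types on which
    equality has to be decided. *)
Class coded (T : Type) := Coded { enc : T -> nat }.

#[global] Instance coded_nat : coded nat := Coded id.
#[global] Instance coded_bool : coded bool := Coded nat_of_bool.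
#[global] Instance coded_prod A B (cA : coded A) (cB : coded B) : coded (A * B) :=
  Coded (fun p => pairn (enc p.1) (enc p.2)).
#[global] Instance coded_option A (cA : coded A) : coded (option A) :=
  Coded (fun o => if o is Some x then (enc x).+1 else 0%N).
#[global] Instance coded_seq A (cA : coded A) : coded (seq A) :=
  Coded (foldr (fun x n => (pairn (enc x) n).+1) 0%N).

Definition computable {A B : Type} {cA : coded A} {cB : coded B} (f : A -> B) :=
  exists2 g, rec1 g & forall a, g (enc a) = enc (f a).

Definition computable2 {A B D} {cA : coded A} {cB : coded B} {cD : coded D}
    (f : A -> B -> D) := computable (fun p : A * B => f p.1 p.2).

Definition computable3 {A1 A2 A3 D} {c1 : coded A1} {c2 : coded A2}
    {c3 : coded A3} {cD : coded D} (f : A1 -> A2 -> A3 -> D) :=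
  computable (fun p : A1 * A2 * A3 => f p.1.1 p.1.2 p.2).

Definition computable4 {A1 A2 A3 A4 D} {c1 : coded A1} {c2 : coded A2}
    {c3 : coded A3} {c4 : coded A4} {cD : coded D}
    (f : A1 -> A2 -> A3 -> A4 -> D) :=
  computable (fun p : A1 * A2 * A3 * A4 => f p.1.1.1 p.1.1.2 p.1.2 p.2).

(* The closure lemmas are stated for expressions depending on a context [c], so
   that they apply to the body of a function whatever its variables are; under a
   binder the context is extended with a pair. *)
Section Closure.
Context {C : Type} {cC : coded C}.

Lemma comp_id : computable (fun c : C => c).
Proof. by exists id => //; exact: rec1_id. Qed.

Lemma comp_const T (cT : coded T) (k : T) : computable (fun _ : C => k).
Proof. by exists (fun=> enc k) => //; exact: rec1_const. Qed.

Lemma comp_comp A B (cA : coded A) (cB : coded B) (f : A -> B) (a : C -> A) :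
  computable f -> computable a -> computable (fun c => f (a c)).
Proof.
move=> [g rg gE] [h rh hE]; exists (g \o h); first exact: (rec1_app rg rh).
by move=> c /=; rewrite hE gE.
Qed.

Lemma comp_pair A B (cA : coded A) (cB : coded B) (a : C -> A) (b : C -> B) :
  computable a -> computable b -> computable (fun c => (a c, b c)).
Proof.
move=> [g rg gE] [h rh hE]; exists (fun n => pairn (g n) (h n)).
  exact: (rec2_app rec2_pairn).
by move=> c /=; rewrite hE gE.
Qed.

Lemma comp_fst A B (cA : coded A) (cB : coded B) (a : C -> A * B) :
  computable a -> computable (fun c => (a c).1).
Proof.
move=> [g rg gE]; exists (fstn \o g); first exact: rec1_app rec1_fstn rg.
by move=> c /=; rewrite gE pairnK1.
Qed.

Lemma comp_snd A B (cA : coded A) (cB : coded B) (a : C -> A * B) :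
  computable a -> computable (fun c => (a c).2).
Proof.
move=> [g rg gE]; exists (sndn \o g); first exact: rec1_app rec1_sndn rg.
by move=> c /=; rewrite gE pairnK2.
Qed.

Lemma comp_rec1 (f : nat -> nat) (a : C -> nat) :
  rec1 f -> computable a -> computable (fun c => f (a c)).
Proof. by move=> rf; apply: comp_comp; exists f. Qed.

Lemma comp_rec2 (f : nat -> nat -> nat) (a b : C -> nat) :
  rec2 f -> computable a -> computable b -> computable (fun c => f (a c) (b c)).
Proof.
move=> rf [g rg gE] [h rh hE]; exists (fun n => f (g n) (h n)).
  exact: (rec2_app rf).
by move=> c; rewrite gE hE.
Qed.

Lemma comp_succ (a : C -> nat) : computable a -> computable (fun c => (a c).+1).
Proof. by apply: comp_rec1; apply: recursive_succ_app; rec_proj. Qed.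

Lemma comp_pred (a : C -> nat) : computable a -> computable (fun c => (a c).-1).
Proof. exact: comp_rec1 rec1_pred. Qed.

Lemma comp_add (a b : C -> nat) :
  computable a -> computable b -> computable (fun c => (a c + b c)%N).
Proof. exact: comp_rec2 rec2_add. Qed.

Lemma comp_sub (a b : C -> nat) :
  computable a -> computable b -> computable (fun c => (a c - b c)%N).
Proof. exact: comp_rec2 rec2_sub. Qed.

Lemma comp_mul (a b : C -> nat) :
  computable a -> computable b -> computable (fun c => (a c * b c)%N).
Proof. exact: comp_rec2 rec2_mul. Qed.

Lemma comp_enc T (cT : coded T) (a : C -> T) :
  computable a -> computable (fun c => enc (a c)).
Proof. by move=> [g rg gE]; exists g. Qed.

Lemma comp_iter T (cT : coded T) (n : C -> nat) (f : C -> T -> T) (x : C -> T) :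
  computable n -> computable2 f -> computable x ->
  computable (fun c => iter (n c) (f c) (x c)).
Proof.
move=> [gn rn nE] [gf rf fE] [gx rx xE].
exists (fun k => iter (gn k) (fun r => gf (pairn k r)) (gx k)).
  apply: (rec1_iter rn rx); apply: (rec1_app rf).
  by apply: (rec2_app rec2_pairn); rec_proj.
move=> c; rewrite nE xE.
by elim: (n c) => //= k ->; exact: (fE (c, _)).
Qed.

Lemma comp_bool_of (a : C -> nat) (b : C -> bool) :
  (forall c, b c = (a c != 0)%N) -> computable a -> computable b.
Proof.
move=> ab [g rg gE]; exists (fun k => 1 - (1 - g k))%N.
  apply: (rec2_app rec2_sub); first rec_proj.
  by apply: (rec2_app rec2_sub) => //; rec_proj.
by move=> c; rewrite gE ab /=; case: (a c).
Qed.

Lemma comp_nat_of_bool (b : C -> bool) :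
  computable b -> computable (fun c => nat_of_bool (b c)).
Proof. exact: comp_enc. Qed.

Lemma comp_if T (cT : coded T) (b : C -> bool) (x y : C -> T) :
  computable b -> computable x -> computable y ->
  computable (fun c => if b c then x c else y c).
Proof.
move=> [gb rb bE] [gx rx xE] [gy ry yE].
exists (fun k => gb k * gx k + (1 - gb k) * gy k)%N.
  apply: (rec2_app rec2_add); apply: (rec2_app rec2_mul) => //.
  by apply: (rec2_app rec2_sub) => //; rec_proj.
by move=> c; rewrite bE xE yE /=; case: (b c); rewrite ?mul1n ?mul0n ?addn0.
Qed.

Lemma comp_neg (b : C -> bool) : computable b -> computable (fun c => ~~ b c).
Proof.
move=> cb; apply: comp_if cb (comp_const _ false) (comp_const _ true).
Qed.

Lemma comp_and (a b : C -> bool) :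
  computable a -> computable b -> computable (fun c => a c && b c).
Proof. move=> ca cb; exact: comp_if ca cb (comp_const _ false). Qed.

Lemma comp_leq (a b : C -> nat) :
  computable a -> computable b -> computable (fun c => (a c <= b c)%N).
Proof.
move=> ca cb; apply: (@comp_bool_of (fun c => 1 - (a c - b c)))%N.
  by move=> c; lia.
exact: comp_sub (comp_const _ 1%N) (comp_sub ca cb).
Qed.

Lemma comp_eqn (a b : C -> nat) :
  computable a -> computable b -> computable (fun c => (a c == b c)%N).
Proof.
move=> ca cb; have := comp_and (comp_leq ca cb) (comp_leq cb ca).
by congr computable; apply/funext => c; rewrite eqn_leq.
Qed.

Lemma comp_code_eq (T : eqType) (cT : coded T) (a b : C -> T) :
  injective (enc : T -> nat) ->
  computable a -> computable b -> computable (fun c => a c == b c).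
Proof.
move=> einj ca cb; have := comp_eqn (comp_enc ca) (comp_enc cb).
by congr computable; apply/funext => c; rewrite inj_eq.
Qed.

Lemma comp_some T (cT : coded T) (a : C -> T) :
  computable a -> computable (fun c => Some (a c)).
Proof.
move=> [g rg gE]; exists (fun k => (g k).+1); first exact: recursive_succ_app.
by move=> c; rewrite gE.
Qed.

Lemma comp_oapp S T (cS : coded S) (cT : coded T) (f : C -> S -> T) (y : C -> T)
    (o : C -> option S) :
  computable2 f -> computable y -> computable o ->
  computable (fun c => oapp (f c) (y c) (o c)).
Proof.
move=> [gf rf fE] [gy ry yE] [go ro oE].
pose z := fun k => ((1 - (1 - go k)) * gf (pairn k (go k).-1) +
                    (1 - go k) * gy k)%N.
exists z.
  have r1 : rec1 (fun k => 1 - go k)%N by apply: (rec2_app rec2_sub) => //; rec_proj.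
  apply: (rec2_app rec2_add); apply: (rec2_app rec2_mul) => //.
    by apply: (rec2_app rec2_sub) => //; rec_proj.
  apply: (rec1_app rf); apply: (rec2_app rec2_pairn); first rec_proj.
  exact: rec1_app rec1_pred ro.
move=> c; rewrite /z yE oE /=; case: (o c) => [s|] /=.
  by rewrite subSS sub0n mul0n addn0 mul1n; exact: (fE (c, s)).
by rewrite mul0n mul1n.
Qed.

Section Lists.
Context {T : Type} {cT : coded T}.

Lemma comp_cons (x : C -> T) (s : C -> seq T) :
  computable x -> computable s -> computable (fun c => x c :: s c).
Proof.
move=> [g rg gE] [h rh hE]; exists (fun n => (pairn (g n) (h n)).+1).
  by apply: recursive_succ_app; exact: (rec2_app rec2_pairn).
by move=> c /=; rewrite hE gE.
Qed.

Lemma comp_behead (s : C -> seq T) :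
  computable s -> computable (fun c => behead (s c)).
Proof.
move=> [g rg gE]; exists (fun n => sndn (g n).-1).
  by apply: (rec1_app rec1_sndn); exact: rec1_app rec1_pred rg.
by move=> c; rewrite gE; case: (s c) => [|x s'] /=; rewrite ?sndn0 ?pairnK2.
Qed.

Lemma comp_ohead (s : C -> seq T) :
  computable s -> computable (fun c => ohead (s c)).
Proof.
move=> [g rg gE].
exists (fun n => (fstn (g n).-1).+1 * (1 - (1 - g n)))%N.
  have r1 : rec1 (fun k => 1 - g k)%N by apply: (rec2_app rec2_sub) => //; rec_proj.
  apply: (rec2_app rec2_mul).
    apply: recursive_succ_app.
    by apply: (rec1_app rec1_fstn); exact: rec1_app rec1_pred rg.
  by apply: (rec2_app rec2_sub) => //; rec_proj.
move=> c; rewrite gE; case: (s c) => [|x s'] /=; rewrite ?muln0 //.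
by rewrite pairnK1 subSS sub0n muln1.
Qed.

Lemma leq_size_enc (s : seq T) : (size s <= enc s)%N.
Proof.
by elim: s => //= x s IH; rewrite ltnS (leq_trans IH) // leq_pairn2.
Qed.

End Lists.
End Closure.

Section ListOperations.
Context {C : Type} {cC : coded C} {T : Type} {cT : coded T}.

(** One iteration consumes one element, and an empty list is a fixed point. Any number of iterations
    that is at least the length will do; [leq_size_enc] offers the code of the list. *)
Definition foldl_step A (f : A -> T -> A) (p : seq T * A) : seq T * A :=
  oapp (fun x => (behead p.1, f p.2 x)) p (ohead p.1).

Lemma foldl_iter A (f : A -> T -> A) x s n :
  (size s <= n)%N -> foldl f x s = (iter n (foldl_step f) (s, x)).2.
Proof.
elim: n s x => [|n IH] s x; first by case: s.
rewrite iterSr; case: s => [_|y s /= /IH ->] //=.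
by rewrite -(IH [::]).
Qed.

Lemma comp_foldl A (cA : coded A) (f : C -> A -> T -> A) (x : C -> A)
    (s : C -> seq T) :
  computable3 f ->
  computable x -> computable s ->
  computable (fun c => foldl (f c) (x c) (s c)).
Proof.
move=> cf cx cs.
have -> : (fun c => foldl (f c) (x c) (s c)) =
    fun c => (iter (enc (s c)) (foldl_step (f c)) (s c, x c)).2.
  by apply/funext => c; apply: foldl_iter; exact: leq_size_enc.
apply: comp_snd.
apply: comp_iter; [exact: comp_enc | | exact: comp_pair].
apply: comp_oapp.
- apply: comp_pair.
    by apply: comp_behead; apply: comp_fst; apply: comp_snd; apply: comp_fst;
      exact: comp_id.
  apply: (comp_comp (a := fun q : C * (seq T * A) * T => (q.1.1, q.1.2.2, q.2)) cf).
  apply: comp_pair; last by apply: comp_snd; exact: comp_id.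
  apply: comp_pair; first by do 2!apply: comp_fst; exact: comp_id.
  by do 2!apply: comp_snd; apply: comp_fst; exact: comp_id.
- by apply: comp_snd; exact: comp_id.
- by apply: comp_ohead; apply: comp_fst; apply: comp_snd; exact: comp_id.
Qed.

End ListOperations.

Lemma comp_eq A B (cA : coded A) (cB : coded B) (f g : A -> B) :
  f =1 g -> computable f -> computable g.
Proof. by move=> /funext ->. Qed.

Lemma comp_comp2 C A B D (cC : coded C) (cA : coded A) (cB : coded B)
    (cD : coded D) (f : A -> B -> D) (a : C -> A) (b : C -> B) :
  computable2 f -> computable a -> computable b ->
  computable (fun c => f (a c) (b c)).
Proof. by move=> cf ca cb; apply: (comp_comp cf (comp_pair ca cb)). Qed.

Lemma comp_comp3 C A1 A2 A3 D (cC : coded C) (c1 : coded A1) (c2 : coded A2)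
    (c3 : coded A3) (cD : coded D) (f : A1 -> A2 -> A3 -> D)
    (a1 : C -> A1) (a2 : C -> A2) (a3 : C -> A3) :
  computable3 f ->
  computable a1 -> computable a2 -> computable a3 ->
  computable (fun c => f (a1 c) (a2 c) (a3 c)).
Proof.
by move=> cf h1 h2 h3; apply: (comp_comp cf (comp_pair (comp_pair h1 h2) h3)).
Qed.

Lemma comp_comp4 C A1 A2 A3 A4 D (cC : coded C) (c1 : coded A1) (c2 : coded A2)
    (c3 : coded A3) (c4 : coded A4) (cD : coded D) (f : A1 -> A2 -> A3 -> A4 -> D)
    (a1 : C -> A1) (a2 : C -> A2) (a3 : C -> A3) (a4 : C -> A4) :
  computable4 f ->
  computable a1 -> computable a2 -> computable a3 -> computable a4 ->
  computable (fun c => f (a1 c) (a2 c) (a3 c) (a4 c)).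
Proof.
move=> cf h1 h2 h3 h4.
by apply: (comp_comp cf (comp_pair (comp_pair (comp_pair h1 h2) h3) h4)).
Qed.

Ltac comp_hook := fail.

(* The dispatch is on the syntactic shape of the body, since unification up to
   conversion would unfold the arithmetic operations. *)
Ltac comp_step :=
  match goal with
  | H : computable ?f |- computable ?f => exact H
  | |- computable (fun _ => ?k) => exact (comp_const _ k)
  | |- computable (fun c => c) => exact comp_id
  | |- computable (fun c => (@?a c).1) => refine (comp_fst _)
  | |- computable (fun c => (@?a c).2) => refine (comp_snd _)
  | |- computable (fun c => (_, _)) => refine (comp_pair _ _)
  | |- computable (fun c => (_.+1)%N) => refine (comp_succ _)
  | |- computable (fun c => if _ then _ else _) => refine (comp_if _ _ _)
  | |- computable (fun c => (_ + _)%N) => refine (comp_add _ _)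
  | |- computable (fun c => (_ - _)%N) => refine (comp_sub _ _)
  | |- computable (fun c => (_ * _)%N) => refine (comp_mul _ _)
  | |- computable (fun c => (_.-1)%N) => refine (comp_pred _)
  | |- computable (fun c => (_ <= _)%N) => refine (comp_leq _ _)
  | |- computable (fun c => (_ == _ :> nat)) => refine (comp_eqn _ _)
  | |- computable (fun c => ~~ _) => refine (comp_neg _)
  | |- computable (fun c => _ && _) => refine (comp_and _ _)
  | |- computable (fun c => Some _) => refine (comp_some _)
  | |- computable (fun c => oapp _ _ _) => refine (comp_oapp _ _ _)
  | |- computable (fun c => _ :: _) => refine (comp_cons _ _)
  | |- computable (fun c => behead _) => refine (comp_behead _)
  | |- computable (fun c => ohead _) => refine (comp_ohead _)
  | |- computable (fun c => foldl _ _ _) => refine (comp_foldl _ _ _)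
  | |- computable (fun c => iter _ _ _) => refine (comp_iter _ _ _)
  | |- computable (fun c => nat_of_bool _) => refine (comp_nat_of_bool _)
  | H : computable ?f |- computable (fun c => ?f _) => refine (comp_comp H _)
  | H : computable2 ?f |- computable (fun c => ?f _ _) => refine (comp_comp2 H _ _)
  | H : computable3 ?f |- computable (fun c => ?f _ _ _) =>
      refine (comp_comp3 H _ _ _)
  | H : computable4 ?f |- computable (fun c => ?f _ _ _ _) =>
      refine (comp_comp4 H _ _ _ _)
  | _ => comp_hook
  | |- computable (fun _ => _) => fail 1
  | |- @computable ?A _ _ _ ?f => change (computable (fun c : A => f c))
  end.

Ltac comp := repeat (unfold computable2, computable3, computable4; cbv beta; comp_step).

Section Lists2.
Context {C T : Type} {cC : coded C} {cT : coded T}.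
Implicit Types s t : C -> seq T.

Lemma comp_rev s : computable s -> computable (fun c => rev (s c)).
Proof.
move=> cs; apply: (@comp_eq _ _ _ _ (fun c => foldl (fun r x => x :: r) [::] (s c))).
  by move=> c; rewrite /rev; elim: (s c) [::] => [|x s' IH] r /=; rewrite ?IH.
by comp.
Qed.

Lemma comp_foldr A (cA : coded A) (f : C -> T -> A -> A) (x : C -> A) s :
  computable3 f ->
  computable x -> computable s ->
  computable (fun c => foldr (f c) (x c) (s c)).
Proof.
move=> cf cx /comp_rev cs.
apply: (@comp_eq _ _ _ _ (fun c => foldl (fun a y => f c y a) (x c) (rev (s c)))).
  by move=> c; rewrite foldl_rev.
by comp.
Qed.

Lemma comp_cat s t :
  computable s -> computable t -> computable (fun c => s c ++ t c).
Proof.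
move=> cs ct; apply: (@comp_eq _ _ _ _ (fun c => foldr (fun x r => x :: r) (t c) (s c))).
  by move=> c; elim: (s c) => //= x s' ->.
by apply: comp_foldr; comp.
Qed.

Lemma comp_map A (cA : coded A) (f : C -> T -> A) s :
  computable2 f -> computable s ->
  computable (fun c => map (f c) (s c)).
Proof.
move=> cf cs; apply: (@comp_eq _ _ _ _
  (fun c => foldr (fun x r => f c x :: r) [::] (s c))).
  by move=> c; elim: (s c) => //= x s' ->.
by apply: comp_foldr; comp.
Qed.

Lemma comp_size s : computable s -> computable (fun c => size (s c)).
Proof.
move=> cs; apply: (@comp_eq _ _ _ _ (fun c => foldr (fun=> S) 0%N (s c))).
  by move=> c; elim: (s c) => //= x s' ->.
by apply: comp_foldr; comp.
Qed.

Lemma comp_drop (n : C -> nat) s :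
  computable n -> computable s -> computable (fun c => drop (n c) (s c)).
Proof.
move=> cn cs; apply: (@comp_eq _ _ _ _ (fun c => iter (n c) behead (s c))).
  by move=> c; elim: (n c) => [|k IH]; rewrite ?drop0 //= IH -drop1 drop_drop.
by comp.
Qed.

Lemma comp_nth (x : C -> T) s (n : C -> nat) :
  computable x -> computable s -> computable n ->
  computable (fun c => nth (x c) (s c) (n c)).
Proof.
move=> cx cs cn; apply: (@comp_eq _ _ _ _
  (fun c => oapp (fun y => y) (x c) (ohead (drop (n c) (s c))))).
  by move=> c; elim: (s c) (n c) => [|y s' IH] [].
have cd := comp_drop cn cs; by comp.
Qed.

Lemma comp_mkseq (f : C -> nat -> T) (n : C -> nat) :
  computable2 f -> computable n ->
  computable (fun c => mkseq (f c) (n c)).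
Proof.
move=> cf cn; apply: (@comp_eq _ _ _ _ (fun c =>
  (iter (n c) (fun p => (p.1.-1, f c p.1.-1 :: p.2)) (n c, [::])).2)).
  move=> c; move: (n c) => m.
  suff H k : (k <= m)%N -> iter k (fun p : nat * seq T =>
      (p.1.-1, f c p.1.-1 :: p.2)) (m, [::]) =
      ((m - k)%N, [seq f c i | i <- iota (m - k) k]).
    by rewrite H // subnn.
  elim: k => [|k IH] km /=; first by rewrite subn0.
  rewrite IH 1?ltnW //= subnS; congr (_, _ :: _).
  by rewrite prednK // subn_gt0.
by comp.
Qed.

Lemma comp_take (n : C -> nat) s :
  computable n -> computable s -> computable (fun c => take (n c) (s c)).
Proof.
move=> cn cs; apply: (@comp_eq _ _ _ _ (fun c =>
  rev (drop (size (s c) - n c) (rev (s c))))).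
  by move=> c; rewrite -rev_take revK.
by apply: comp_rev; apply: comp_drop;
  [apply: comp_sub => //; exact: comp_size | exact: comp_rev].
Qed.

End Lists2.

Section Lists3.
Context {C T : Type} {cC : coded C} {cT : coded T}.

Lemma comp_flatten (s : C -> seq (seq T)) :
  computable s -> computable (fun c => flatten (s c)).
Proof.
move=> cs; apply: (@comp_eq _ _ _ _ (fun c =>
  foldr (fun x r => x ++ r) [::] (s c))) => //.
by apply: comp_foldr; comp; apply: comp_cat; comp.
Qed.

Lemma comp_index_false (s : C -> bits) :
  computable s -> computable (fun c => index false (s c)).
Proof.
move=> cs; apply: (@comp_eq _ _ _ _ (fun c =>
  foldr (fun (b : bool) r => if b then r.+1 else 0%N) 0%N (s c))).
  by move=> c; rewrite /index; elim: (s c) => [|[] s' IH] //=; rewrite IH.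
by apply: comp_foldr; comp.
Qed.

Lemma comp_rcons (s : C -> seq T) (x : C -> T) :
  computable s -> computable x -> computable (fun c => rcons (s c) (x c)).
Proof.
move=> cs cx; apply: (@comp_eq _ _ _ _ (fun c => s c ++ [:: x c])).
  by move=> c; rewrite cats1.
by apply: comp_cat; comp.
Qed.

Lemma comp_nseq (n : C -> nat) (x : C -> T) :
  computable n -> computable x -> computable (fun c => nseq (n c) (x c)).
Proof.
move=> cn cx; apply: (@comp_eq _ _ _ _ (fun c => iter (n c) (cons (x c)) [::])).
  by [].
by comp.
Qed.

End Lists3.

Section Arithmetic.
Context {C : Type} {cC : coded C}.

Lemma comp_iteri T (cT : coded T) (n : C -> nat) (f : C -> nat -> T -> T) (x : C -> T) :
  computable n -> computable3 f -> computable x ->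
  computable (fun c => iteri (n c) (f c) (x c)).
Proof.
move=> cn cf cx; apply: (@comp_eq _ _ _ _ (fun c =>
  (iter (n c) (fun p => (p.1.+1, f c p.1 p.2)) (0%N, x c)).2)).
  move=> c; suff -> : iter (n c) (fun p => (p.1.+1, f c p.1 p.2)) (0%N, x c) =
    (n c, iteri (n c) (f c) (x c)) by [].
  by elim: (n c) => //= k ->.
by comp.
Qed.

Lemma comp_expn (a b : C -> nat) :
  computable a -> computable b -> computable (fun c => a c ^ b c)%N.
Proof.
move=> ca cb; apply: (@comp_eq _ _ _ _ (fun c => iter (b c) (muln (a c)) 1%N)).
  by move=> c; elim: (b c) => //= k ->; rewrite expnS.
by comp.
Qed.

(** For [d = 0] the test never succeeds, in accordance with [m %/ 0 = 0] and [m %% 0 = m]. *)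
Definition divmod_step (d : nat) (p : nat * nat) : nat * nat :=
  if (p.2.+1 == d)%N then (p.1.+1, 0%N) else (p.1, p.2.+1).

Lemma divmod_iter m d : iter m (divmod_step d) (0%N, 0%N) = (m %/ d, m %% d)%N.
Proof.
elim: m => [|m IH]; first by rewrite /= div0n mod0n.
rewrite iterS IH /divmod_step /=; case: d {IH} => [|d].
  by rewrite !divn0 !modn0.
have := divn_eq m d.+1; have := ltn_pmod m (ltn0Sn d).
move: (m %/ d.+1)%N (m %% d.+1)%N => q r rd ->.
case: eqP => [[rE]|re].
  by rewrite rE -addnS -mulSnr mulnK // modnMl.
rewrite -addnS divnMDl // modnMDl.
have h : (r.+1 < d.+1)%N by rewrite ltn_neqAle rd andbT; apply/eqP.
by rewrite divn_small // modn_small // addn0.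
Qed.

Lemma comp_divmod (a b : C -> nat) : computable a -> computable b ->
  computable (fun c => (a c %/ b c, a c %% b c)%N).
Proof.
move=> ca cb; apply: (@comp_eq _ _ _ _ (fun c =>
  iter (a c) (divmod_step (b c)) (0%N, 0%N))).
  by move=> c; rewrite divmod_iter.
by apply: comp_iter; comp; rewrite /divmod_step; comp.
Qed.

Lemma comp_divn (a b : C -> nat) :
  computable a -> computable b -> computable (fun c => a c %/ b c)%N.
Proof. by move=> ca /(comp_divmod ca)/comp_fst. Qed.

Lemma comp_modn (a b : C -> nat) :
  computable a -> computable b -> computable (fun c => a c %% b c)%N.
Proof. by move=> ca /(comp_divmod ca)/comp_snd. Qed.

Definition euclid_step (p : nat * nat) : nat * nat :=
  if (p.2 == 0)%N then p else (p.2, p.1 %% p.2)%N.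

(** The second component decreases strictly until it vanishes, so [b] iterations are enough. *)
Lemma euclid_iter n a b : (b <= n)%N -> (iter n euclid_step (a, b)).1 = gcdn a b.
Proof.
elim: n a b => [|n IH] a b; first by rewrite leqn0 => /eqP->; rewrite gcdn0.
move=> bn; rewrite iterSr /euclid_step /=; case: eqP => [b0|/eqP b0].
  by rewrite b0 -/euclid_step IH.
rewrite -/euclid_step IH; first by rewrite gcdnC gcdn_modl gcdnC.
by rewrite -ltnS; apply: leq_trans bn; rewrite ltn_mod lt0n.
Qed.

End Arithmetic.

Section Arithmetic2.
Context {C : Type} {cC : coded C}.

Lemma comp_gcdn (a b : C -> nat) :
  computable a -> computable b -> computable (fun c => gcdn (a c) (b c)).
Proof.
move=> ca cb; apply: (@comp_eq _ _ _ _ (fun c =>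
  (iter (b c) euclid_step (a c, b c)).1)).
  by move=> c; rewrite euclid_iter.
apply: comp_fst; apply: comp_iter; comp.
rewrite /euclid_step; comp; apply: comp_modn; comp.
Qed.

Lemma comp_all_iota (n : C -> nat) (P : C -> nat -> bool) :
  computable n -> computable2 P ->
  computable (fun c => all (P c) (iota 0 (n c))).
Proof.
move=> cn cP; apply: (@comp_eq _ _ _ _ (fun c =>
  iteri (n c) (fun i b => b && P c i) true)).
  by move=> c; elim: (n c) => // k IH; rewrite -{2}addn1 iotaD all_cat /= IH andbT.
by apply: comp_iteri; comp.
Qed.

Lemma comp_find_iota (n : C -> nat) (P : C -> nat -> bool) :
  computable n -> computable2 P ->
  computable (fun c => find (P c) (iota 0 (n c))).
Proof.
move=> cn cP; apply: (@comp_eq _ _ _ _ (fun c =>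
  foldr (fun i k => if P c i then 0 else k.+1)%N 0%N (mkseq id (n c)))).
  by move=> c; rewrite /mkseq map_id; elim: (iota _ _) => //= i s ->.
apply: comp_foldr; comp; apply: (@comp_mkseq _ _ _ _ (fun _ i => i)); comp.
Qed.

End Arithmetic2.

(** * Integers, rationals and complex rationals *)

Definition int_of (b : bool) (n : nat) : int := if b then (- Posz n)%R else Posz n.

Lemma int_ofK (z : int) : int_of (z < 0)%R `|z| = z.
Proof. by rewrite /int_of; case: (ltP z 0%R) => h; lia. Qed.

#[global] Instance coded_int : coded int :=
  Coded (fun z => enc ((z < 0)%R, `|z|%N)).
#[global] Instance coded_rat : coded rat := Coded (fun x => enc (numq x, denq x)).
#[global] Instance coded_complex T (cT : coded T) : coded T[i] :=
  Coded (fun z => enc (complex.Re z, complex.Im z)).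

Section Numbers.
Context {C : Type} {cC : coded C}.

Lemma comp_recode A B (cA : coded A) (cB : coded B) (f : A -> B) (a : C -> A) :
  (forall x, enc (f x) = enc x) -> computable a -> computable (fun c => f (a c)).
Proof. by move=> fE [g rg gE]; exists g => // c; rewrite gE fE. Qed.

Lemma comp_ltz0 (a : C -> int) : computable a -> computable (fun c => (a c < 0)%R).
Proof.
move=> ca; apply: (comp_fst (a := fun c => ((a c < 0)%R, `|a c|%N))).
exact: (comp_recode (f := fun z : int => ((z < 0)%R, `|z|%N))).
Qed.

Lemma comp_absz (a : C -> int) : computable a -> computable (fun c => `|a c|%N).
Proof.
move=> ca; apply: (comp_snd (a := fun c => ((a c < 0)%R, `|a c|%N))).
exact: (comp_recode (f := fun z : int => ((z < 0)%R, `|z|%N))).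
Qed.

Lemma comp_int_of (b : C -> bool) (n : C -> nat) :
  computable b -> computable n -> computable (fun c => int_of (b c) (n c)).
Proof.
(* The sign bit of zero must be cleared, since the first component of the code of [z] is [z < 0]. *)
move=> cb cn; have [g rg gE] : computable (fun c => (b c && (0 < n c)%N, n c)) by comp.
exists g => // c; rewrite gE /= /int_of; congr (pairn (nat_of_bool _) _).
  by case: (b c); lia.
by case: (b c); lia.
Qed.

Lemma comp_posz (n : C -> nat) : computable n -> computable (fun c => Posz (n c)).
Proof. by move=> cn; apply: (comp_int_of (b := fun=> false)); comp. Qed.

Lemma comp_numq (a : C -> rat) : computable a -> computable (fun c => numq (a c)).
Proof.
move=> ca; apply: (comp_fst (a := fun c => (numq (a c), denq (a c)))).
exact: (comp_recode (f := fun x => (numq x, denq x))).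
Qed.

Lemma comp_denq (a : C -> rat) : computable a -> computable (fun c => denq (a c)).
Proof.
move=> ca; apply: (comp_snd (a := fun c => (numq (a c), denq (a c)))).
exact: (comp_recode (f := fun x => (numq x, denq x))).
Qed.

Lemma comp_Re T (cT : coded T) (a : C -> T[i]) :
  computable a -> computable (fun c => complex.Re (a c)).
Proof.
move=> ca; apply: (comp_fst (a := fun c => (complex.Re (a c), complex.Im (a c)))).
exact: (comp_recode (f := fun x => (complex.Re x, complex.Im x))).
Qed.

Lemma comp_Im T (cT : coded T) (a : C -> T[i]) :
  computable a -> computable (fun c => complex.Im (a c)).
Proof.
move=> ca; apply: (comp_snd (a := fun c => (complex.Re (a c), complex.Im (a c)))).
exact: (comp_recode (f := fun x => (complex.Re x, complex.Im x))).
Qed.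

Lemma comp_Complex T (cT : coded T) (a b : C -> T) :
  computable a -> computable b -> computable (fun c => Complex (a c) (b c)).
Proof.
move=> ca cb.
exact: (comp_recode (f := fun p => Complex p.1 p.2) _ (comp_pair ca cb)).
Qed.

End Numbers.

Lemma enc_int_inj : injective (enc : int -> nat).
Proof.
move=> x y /= e; have := congr1 fstn e; have := congr1 sndn e.
rewrite !pairnK1 !pairnK2; lia.
Qed.

Lemma enc_rat_inj : injective (enc : rat -> nat).
Proof.
move=> x y e; have := congr1 fstn e; have := congr1 sndn e.
rewrite !pairnK1 !pairnK2 => /enc_int_inj /= de /enc_int_inj /= ne.
by rewrite -[x]divq_num_den -[y]divq_num_den de ne.
Qed.

Lemma enc_crat_inj : injective (enc : rat[i] -> nat).
Proof.
move=> [a b] [c d] e; have := congr1 fstn e; have := congr1 sndn e.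
by rewrite !pairnK1 !pairnK2 => /enc_rat_inj /= -> /enc_rat_inj /= ->.
Qed.

Ltac comp_hook ::=
  match goal with
  | |- computable (fun c => (_ < 0)%R) => refine (comp_ltz0 _)
  | |- computable (fun c => absz _) => refine (comp_absz _)
  | |- computable (fun c => int_of _ _) => refine (comp_int_of _ _)
  | |- computable (fun c => Posz _) => refine (comp_posz _)
  | |- computable (fun c => numq _) => refine (comp_numq _)
  | |- computable (fun c => denq _) => refine (comp_denq _)
  | |- computable (fun c => complex.Re _) => refine (comp_Re _)
  | |- computable (fun c => complex.Im _) => refine (comp_Im _)
  | |- computable (fun c => Complex _ _) => refine (comp_Complex _ _)
  | |- computable (fun c => divn _ _) => refine (comp_divn _ _)
  | |- computable (fun c => modn _ _) => refine (comp_modn _ _)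
  | |- computable (fun c => gcdn _ _) => refine (comp_gcdn _ _)
  | |- computable (fun c => expn _ _) => refine (comp_expn _ _)
  | |- computable (fun c => _ ++ _) => refine (comp_cat _ _)
  | |- computable (fun c => size _) => refine (comp_size _)
  | |- computable (fun c => foldr _ _ _) => refine (comp_foldr _ _ _)
  | |- computable (fun c => map _ _) => refine (comp_map _ _)
  | |- computable (fun c => rev _) => refine (comp_rev _)
  | |- computable (fun c => nth _ _ _) => refine (comp_nth _ _ _)
  | |- computable (fun c => take _ _) => refine (comp_take _ _)
  | |- computable (fun c => drop _ _) => refine (comp_drop _ _)
  | |- computable (fun c => flatten _) => refine (comp_flatten _)
  | |- computable (fun c => rcons _ _) => refine (comp_rcons _ _)
  | |- computable (fun c => nseq _ _) => refine (comp_nseq _ _)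
  | |- computable (fun c => mkseq _ _) => refine (comp_mkseq _ _)
  | |- computable (fun c => iteri _ _ _) => refine (comp_iteri _ _ _)
  | |- computable (fun c => all _ (iota 0 _)) => refine (comp_all_iota _ _)
  | |- computable (fun c => find _ (iota 0 _)) => refine (comp_find_iota _ _)
  | |- computable (fun c => index false _) => refine (comp_index_false _)
  | |- computable (fun c => enc _) => refine (comp_enc _)
  end.

Local Open Scope ring_scope.

Definition rat_frac (a b : int) : rat := a%:~R / b%:~R.

(** Codes of rationals contain the reduced fraction. Arithmetic therefore ends with a division by
    the gcd, whose result is identified here with [numq] and [denq]. *)
Lemma rat_fracE (a b : int) : b != 0 ->
  let g := gcdn `|a| `|b| in
  numq (rat_frac a b) = int_of ((a < 0) (+) (b < 0)) (`|a| %/ g)%N /\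
  denq (rat_frac a b) = (`|b| %/ g)%N.
Proof.
move=> b0 g; have b0' : (0 < `|b|)%N by rewrite absz_gt0.
have g0 : (0 < g)%N by rewrite gcdn_gt0 b0' orbT.
have /dvdnP[a' aE] : (g %| `|a|)%N by exact: dvdn_gcdl.
have /dvdnP[b' bE] : (g %| `|b|)%N by exact: dvdn_gcdr.
have b'0 : (0 < b')%N by move: b0'; rewrite bE muln_gt0 => /andP[].
have cop : coprime a' b'.
  rewrite /coprime -(eqn_pmul2r g0) mul1n muln_gcdl -aE -bE.
  by rewrite -/g.
have -> : rat_frac a b = (int_of ((a < 0) (+) (b < 0)) a')%:~R / (b'%:Z)%:~R.
  have aE' : a = int_of (a < 0) (a' * g) by rewrite -aE int_ofK.
  have bE' : b = int_of (b < 0) (b' * g) by rewrite -bE int_ofK.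
  have h1 : (b'%:R : rat) != 0 by rewrite pnatr_eq0 -lt0n.
  have h2 : (g%:R : rat) != 0 by rewrite pnatr_eq0 -lt0n.
  rewrite /rat_frac {1}aE' {1}bE' /int_of.
  case: (a < 0); case: (b < 0); rewrite /= ?mulrNz ?PoszM ?intrM;
    rewrite -!pmulrn; field; by rewrite ?h1 ?h2.
have cop' : coprime `|int_of ((a < 0) (+) (b < 0)) a'| `|b'%:Z|.
  by rewrite /int_of; case: (_ (+) _); rewrite ?abszN.
rewrite coprimeq_num // coprimeq_den // aE bE !mulnK //.
rewrite gtr0_sg ?ltz_nat // mul1r; split=> //.
by rewrite eqz_nat gtn_eqF.
Qed.

Section Rationals.
Context {C : Type} {cC : coded C}.

Lemma comp_addz (a b : C -> int) :
  computable a -> computable b -> computable (fun c => a c + b c).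
Proof.
move=> ca cb.
pose pos (z : int) := if z < 0 then 0%N else `|z|%N.
pose neg (z : int) := if z < 0 then `|z|%N else 0%N.
apply: (@comp_eq _ _ _ _ (fun c =>
  let p := (pos (a c) + pos (b c))%N in let n := (neg (a c) + neg (b c))%N in
  if (n <= p)%N then int_of false (p - n)%N else int_of true (n - p)%N)).
  move=> c; rewrite /pos /neg /int_of /=.
  by case: (ltP (a c) 0) => ?; case: (ltP (b c) 0) => ?; case: leqP => ? /=; lia.
by rewrite /pos /neg; comp.
Qed.

Lemma comp_mulz (a b : C -> int) :
  computable a -> computable b -> computable (fun c => a c * b c).
Proof.
move=> ca cb.
apply: (@comp_eq _ _ _ _ (fun c =>
  int_of (if a c < 0 then ~~ (b c < 0) else b c < 0) (`|a c| * `|b c|)%N)).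
  move=> c; rewrite /int_of.
  by case: (ltP (a c) 0) => ?; case: (ltP (b c) 0) => ? /=; nia.
by comp.
Qed.

Lemma comp_oppz (a : C -> int) : computable a -> computable (fun c => - a c).
Proof.
move=> ca; apply: (@comp_eq _ _ _ _ (fun c => int_of (~~ (a c < 0)) `|a c|)).
  by move=> c; rewrite /int_of; case: (ltP (a c) 0) => ? /=; lia.
by comp.
Qed.

Lemma comp_rat_frac (a b : C -> int) :
  computable a -> computable b -> computable (fun c => rat_frac (a c) (b c)).
Proof.
move=> ca cb.
(* A zero denominator gives the rational 0, whose reduced fraction is 0 / 1. *)
pose f (c : C) : int * int := if (`|b c| == 0)%N then (0, 1) else
  (int_of (if a c < 0 then ~~ (b c < 0) else b c < 0)
     (`|a c| %/ gcdn `|a c| `|b c|)%N,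
   (`|b c| %/ gcdn `|a c| `|b c|)%N%:Z).
have [g rg gE] : computable f by rewrite /f; comp.
exists g => // c; rewrite gE /f; case: eqP => [/eqP|].
  by rewrite absz_eq0 => /eqP ->; rewrite /rat_frac invr0 mulr0.
move=> /eqP; rewrite absz_eq0 => b0; have [nE dE] := rat_fracE (a c) b0.
rewrite [RHS](_ : _ = enc (numq (rat_frac (a c) (b c)), denq (rat_frac (a c) (b c)))) //.
by rewrite nE dE; case: (a c < 0).
Qed.

End Rationals.

Section Rationals2.
Context {C : Type} {cC : coded C}.

Lemma comp_addq (a b : C -> rat) :
  computable a -> computable b -> computable (fun c => a c + b c).
Proof.
move=> ca cb; apply: (@comp_eq _ _ _ _ (fun c => rat_frac
  (numq (a c) * denq (b c) + numq (b c) * denq (a c)) (denq (a c) * denq (b c)))).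
  move=> c; rewrite /rat_frac rmorphD /= !rmorphM /= -[in RHS](divq_num_den (a c)).
  by rewrite -[in RHS](divq_num_den (b c)) addf_div ?intr_eq0.
apply: comp_rat_frac; last by apply: comp_mulz; comp.
by apply: comp_addz; apply: comp_mulz; comp.
Qed.

Lemma comp_mulq (a b : C -> rat) :
  computable a -> computable b -> computable (fun c => a c * b c).
Proof.
move=> ca cb; apply: (@comp_eq _ _ _ _ (fun c => rat_frac
  (numq (a c) * numq (b c)) (denq (a c) * denq (b c)))).
  move=> c; rewrite /rat_frac !rmorphM /= -[in RHS](divq_num_den (a c)).
  by rewrite -[in RHS](divq_num_den (b c)) mulf_div.
by apply: comp_rat_frac; apply: comp_mulz; comp.
Qed.

Lemma comp_oppq (a : C -> rat) : computable a -> computable (fun c => - a c).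
Proof.
move=> ca; apply: (@comp_eq _ _ _ _ (fun c => rat_frac (- numq (a c)) (denq (a c)))).
  move=> c; rewrite /rat_frac rmorphN /= -[in RHS](divq_num_den (a c)).
  by rewrite mulNr.
by apply: comp_rat_frac; first apply: comp_oppz; comp.
Qed.

Lemma comp_natq (n : C -> nat) :
  computable n -> computable (fun c => (n c)%:R : rat).
Proof.
move=> cn; apply: (@comp_eq _ _ _ _ (fun c => rat_frac (Posz (n c)) 1)).
  by move=> c; rewrite /rat_frac divr1.
by apply: comp_rat_frac; comp.
Qed.

Lemma comp_invq (a : C -> rat) : computable a -> computable (fun c => (a c)^-1).
Proof.
move=> ca; apply: (@comp_eq _ _ _ _ (fun c => rat_frac (denq (a c)) (numq (a c)))).
  by move=> c; rewrite /rat_frac -[in RHS](divq_num_den (a c)) invf_div.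
by apply: comp_rat_frac; comp.
Qed.

End Rationals2.

Section ComplexRationals.
Context {C : Type} {cC : coded C}.

Lemma comp_addC (a b : C -> rat[i]) :
  computable a -> computable b -> computable (fun c => a c + b c).
Proof.
move=> ca cb; apply: (@comp_eq _ _ _ _ (fun c => Complex
  (complex.Re (a c) + complex.Re (b c)) (complex.Im (a c) + complex.Im (b c)))).
  by move=> c; case: (a c); case: (b c).
by apply: comp_Complex; apply: comp_addq; comp.
Qed.

Lemma comp_mulC (a b : C -> rat[i]) :
  computable a -> computable b -> computable (fun c => a c * b c).
Proof.
move=> ca cb; apply: (@comp_eq _ _ _ _ (fun c => Complex
  (complex.Re (a c) * complex.Re (b c) + - (complex.Im (a c) * complex.Im (b c)))
  (complex.Re (a c) * complex.Im (b c) + complex.Im (a c) * complex.Re (b c)))).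
  by move=> c; case: (a c) => x y; case: (b c).
apply: comp_Complex; apply: comp_addq; [|apply: comp_oppq|..];
  by apply: comp_mulq; comp.
Qed.

Lemma comp_conjc (a : C -> rat[i]) : computable a -> computable (fun c => conjc (a c)).
Proof.
move=> ca; apply: (@comp_eq _ _ _ _ (fun c => Complex
  (complex.Re (a c)) (- complex.Im (a c)))).
  by move=> c; case: (a c).
by apply: comp_Complex; last apply: comp_oppq; comp.
Qed.

(* A sum over ordinals, in a form whose general term is a function on [nat]. *)
Definition sum_upto (n : nat) (f : nat -> rat[i]) : rat[i] := \sum_(i < n) f i.

End ComplexRationals.

Section ComplexRationals2.
Context {C : Type} {cC : coded C}.

Lemma comp_sum_upto (n : C -> nat) (f : C -> nat -> rat[i]) :
  computable n -> computable2 f -> computable (fun c => sum_upto (n c) (f c)).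
Proof.
move=> cn cf; apply: (@comp_eq _ _ _ _ (fun c => iteri (n c) (fun i r => r + f c i) 0)).
  move=> c; rewrite /sum_upto; elim: (n c) => [|k IH]; first by rewrite big_ord0.
  by rewrite big_ord_recr /= IH.
by comp; apply: comp_addC; comp.
Qed.

End ComplexRationals2.

Lemma comp_eqC C (cC : coded C) (a b : C -> rat[i]) :
  computable a -> computable b -> computable (fun c => a c == b c).
Proof. by move=> ca cb; apply: comp_code_eq => //; exact: enc_crat_inj. Qed.

Ltac comp_ring :=
  match goal with
  | |- computable (fun c => GRing.add _ _ : rat[i]) => refine (comp_addC _ _)
  | |- computable (fun c => GRing.mul _ _ : rat[i]) => refine (comp_mulC _ _)
  | |- computable (fun c => conjc _) => refine (comp_conjc _)
  | |- computable (fun c => sum_upto _ _) => refine (comp_sum_upto _ _)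
  | |- computable (fun c => (_%:R : rat)) => refine (comp_natq _)
  | |- computable (fun c => (_^-1 : rat)) => refine (comp_invq _)
  | |- computable (fun c => rat_frac _ _) => refine (comp_rat_frac _ _)
  | |- computable (fun c => (_ == _ :> rat[i])) => refine (comp_eqC _ _)
  end.

(** * Strings, machines and readers *)

Lemma nat_of_bits_incr s : nat_of_bits (incr_bits s) = (nat_of_bits s).+1.
Proof.
by elim: s => //= -[] s IH //=; rewrite IH !add1n add0n doubleS.
Qed.

Lemma bits_of_natK : cancel bits_of_nat nat_of_bits.
Proof. by elim=> // n IH; rewrite /bits_of_nat iterS nat_of_bits_incr -{2}IH. Qed.

Lemma nat_of_bits_inj : injective nat_of_bits.
Proof.
elim=> [|b s IH] [|b' s'] //= -[] e.
have eb : b = b'.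
  by have := congr1 odd e; rewrite !oddD !odd_double !addbF !oddb.
by rewrite -eb in e *; move/addnI/double_inj/IH: e => ->.
Qed.

Lemma nat_of_bitsK : cancel nat_of_bits bits_of_nat.
Proof. by move=> s; apply: nat_of_bits_inj; rewrite bits_of_natK. Qed.

Section BitsComputable.
Context {C : Type} {cC : coded C}.

Lemma comp_nat_of_bits (s : C -> bits) :
  computable s -> computable (fun c => nat_of_bits (s c)).
Proof.
move=> cs; apply: (@comp_eq _ _ _ _ (fun c =>
  foldr (fun (b : bool) n => (nat_of_bool b + (n + n)).+1)%N 0%N (s c))).
  by move=> c; elim: (s c) => //= b s' ->; rewrite addnn.
by comp.
Qed.

(** The carry runs through the leading [true] digits up to the first [false]. This form, unlike the
    fixpoint, is made of operations that have closure lemmas. *)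
Lemma incr_bitsE s : incr_bits s = nseq (index false s) false ++
  (if (index false s < size s)%N then true :: drop (index false s).+1 s
   else [:: false]).
Proof. by rewrite /index; elim: s => //= -[] s IH /=; rewrite ?drop0 // IH. Qed.

Lemma comp_incr_bits (s : C -> bits) :
  computable s -> computable (fun c => incr_bits (s c)).
Proof. by move=> cs; apply: comp_eq (fun c => esym (incr_bitsE (s c))) _; comp. Qed.

End BitsComputable.

Section BitsComputable2.
Context {C : Type} {cC : coded C}.

Lemma comp_bits_of_nat (n : C -> nat) :
  computable n -> computable (fun c => bits_of_nat (n c)).
Proof.
move=> cn; rewrite /bits_of_nat; comp.
by apply: comp_incr_bits; comp.
Qed.

End BitsComputable2.

Section Machines.

(** A control receives strings coded by [nat_of_bits], whereas [computable] codes them as lists by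
    [enc]. Composing with [bits_of_nat], itself computable, bridges the two. *)
Lemma control_of_computable (D : nat -> bits -> bits -> bits -> nat) :
  computable4 D -> exists M : machine, forall t y c w,
    control M [tuple t; nat_of_bits y; nat_of_bits c; nat_of_bits w] = D t y c w.
Proof.
move=> cD; pose E t y c w := D t (bits_of_nat y) (bits_of_nat c) (bits_of_nat w).
have [g rg gE] : computable4 E.
  by rewrite /E; comp; apply: comp_bits_of_nat; comp.
pose f (v : 4.-tuple nat) := g (pairn (pairn (pairn (tnth v (inord 0))
  (tnth v (inord 1))) (tnth v (inord 2))) (tnth v (inord 3))).
have rf : recursive f.
  apply: (rec1_app rg); do 3![apply: (rec2_app rec2_pairn); last rec_proj].
  rec_proj.
exists (Machine rf) => t y c w /=.
rewrite /f !(tnth_nth 0%N) !inordK //=.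
by rewrite (gE (t, nat_of_bits y, nat_of_bits c, nat_of_bits w)) /E /= !nat_of_bitsK.
Qed.

Definition control_on (M : machine) t y c w :=
  control M [tuple t; nat_of_bits y; nat_of_bits c; nat_of_bits w].

Lemma comp_control M : computable4 (control_on M).
Proof.
have [g rg gE] : computable (fun p : nat * bits * bits * bits =>
  (p.1.1.1, nat_of_bits p.1.1.2, nat_of_bits p.1.2, nat_of_bits p.2)).
  by comp; apply: comp_nat_of_bits; comp.
have rM := control_recursive M.
exists (fun n => control M [tuple fstn (fstn (fstn (g n)));
  sndn (fstn (fstn (g n))); sndn (fstn (g n)); sndn (g n)]).
  by apply: recursive_app4 => //; do ?[exact: rg | apply: (rec1_app rec1_fstn)
    | apply: (rec1_app rec1_sndn)].
by move=> p; rewrite gE /= !(pairnK1, pairnK2).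
Qed.

End Machines.

#[global] Instance coded_config : coded config :=
  Coded (fun c => enc (clock c, consumed c, written c)).

Section Configs.
Context {C : Type} {cC : coded C}.

Lemma comp_config (a : C -> config) : computable a ->
  computable (fun c => (clock (a c), consumed (a c), written (a c))).
Proof. exact: (comp_recode (f := fun c => (clock c, consumed c, written c))). Qed.

Lemma comp_clock (a : C -> config) : computable a -> computable (fun c => clock (a c)).
Proof. by move=> /comp_config/comp_fst/comp_fst. Qed.

Lemma comp_consumed (a : C -> config) :
  computable a -> computable (fun c => consumed (a c)).
Proof. by move=> /comp_config/comp_fst/comp_snd. Qed.

Lemma comp_written (a : C -> config) :
  computable a -> computable (fun c => written (a c)).
Proof. by move=> /comp_config/comp_snd. Qed.

Lemma comp_Config (t : C -> nat) (c w : C -> bits) :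
  computable t -> computable c -> computable w ->
  computable (fun x => Config (t x) (c x) (w x)).
Proof.
move=> ct cc cw.
exact: (comp_recode (f := fun p => Config p.1.1 p.1.2 p.2) _
  (comp_pair (comp_pair ct cc) cw)).
Qed.

End Configs.

Ltac comp_bits :=
  match goal with
  | |- computable (fun c => clock _) => refine (comp_clock _)
  | |- computable (fun c => consumed _) => refine (comp_consumed _)
  | |- computable (fun c => written _) => refine (comp_written _)
  | |- computable (fun c => Config _ _ _) => refine (comp_Config _ _ _)
  | |- computable (fun c => nat_of_bits _) => refine (comp_nat_of_bits _)
  | |- computable (fun c => bits_of_nat _) => refine (comp_bits_of_nat _)
  end.

Ltac compb := repeat (unfold computable2, computable3, computable4; cbv beta;
  first [comp_step | comp_bits | comp_ring]).

Definition action_code (M : machine) y (c : config) :=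
  control_on M (clock c) y (consumed c) (written c).

Lemma stepE M y p c : step M y p c =
  if action_code M y c == 0%N then c else
  if action_code M y c == 1%N then
    if (size (consumed c) < size p)%N
    then Config (clock c).+1 (take (size (consumed c)).+1 p) (written c) else c
  else Config (clock c).+1 (consumed c)
    (if action_code M y c == 2%N then rcons (written c) false else
     if action_code M y c == 3%N then rcons (written c) true else written c).
Proof.
rewrite /step /next_action -/(control_on M (clock c) y (consumed c) (written c)).
by rewrite -/(action_code M y c); case: (action_code M y c) => [|[|[|[|k]]]].
Qed.

Lemma comp_run M : computable3 (fun y p t => run M y p t).
Proof.
have ca : computable2 (action_code M).
  by have cM := comp_control M; rewrite /action_code; compb.
have cs : computable3 (step M).
  by apply: comp_eq (fun q => esym (stepE M q.1.1 q.1.2 q.2)) _; compb.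
by rewrite /run; compb.
Qed.

Lemma comp_action M : computable2 (action_code M).
Proof. by have cM := comp_control M; rewrite /action_code; compb. Qed.

(* A parser reads a value off the front of a string and returns the rest; on a
   proper prefix of a code word it must fail. *)
Definition parser A := bits -> option (A * bits).

Definition parses A (rd : parser A) (w : bits) (v : A) :=
  (forall s, rd (w ++ s) = Some (v, s)) /\
  (forall s, prefix s w -> s != w -> rd s = None).

Definition parser_bind A B (rd : parser A) (k : A -> parser B) : parser B :=
  fun s => oapp (fun p => k p.1 p.2) None (rd s).

Definition parser_map A B (f : A -> B) (rd : parser A) : parser B :=
  fun s => oapp (fun p => Some (f p.1, p.2)) None (rd s).

Lemma prefix_catP (T : eqType) (s u v : seq T) : prefix s (u ++ v) ->
  (prefix s u && (s != u)) \/ (exists2 t, s = u ++ t & prefix t v).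
Proof.
case/prefixP=> r /esym e; case: (leqP (size u) (size s)) => h.
  right; exists (drop (size u) s).
    by rewrite -{1}(cat_take_drop (size u) s); congr (_ ++ _);
      rewrite -(takel_cat r h) e take_size_cat.
  apply/prefixP; exists r; have := congr1 (drop (size u)) e.
  rewrite [drop _ (u ++ v)]drop_size_cat // drop_cat; case: ltnP => [_ <- //|h2] <-.
  have -> : size u = size s by lia.
  by rewrite subnn drop0 drop_size.
left; apply/andP; split; last by apply: contraTneq h => ->; rewrite ltnn.
apply/prefixP; exists (drop (size s) u).
rewrite -{1}(cat_take_drop (size s) u); congr (_ ++ _).
by rewrite -(takel_cat v (ltnW h)) -e take_size_cat.
Qed.

Lemma parses_bind A B (rd : parser A) (k : A -> parser B) w v w' v' :
  parses rd w v -> parses (k v) w' v' -> parses (parser_bind rd k) (w ++ w') v'.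
Proof.
move=> [h1 h2] [k1 k2]; split=> [s|s].
  by rewrite /parser_bind -catA h1 /= k1.
move=> /prefix_catP[/andP[sw sw']|[t -> tw']] ne; first by rewrite /parser_bind h2.
by rewrite /parser_bind h1 /= k2 //; apply: contraNneq ne => ->.
Qed.

Lemma parses_map A B (f : A -> B) (rd : parser A) w v :
  parses rd w v -> parses (parser_map f rd) w (f v).
Proof. by move=> [h1 h2]; split=> s *; rewrite /parser_map ?h1 ?h2. Qed.

Definition read_bit : parser bool :=
  fun s => oapp (fun b => Some (b, behead s)) None (ohead s).

Lemma parses_bit b : parses read_bit [:: b] b.
Proof. by split=> // -[|b' s] //= /andP[/eqP->]; case: s; rewrite ?eqxx. Qed.

Definition read_nat : parser nat := fun s =>
  if (index false s < size s)%N then Some (index false s, drop (index false s).+1 s)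
  else None.

Lemma parses_nat n : parses read_nat (code_nat n) n.
Proof.
have iE k s : index false (nseq k true ++ s) = (k + index false s)%N.
  by rewrite /index; elim: k => //= k ->.
split=> s.
  rewrite /read_nat /code_nat -catA iE /= addn0 size_cat size_nseq /=.
  by rewrite -{1}(addn0 n) ltn_add2l /= drop_cat size_nseq ltnNge leqnSn /= subSnn /= drop0.
move=> /prefix_catP[/andP[sw _] _|[t -> /=]].
  rewrite /read_nat index_mem; case: ifP => // fs; case/prefixP: sw => r e.
  have : false \in nseq n true by rewrite e mem_cat fs.
  by rewrite mem_nseq andbF.
case: t => [|b t] /=; last by case: t => [|? ?] /andP[/eqP-> //]; rewrite eqxx.
by rewrite cats0 /read_nat index_mem mem_nseq andbF.
Qed.

Definition read_int : parser int := parser_bind read_bit (fun b =>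
  parser_map (fun n => if b then int_of true n.+1 else int_of false n) read_nat).

Lemma parses_int z : parses read_int (code_int z) z.
Proof.
case: z => n; apply: (parses_bind (w := [:: _]) (parses_bit _)).
  exact: (parses_map (fun n => int_of false n) (parses_nat n)).
have := parses_map (fun n => int_of true n.+1) (parses_nat n).
by rewrite /= /int_of NegzE.
Qed.

Definition read_rat : parser rat :=
  parser_bind read_int (fun a => parser_map (rat_frac a) read_int).

Lemma parses_rat x : parses read_rat (code_rat x) x.
Proof.
apply: (parses_bind (parses_int _)); rewrite -[X in parses _ _ X]divq_num_den.
exact: parses_map (parses_int _).
Qed.

Definition read_crat : parser rat[i] :=
  parser_bind read_rat (fun a => parser_map (Complex a) read_rat).

Lemma parses_crat z : parses read_crat (code_crat z) z.
Proof.
apply: (parses_bind (parses_rat _)).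
by case: z => a b; apply: (parses_map (Complex a) (parses_rat b)).
Qed.

Definition read_seq A (rd : parser A) n : parser (seq A) :=
  iter n (fun p => parser_bind p (fun vs => parser_map (rcons vs) rd)) (fun s => Some ([::], s)).

Lemma parses_seq A (rd : parser A) (code : A -> bits) vs :
  (forall v, parses rd (code v) v) ->
  parses (read_seq rd (size vs)) (flatten (map code vs)) vs.
Proof.
move=> h; elim/last_ind: vs => [|vs v IH].
  by split=> // s; rewrite prefixs0 => /eqP->; rewrite eqxx.
rewrite size_rcons map_rcons -cats1 flatten_cat [flatten [:: _]]/= cats0.
exact: parses_bind IH (parses_map _ (h v)).
Qed.

Definition code_entries m n (es : seq rat[i]) : bits :=
  code_nat m ++ code_nat n ++ flatten (map code_crat es).

Definition mx_entries m n (A : 'M[rat[i]]_(m, n)) : seq rat[i] :=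
  flatten [seq [seq A i j | j <- enum 'I_n] | i <- enum 'I_m].

Lemma code_mxE m n (A : 'M[rat[i]]_(m, n)) :
  code_mx A = code_entries m n (mx_entries A).
Proof.
rewrite /code_mx /code_entries /mx_entries map_flatten; congr (_ ++ (_ ++ _)).
rewrite -map_comp; elim: (enum 'I_m) => //= i s ->.
by rewrite flatten_cat -map_comp.
Qed.

Lemma size_mx_entries m n (A : 'M[rat[i]]_(m, n)) : size (mx_entries A) = (m * n)%N.
Proof.
rewrite /mx_entries size_flatten /shape -map_comp /=.
rewrite (eq_map (g := fun=> n)); last by move=> i /=; rewrite size_map size_enum_ord.
rewrite -[in RHS](size_enum_ord m).
by elim: (enum 'I_m) => //= i s ->; rewrite mulSn.
Qed.

Lemma nth_mx_entries m n (A : 'M[rat[i]]_(m, n)) (i : 'I_m) (j : 'I_n) :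
  nth 0%R (mx_entries A) (i * n + j) = A i j.
Proof.
have H (s : seq 'I_m) (k : nat) (i0 : 'I_m) : (k < size s)%N ->
    nth 0%R (flatten [seq [seq A i j | j <- enum 'I_n] | i <- s]) (k * n + j) =
    A (nth i0 s k) j.
  elim: s k => // i' s IH [|k] /= ks; rewrite nth_cat size_map size_enum_ord.
    by rewrite mul0n add0n ltn_ord (nth_map j) ?size_enum_ord ?ltn_ord // nth_ord_enum.
  by rewrite mulSn -addnA ltnNge leq_addr /= addKn IH.
by rewrite /mx_entries (H _ _ i) ?size_enum_ord // nth_ord_enum.
Qed.

Definition read_mx : parser (seq rat[i]) :=
  parser_bind read_nat (fun m => parser_bind read_nat (fun n => read_seq read_crat (m * n))).

Lemma parses_mx m n es :
  size es = (m * n)%N -> parses read_mx (code_entries m n es) es.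
Proof.
move=> e; apply: parses_bind (parses_nat m) _; apply: parses_bind (parses_nat n) _.
by rewrite -e; apply: parses_seq; exact: parses_crat.
Qed.

Lemma code_mx_inj m n : injective (@code_mx m n).
Proof.
move=> A B; rewrite !code_mxE => e.
have [h _] := parses_mx (size_mx_entries A).
have [h' _] := parses_mx (size_mx_entries B).
have := h [::]; rewrite e h' => -[] ee.
by apply/matrixP => i j; rewrite -!nth_mx_entries ee.
Qed.

Lemma size_code_mx m n (A : 'M[rat[i]]_(m, n)) : (0 < size (code_mx A))%N.
Proof. by rewrite /code_mx /code_nat !size_cat !size_nseq addn1. Qed.

Definition read_all A (rd : parser A) (s : bits) : seq A :=
  (iter (size s) (fun p : seq A * bits =>
     oapp (fun q => (rcons p.1 q.1, q.2)) p (rd p.2)) ([::], s)).1.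

(** Applied to the output that [U] has written so far. The parser fails on an incomplete code at the
    end, which is thus ignored, and the maximality of [j] says that no complete code is missed.
    Codes are nonempty, so the size of the string is enough fuel. *)
Lemma read_all_prefix A (rd : parser A) (code : A -> bits) (vs : seq A)
    (s : bits) :
  rd [::] = None -> (forall v, 0 < size (code v))%N ->
  (forall i, (i < size vs)%N -> forall x0, parses rd (code (nth x0 vs i)) (nth x0 vs i)) ->
  prefix s (flatten (map code vs)) ->
  exists2 j, (j <= size vs)%N & read_all rd s = take j vs /\
    forall k, (k <= size vs)%N -> prefix (flatten (map code (take k vs))) s ->
    (k <= j)%N.
Proof.
move=> rd0 code0; rewrite /read_all; set step := fun p : seq A * bits => _.
suff H acc n : (size s <= n)%N ->
    (forall i, (i < size vs)%N -> forall x0, parses rd (code (nth x0 vs i)) (nth x0 vs i)) ->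
    prefix s (flatten (map code vs)) ->
    exists2 j, (j <= size vs)%N & (iter n step (acc, s)).1 = acc ++ take j vs /\
    forall k, (k <= size vs)%N -> prefix (flatten (map code (take k vs))) s ->
    (k <= j)%N.
  by move=> h1 h2; exact: (H [::]).
have stuck a t m : rd t = None -> iter m step (a, t) = (a, t).
  by move=> e; elim: m => //= m ->; rewrite /step /= e.
elim: vs s acc n => [|v vs IH] s acc n sn hp.
  rewrite prefixs0 => /eqP->; exists 0%N => //.
  by rewrite stuck // take0 cats0; split=> // k; rewrite leqn0 => /eqP->.
have hv := hp 0%N (ltn0Sn _) v; move=> /prefix_catP[/andP[sv ne]|[t sE tp]].
  exists 0%N => //; rewrite take0 cats0; case: hv => _ hv; rewrite stuck ?hv //.
  split=> // -[|k] //= _ /prefixP[r e]; exfalso.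
  have ge : (size (code v) <= size s)%N by rewrite e !size_cat -addnA leq_addr.
  by move: sv ne; rewrite prefixE take_oversize // eq_sym => ->.
case: n sn => [|n] sn.
  by move: sn; rewrite sE size_cat leqn0 addn_eq0 => /andP[/eqP c0]; have := code0 v; rewrite c0.
have tn : (size t <= n)%N.
  by rewrite -ltnS (leq_trans _ sn) // sE size_cat -add1n leq_add2r code0.
have [i|j jvs [jE jmax]] := IH t (rcons acc v) n tn _ tp; first exact: (hp i.+1).
exists j.+1 => //; split.
  by rewrite iterSr {2}/step /= sE hv.1 /= jE cat_rcons.
case=> [|k] //= kvs; rewrite sE => /prefixP[r]; rewrite -catA => /eqP; rewrite eqseq_cat // eqxx /= => /eqP e.
by rewrite ltnS; apply: jmax => //; apply/prefixP; exists r.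
Qed.

(** * Runs of a machine on an input and on its prefixes *)

Section Runs.
Variables (M : machine) (y : bits).
Implicit Types (p q s w : bits) (t : nat).

Local Notation act := (action_code M y).

Lemma next_actionE c : next_action M y c = action_of_nat (act c).
Proof. by []. Qed.

Lemma next_action_halt c : next_action M y c = Halt -> act c = 0%N.
Proof. by rewrite next_actionE; case: (act c) => [|[|[|[|]]]]. Qed.

Lemma runS p t : run M y p t.+1 = step M y p (run M y p t).
Proof. exact: iterS. Qed.

Lemma run_fixed p t t' : step M y p (run M y p t) = run M y p t -> (t <= t')%N ->
  run M y p t' = run M y p t.
Proof.
move=> e /subnK <-; rewrite /run iterD -/(run M y p t).
by elim: (t' - t)%N => //= k ->.
Qed.

Lemma step_halt p c : act c = 0%N -> step M y p c = c.
Proof. by rewrite stepE => ->. Qed.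

Lemma step_blocked p c : act c = 1%N -> (size p <= size (consumed c))%N ->
  step M y p c = c.
Proof. by rewrite stepE => -> /=; rewrite ltnNge => ->. Qed.

Lemma prefix_take (T : eqType) (s : seq T) k : prefix (take k s) s.
Proof. by apply/prefixP; exists (drop k s); rewrite cat_take_drop. Qed.

Lemma prefix_eq_take (T : eqType) (s u : seq T) : prefix s u -> s = take (size s) u.
Proof. by rewrite prefixE => /eqP. Qed.

Lemma prefix_antisym (T : eqType) (s u : seq T) :
  prefix s u -> (size u <= size s)%N -> s = u.
Proof. by move=> /prefix_eq_take + h; rewrite take_oversize. Qed.

Lemma consumed_prefix p t : prefix (consumed (run M y p t)) p.
Proof.
elim: t => [|t IH]; first exact: prefix0s.
by rewrite runS stepE; case: ifP => // _; case: ifP => // _; case: ifP => //= _;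
  exact: prefix_take.
Qed.

Lemma step_written_prefix p c : prefix (written c) (written (step M y p c)).
Proof.
rewrite stepE; repeat case: ifP => _ //=; rewrite ?prefix_refl //;
  by rewrite -cats1 prefix_prefix.
Qed.

Lemma step_consumed_size p c :
  (size (consumed c) <= size (consumed (step M y p c)))%N.
Proof.
rewrite stepE; repeat case: ifP => //= ?; rewrite size_take_min leq_min; lia.
Qed.

Lemma written_mono p t t' :
  (t <= t')%N -> prefix (written (run M y p t)) (written (run M y p t')).
Proof.
move=> /subnK <-; elim: (t' - t)%N => [|k IH]; first exact: prefix_refl.
by rewrite addSn runS; apply: prefix_trans IH (step_written_prefix _ _).
Qed.

(* Giving more input changes nothing until the shorter input is exhausted. *)
Lemma run_prefix p q t : prefix p q -> run M y p t = run M y q t \/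
  [/\ act (run M y p t) = 1%N, consumed (run M y p t) = p,
      (size p < size (consumed (run M y q t)))%N &
      prefix (written (run M y p t)) (written (run M y q t))].
Proof.
move=> pq; elim: t => [|t [e|[a cp lt wp]]]; first by left.
  have := consumed_prefix p t; rewrite !runS e; set c := run M y q t => cp.
  rewrite !stepE; case: eqP => [_|_]; first by left.
  case: eqP => [a1|_]; last by left.
  case: (ltnP (size (consumed c)) (size p)) => h.
    left; by rewrite (leq_trans h (size_prefix pq)) [in LHS](prefix_eq_take pq) take_takel.
  have cE := prefix_antisym cp h; rewrite cE.
  case: ltnP => h'; last by left.
  by right; split => //=; [rewrite size_take_min leq_min ltnS leqnn h'|exact: prefix_refl].
right; rewrite !runS (step_blocked a) ?cp //; split=> //.
  exact: leq_trans lt (step_consumed_size _ _).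
exact: prefix_trans wp (step_written_prefix _ _).
Qed.

Lemma computes_after p x : computes M y p x -> exists t0, forall t, (t0 <= t)%N ->
  [/\ act (run M y p t) = 0%N, consumed (run M y p t) = p & written (run M y p t) = x].
Proof.
case=> t0 [/next_action_halt a cE wE]; exists t0 => t le.
by rewrite (run_fixed _ le) // step_halt.
Qed.

Lemma computes_halted p x t : computes M y p x -> act (run M y p t) = 0%N ->
  consumed (run M y p t) = p /\ written (run M y p t) = x.
Proof.
move=> /computes_after[t0 h] a; have e := step_halt p a.
have [_ cE wE] := h _ (leq_maxl t0 t).
by rewrite -(run_fixed e (leq_maxr t0 t)).
Qed.

Lemma computes_not_blocked p x t : computes M y p x -> act (run M y p t) = 1%N ->
  (size p <= size (consumed (run M y p t)))%N -> False.
Proof.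
move=> /computes_after[t0 h] a sz; have e := step_blocked a sz.
have [+ _ _] := h _ (leq_maxl t0 t); rewrite (run_fixed e (leq_maxr t0 t)).
by rewrite a.
Qed.

(** The run on [q] follows the run on [p] unless the latter blocks for lack of input. As it halts
    instead, both runs end in the same configuration, whose consumed part is [p] and also [q]. *)
Lemma computes_prefix_free p q x x' : computes M y p x -> computes M y q x' ->
  prefix p q -> p = q /\ x = x'.
Proof.
move=> cp cq pq; have [t1 h1] := computes_after cp; have [t2 h2] := computes_after cq.
have [a1 c1 w1] := h1 _ (leq_maxl t1 t2); have [a2 c2 w2] := h2 _ (leq_maxr t1 t2).
have [e|[]] := run_prefix (maxn t1 t2) pq; last by rewrite a1.
by rewrite -c1 -w1 e c2 w2.
Qed.

Lemma computes_inj p x x' : computes M y p x -> computes M y p x' -> x = x'.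
Proof. by move=> c1 c2; have [] := computes_prefix_free c1 c2 (prefix_refl _). Qed.

End Runs.

(* A reader is a parser which may be given time: [None] means that it is still
   computing, [Some None] that it needs more input. *)
Definition reader A := nat -> bits -> option (option (A * bits)).

Definition ultimately (P : nat -> Prop) := exists t0, forall t, (t0 <= t)%N -> P t.

(** An answer other than [None] must never be wrong, because the machine acts on it at once. The
    unread rest [s] is handed over so that readers can be chained. *)
Definition reads A (rd : reader A) (p : bits) (v : A) :=
  (forall s, (forall t, rd t (p ++ s) = None \/ rd t (p ++ s) = Some (Some (v, s))) /\
     ultimately (fun t => rd t (p ++ s) = Some (Some (v, s)))) /\
  (forall s, prefix s p -> s != p ->
     (forall t, rd t s = None \/ rd t s = Some None) /\
     ultimately (fun t => rd t s = Some None)).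

Definition rbind A B (rd : reader A) (k : A -> reader B) : reader B := fun t s =>
  oapp (fun o => oapp (fun p => k p.1 t p.2) (Some None) o) None (rd t s).

Definition rret A (v : A) : reader A := fun _ s => Some (Some (v, s)).

Lemma reads_ret A (v : A) : reads (rret v) [::] v.
Proof.
split=> s; first by split=> [t|]; [right | exists 0%N].
by rewrite prefixs0 => ->.
Qed.

Lemma reads_bind A B (rd : reader A) (k : A -> reader B) p v p' v' :
  reads rd p v -> reads (k v) p' v' -> reads (rbind rd k) (p ++ p') v'.
Proof.
move=> [h1 h2] [k1 k2]; split=> s; rewrite /rbind.
  have [a [t0 ea]] := h1 (p' ++ s); have [b eb] := k1 s.
  split=> [t|].
    by rewrite -catA; case: (a t) => -> /=; [left | exact: b].
  have [t1 h] := eb; exists (maxn t0 t1) => t; rewrite geq_max => /andP[l0 l1].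
  by rewrite -catA ea //= h.
move=> /prefix_catP[/andP[sw sw']|[u -> up]] ne.
  have [a [t0 ea]] := h2 _ sw sw'; split=> [t|].
    by case: (a t) => -> /=; [left | right].
  by exists t0 => t /ea ->.
have [a [t0 ea]] := h1 u.
have [|b [t1 eb]] := k2 _ up; first by apply: contraNneq ne => ->.
split=> [t|]; first by case: (a t) => -> /=; [left | exact: b].
exists (maxn t0 t1) => t; rewrite geq_max => /andP[l0 l1].
by rewrite ea //= eb.
Qed.

Definition rsearch (P : nat -> bool) : reader nat := fun t s =>
  if (find P (iota 0 t) < t)%N then Some (Some (find P (iota 0 t), s)) else None.

Lemma reads_search (P : nat -> bool) m :
  P m -> (forall k, (k < m)%N -> ~~ P k) -> reads (rsearch P) [::] m.
Proof.
move=> Pm Pk; split=> s; last by rewrite prefixs0 => ->.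
have f1 t : (m < t)%N -> find P (iota 0 t) = m.
  move=> mt; have ht : has P (iota 0 t).
    by apply/hasP; exists m; rewrite // mem_iota.
  apply/eqP; rewrite eqn_leq; apply/andP; split.
    rewrite leqNgt; apply/negP => /(before_find 0%N); rewrite nth_iota // add0n.
    by rewrite Pm.
  rewrite leqNgt; apply/negP => /Pk; have := nth_find 0%N ht.
  by rewrite nth_iota ?add0n => [->|] //; move: ht; rewrite has_find size_iota.
split=> [t|]; last by exists m.+1 => t mt; rewrite /rsearch f1 // mt.
rewrite /rsearch; case: ifP => ft; last by left.
case: (ltnP m t) => mt; first by right; rewrite f1.
have ht : has P (iota 0 t) by rewrite has_find size_iota.
have /hasP[k] := ht; rewrite mem_iota /= add0n => kt Pk'.
by have := Pk k (leq_trans kt mt); rewrite Pk'.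
Qed.

Definition rtake n : reader bits := fun _ s =>
  if (size s < n)%N then Some None else Some (Some (take n s, drop n s)).

Lemma reads_take s : reads (rtake (size s)) s s.
Proof.
split=> u.
  have e t : rtake (size s) t (s ++ u) = Some (Some (s, u)).
    by rewrite /rtake size_cat ltnNge leq_addr /= take_size_cat // drop_size_cat.
  by split; [right | exists 0%N].
move=> us ne; have e t : rtake (size s) t u = Some None.
  rewrite /rtake; case: ltnP => // h; move: ne.
  by rewrite (prefix_antisym us h) eqxx.
by split; [right | exists 0%N].
Qed.

(** The simulated machine delimits its own program: its halting yields the end of that program, and
    its blocking at the end of the available input becomes a request for more. The consumed program
    is returned too, since its length serves later as a scaling exponent. *)
Definition rsim (M : machine) (y : bits) : reader (bits * bits) := fun t s =>
  let c := run M y s t in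
  if action_code M y c == 0%N then Some (Some ((written c, consumed c), drop (size (consumed c)) s))
  else if (action_code M y c == 1%N) && (size s <= size (consumed c))%N
  then Some None else None.

Lemma reads_sim M y p x : computes M y p x -> reads (rsim M y) p (x, p).
Proof.
move=> cp; have [t0 h0] := computes_after cp; split=> s.
  have pre : prefix p (p ++ s) := prefix_prefix _ _.
  have eq t : run M y p t = run M y (p ++ s) t.
    have [//|[a c _ _]] := run_prefix M y t pre.
    by exfalso; apply: (computes_not_blocked cp a); rewrite c.
  have halted t : action_code M y (run M y (p ++ s) t) = 0%N ->
      rsim M y t (p ++ s) = Some (Some ((x, p), s)).
    rewrite /rsim => a; rewrite a eqxx; rewrite -eq in a *.
    by have [-> ->] := computes_halted cp a; rewrite drop_size_cat.
  split=> [t|]; last first.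
    by exists t0 => t /h0[a _ _]; apply: halted; rewrite -eq.
  case: (eqVneq (action_code M y (run M y (p ++ s) t)) 0%N) => a.
    by right; exact: halted.
  rewrite /rsim (negbTE a); case: ifP => [/andP[/eqP a1 sz]|_]; last by left.
  exfalso; move: a1 sz; rewrite -eq => a1 sz.
  by apply: (computes_not_blocked cp a1); apply: leq_trans sz; rewrite size_cat leq_addr.
move=> sp ne.
have szs : (size s < size p)%N.
  by rewrite ltnNge; apply: contraNN ne => h; rewrite (prefix_antisym sp h).
have nhalt t : action_code M y (run M y s t) != 0%N.
  apply/eqP => a; have [e|[]] := run_prefix M y t sp; last by rewrite a.
  have := consumed_prefix M y s t; rewrite e in a *.
  have [-> _] := computes_halted cp a.
  by move=> /size_prefix; rewrite leqNgt szs.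
split=> [t|].
  by rewrite /rsim (negbTE (nhalt t)); case: ifP; [right | left].
exists t0 => t /h0[a _ _].
have [e|[a1 c _ _]] := run_prefix M y t sp.
  by have := nhalt t; rewrite e a.
by rewrite /rsim a1 c leqnn.
Qed.

Lemma ultimately_uniform (Q : nat -> nat -> Prop) n :
  (forall k, (k < n)%N -> ultimately (Q k)) ->
  exists T, forall k t, (k < n)%N -> (T <= t)%N -> Q k t.
Proof.
elim: n => [|n IH] h; first by exists 0%N.
have [|T hT] := IH; first by move=> k kn; apply: h; rewrite ltnS ltnW.
have [T' hT'] := h n (ltnSn n); exists (maxn T T') => k t.
rewrite ltnS leq_eqVlt geq_max => /orP[/eqP->|kn] /andP[l0 l1]; first exact: hT'.
exact: hT.
Qed.

Section MeasureRun.
Variables (M : machine) (y p : bits) (inv : config -> Prop) (P : config -> Prop).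
Variable mu : config -> nat.

Lemma run_measure : inv (Config 0%N [::] [::]) ->
  (forall c, inv c -> P c \/ (inv (step M y p c) /\ (mu (step M y p c) < mu c)%N)) ->
  exists t, P (run M y p t).
Proof.
move=> i0 h; suff H n t : inv (run M y p t) -> (mu (run M y p t) <= n)%N ->
    exists t, P (run M y p t) by exact: (H _ 0%N i0 (leqnn _)).
elim: n t => [|n IH] t it mt; have [Pt|[ic lt]] := h _ it; try by exists t.
  by move: (leq_trans lt mt).
by apply: (IH t.+1); rewrite runS // -ltnS (leq_trans lt).
Qed.

End MeasureRun.

Definition emit_next (w x : bits) : nat := if nth false x (size w) then 3%N else 2%N.

Lemma rcons_emit (w x : bits) : prefix w x -> (size w < size x)%N ->
  (if emit_next w x == 2%N then rcons w false else
   if emit_next w x == 3%N then rcons w true else w) = take (size w).+1 x.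
Proof.
move=> /prefix_eq_take wx lt; rewrite (take_nth false) // -wx /emit_next.
by case: (nth _ _ _).
Qed.

(** The control evaluates the reader afresh at every step, on the input consumed so far and with the
    clock as time. *)
Theorem machine_of_reader (rd : bits -> reader bits) :
  computable3 rd -> exists M : machine, forall y p x,
    reads (rd y) p x -> computes M y p x.
Proof.
move=> crd.
(* The action 4 idles while the reader is computing, 1 reads on request, 2 or 3 from [emit_next]
   writes the next bit of the result, and 0 halts once the result is complete. *)
pose D t y c w := oapp (fun o => oapp (fun q : bits * bits =>
  if (size w < size q.1)%N then emit_next w q.1 else 0%N) 1%N o) 4%N (rd y t c).
have cD : computable4 D by rewrite /D /emit_next; comp.
have [M hM] := control_of_computable cD; exists M => y p x [r1 r2].
have {r1}[r1 [t1 e1]] := r1 [::]; rewrite cats0 in r1 e1.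
have [T hT] : exists T, forall k t, (k < size p)%N -> (T <= t)%N ->
    rd y t (take k p) = Some None.
  apply: ultimately_uniform => k kp; apply: (r2 _ _ _).2; first exact: prefix_take.
  by apply: contraTneq kp => e; rewrite -leqNgt -{1}e size_take_min geq_minl.
pose S := maxn T t1.
(* Idling is charged to the clock, which is below [S] as long as the reader can still be computing;
   reading and writing are charged to the other two terms. *)
pose mu c := ((S - clock c) + (size p - size (consumed c)) +
  (size x - size (written c)))%N.
pose inv c := [/\ prefix (consumed c) p, prefix (written c) x &
  consumed c != p -> written c = [::]].
pose P c := [/\ next_action M y c = Halt, consumed c = p & written c = x].
suff [t Pt] : exists t, P (run M y p t) by exists t.
apply: (@run_measure M y p inv P mu).
  by split=> //=; exact: prefix0s.
move=> c [cp wx w0].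
have aE : action_code M y c = D (clock c) y (consumed c) (written c).
  by rewrite /action_code /control_on hM.
have spp := size_prefix cp; have swx := size_prefix wx.
case: (eqVneq (consumed c) p) => [cE|ne].
  have [e|e] := r1 (clock c).
    right; rewrite stepE aE /D cE e /=; split.
      by split=> //=; rewrite ?prefix_refl ?eqxx.
    have cS : (clock c < t1)%N.
      by rewrite ltnNge; apply/negP => /e1; rewrite e.
    by have := leq_maxr T t1; rewrite -/S /mu /= cE; lia.
  case: (ltnP (size (written c)) (size x)) => lt; last first.
    left; split => //; last exact: prefix_antisym.
    by rewrite next_actionE aE /D cE e /= ltnNge lt.
  have a2 : action_code M y c = emit_next (written c) x by rewrite aE /D cE e /= lt.
  right; rewrite stepE a2 rcons_emit //.
  have -> : (emit_next (written c) x == 0%N) = false by rewrite /emit_next; case: nth.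
  have -> : (emit_next (written c) x == 1%N) = false by rewrite /emit_next; case: nth.
  split; first by split=> //=; [exact: prefix_take | rewrite cE eqxx].
  by rewrite /mu /= size_take_min (minn_idPl lt); lia.
have lt : (size (consumed c) < size p)%N.
  by rewrite ltnNge; apply: contraNN ne => h; rewrite (prefix_antisym cp h).
have [r [t0 e0]] := r2 _ cp ne.
right; rewrite stepE aE /D; have [e|e] := r (clock c); rewrite e /=.
  split; first by split.
  have cS : (clock c < T)%N.
    rewrite ltnNge; apply/negP => /(hT _ _ lt).
    by rewrite -(prefix_eq_take cp) e.
  by have := leq_maxl T t1; rewrite -/S /mu /=; lia.
rewrite lt; split.
  by split=> //=; [exact: prefix_take | rewrite w0].
by rewrite /mu /= size_take_min (minn_idPl lt); lia.
Qed.

Lemma prefix_comparable (T : eqType) (u v s : seq T) :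
  prefix u s -> prefix v s -> prefix u v \/ prefix v u.
Proof.
move=> us vs; case: (leqP (size u) (size v)) => h; [left | right].
  by rewrite (prefix_eq_take us) -(take_takel _ h) -(prefix_eq_take vs) prefix_take.
by rewrite (prefix_eq_take vs) -(take_takel _ (ltnW h)) -(prefix_eq_take us) prefix_take.
Qed.

Lemma prefix_le_size (T : eqType) (u v : seq T) :
  prefix u v \/ prefix v u -> (size u <= size v)%N -> prefix u v.
Proof. by case=> // vu h; rewrite (prefix_antisym vu h) prefix_refl. Qed.

(* [tau t c] is the output known after [t] steps on the consumed input [c], and
   [need t c] says that no more can be known without further input. *)
Theorem machine_of_stream (tau : nat -> bits -> bits) (need : nat -> bits -> bool) :
  computable2 tau -> computable2 need -> exists M : machine, forall (y p w : bits) T,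
    (forall t t' (c c' : bits), prefix c p -> prefix c' p ->
       prefix (tau t c) (tau t' c') \/ prefix (tau t' c') (tau t c)) ->
    (forall t (c : bits), prefix c p -> (T <= t)%N ->
       prefix w (tau t c) \/ need t c /\ c != p) ->
    (forall t, prefix w (tau t p) \/ ~~ need t p) ->
    emits M y p w.
Proof.
move=> ctau cneed.
(* Known output is written before anything else; the input is read only when [need] holds. The code
   0 never occurs, so the machine never halts. *)
pose D t (y : bits) c w := if (size w < size (tau t c))%N then emit_next w (tau t c)
  else if need t c then 1%N else 4%N.
have cD : computable4 D by rewrite /D /emit_next; comp.
have [M hM] := control_of_computable cD; exists M => y p w T h1 h2 h3.
pose mu c := ((T - clock c) + (size p - size (consumed c)) +
  (size w - size (written c)))%N.
pose inv c := prefix (consumed c) p /\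
  exists t c0, prefix c0 p /\ prefix (written c) (tau t c0).
pose P c := prefix w (written c).
suff [t Pt] : exists t, P (run M y p t) by exists t.
apply: (@run_measure M y p inv P mu).
  split=> /=; first exact: prefix0s.
  by exists 0%N, p; rewrite prefix_refl prefix0s.
move=> c [cp [t0 [c0 [c0p wt]]]].
have wp : prefix w (tau T p).
  by have [//|[_]] := h2 T p (prefix_refl _) (leqnn _); rewrite eqxx.
have wcomp : prefix w (written c) \/ prefix (written c) w.
  have [h|h] := h1 t0 T c0 p c0p (prefix_refl _).
    exact: prefix_comparable wp (prefix_trans wt h).
  exact: prefix_comparable (prefix_trans wp h) wt.
case: (leqP (size w) (size (written c))) => lw.
  by left; exact: prefix_le_size wcomp lw.
have aE : action_code M y c = D (clock c) y (consumed c) (written c).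
  by rewrite /action_code /control_on hM.
have spp := size_prefix cp.
right; case: (ltnP (size (written c)) (size (tau (clock c) (consumed c)))) => lt.
  have a2 : action_code M y c = emit_next (written c) (tau (clock c) (consumed c)).
    by rewrite aE /D lt.
  have wt2 : prefix (written c) (tau (clock c) (consumed c)).
    apply: prefix_le_size (ltnW lt); have [h|h] := h1 t0 (clock c) c0 _ c0p cp.
      by left; exact: prefix_trans wt h.
    exact: prefix_comparable wt h.
  rewrite stepE a2 rcons_emit //.
  have -> : (emit_next (written c) (tau (clock c) (consumed c)) == 0%N) = false
    by rewrite /emit_next; case: nth.
  have -> : (emit_next (written c) (tau (clock c) (consumed c)) == 1%N) = false
    by rewrite /emit_next; case: nth.
  split; first by split=> //=; exists (clock c), (consumed c); rewrite prefix_take.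
  by rewrite /mu /= size_take_min (minn_idPl lt); lia.
have nw : ~ prefix w (tau (clock c) (consumed c)).
  by move=> /size_prefix h; move: (leq_trans (leq_trans lw h) lt); rewrite ltnn.
case nd: (need (clock c) (consumed c)).
  rewrite stepE aE /D ltnNge lt nd /=.
  have ne : consumed c != p.
    by apply/eqP => e; have := h3 (clock c); rewrite -e nd => -[].
  have ltc : (size (consumed c) < size p)%N.
    by rewrite ltnNge; apply: contraNN ne => h; rewrite (prefix_antisym cp h).
  rewrite ltc; split; first by split=> /=; [exact: prefix_take | exists t0, c0].
  by rewrite /mu /= size_take_min (minn_idPl ltc); lia.
rewrite stepE aE /D ltnNge lt nd /=; split; first by split=> //=; exists t0, c0.
have cT : (clock c < T)%N.
  by rewrite ltnNge; apply/negP => /(h2 _ _ cp)[//|[]]; rewrite nd.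
by rewrite /mu /=; lia.
Qed.

Local Open Scope ring_scope.

(** * Tensor products and slices *)

Section QubitIndices.
Variables k l : nat.

Definition qhi (i : 'I_(2 ^ (k + l))) : 'I_(2 ^ k) :=
  (mxtens_unindex (cast_ord (expnD 2 k l) i)).1.
Definition qlo (i : 'I_(2 ^ (k + l))) : 'I_(2 ^ l) :=
  (mxtens_unindex (cast_ord (expnD 2 k l) i)).2.
Definition qjoin (a : 'I_(2 ^ k)) (b : 'I_(2 ^ l)) : 'I_(2 ^ (k + l)) :=
  cast_ord (esym (expnD 2 k l)) (mxtens_index (a, b)).

Lemma qhiK a b : qhi (qjoin a b) = a.
Proof. by rewrite /qhi /qjoin cast_ordKV mxtens_indexK. Qed.

Lemma qloK a b : qlo (qjoin a b) = b.
Proof. by rewrite /qlo /qjoin cast_ordKV mxtens_indexK. Qed.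

Lemma qjoinK i : qjoin (qhi i) (qlo i) = i.
Proof.
by rewrite /qhi /qlo /qjoin -surjective_pairing mxtens_unindexK cast_ordK.
Qed.

Lemma sum_qjoin (V : nmodType) (F : 'I_(2 ^ (k + l)) -> V) :
  \sum_i F i = \sum_a \sum_b F (qjoin a b).
Proof.
rewrite pair_big (reindex (fun p : 'I_(2 ^ k) * 'I_(2 ^ l) => qjoin p.1 p.2)) //=.
exists (fun i => (qhi i, qlo i)) => [[a b] _|i _] /=; last exact: qjoinK.
by rewrite qhiK qloK.
Qed.

End QubitIndices.

Lemma qtensE (R : realType) k l (A : 'M[R[i]]_(2 ^ k)) (B : 'M[R[i]]_(2 ^ l)) i j :
  qtens A B i j = A (qhi i) (qhi j) * B (qlo i) (qlo j).
Proof. by rewrite /qtens castmxE mxE !esymK. Qed.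

Section Slices.
Variables (F : comPzRingType) (n : nat).
Local Notation N := (2 ^ (n + n))%N.
Local Notation D := (2 ^ ((n + n) + (n + n)))%N.
Implicit Types (X : 'M[F]_D) (Y : 'M[F]_N) (nu xi : 'M[F]_(2 ^ n)).

(* The 4n qubits are ordered as s, b, r, c where (s, r) are kept and b, c are
   the ancillas carrying [nu] and [xi]. *)
Definition anc_join (K : 'I_N) (b c : 'I_(2 ^ n)) : 'I_D :=
  qjoin (qjoin (qhi K) b) (qjoin (qlo K) c).
Definition kept (i : 'I_D) : 'I_N := qjoin (qhi (qhi i)) (qhi (qlo i)).
Definition anc1 (i : 'I_D) : 'I_(2 ^ n) := qlo (qhi i).
Definition anc2 (i : 'I_D) : 'I_(2 ^ n) := qlo (qlo i).

Lemma kept_join K b c : kept (anc_join K b c) = K.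
Proof. by rewrite /kept /anc_join !(qhiK, qloK) qjoinK. Qed.
Lemma anc1_join K b c : anc1 (anc_join K b c) = b.
Proof. by rewrite /anc1 /anc_join !(qhiK, qloK). Qed.
Lemma anc2_join K b c : anc2 (anc_join K b c) = c.
Proof. by rewrite /anc2 /anc_join !(qhiK, qloK). Qed.

Lemma sum_anc_join (V : nmodType) (f : 'I_D -> V) :
  \sum_i f i = \sum_K \sum_b \sum_c f (anc_join K b c).
Proof.
rewrite sum_qjoin sum_qjoin; under eq_bigr do under eq_bigr do rewrite sum_qjoin.
rewrite [RHS]sum_qjoin; apply: eq_bigr => s _; rewrite exchange_big /=.
apply: eq_bigr => r _.
by apply: eq_bigr => b _; apply: eq_bigr => c _; rewrite /anc_join qhiK qloK.
Qed.

(** The partial trace over both ancillas of X (1 (x) nu (x) 1 (x) xi), still without the factor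
    2^-e. *)
Definition slice nu xi X : 'M[F]_N := \matrix_(K, L)
  \sum_b \sum_b' \sum_c \sum_c'
     X (anc_join K b c) (anc_join L b' c') * nu b' b * xi c' c.

Definition spread nu xi Y : 'M[F]_D := \matrix_(i, j)
  (Y (kept i) (kept j) * nu (anc1 i) (anc1 j) * xi (anc2 i) (anc2 j)).

(** [slice] and [spread] are adjoint for the trace pairing. Positivity, trace bound and convergence
    of slices are all obtained by moving to the side of [spread], which is a tensor product up to
    the order of the qubits. *)
Lemma tr_slice nu xi X Y : \tr (slice nu xi X *m Y) = \tr (X *m spread nu xi Y).
Proof.
rewrite /mxtrace sum_anc_join; apply: eq_bigr => K _; rewrite mxE.
transitivity (\sum_L \sum_b \sum_b' \sum_c \sum_c'
    (X (anc_join K b c) (anc_join L b' c') * nu b' b * xi c' c) * Y L K).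
  apply: eq_bigr => L _; rewrite mxE mulr_suml; apply: eq_bigr => b _.
  rewrite mulr_suml; apply: eq_bigr => b' _; rewrite mulr_suml.
  by apply: eq_bigr => c _; rewrite mulr_suml.
rewrite exchange_big /=; apply: eq_bigr => b _.
under eq_bigr do rewrite exchange_big /=.
rewrite exchange_big /=; apply: eq_bigr => c _.
rewrite mxE sum_anc_join; apply: eq_bigr => L _; apply: eq_bigr => b' _.
apply: eq_bigr => c' _; rewrite mxE !kept_join !anc1_join !anc2_join; ring.
Qed.

Lemma sliceB nu xi X1 X2 : slice nu xi (X1 - X2) = slice nu xi X1 - slice nu xi X2.
Proof.
apply/matrixP => K L; rewrite !mxE -sumrB; apply: eq_bigr => b _.
rewrite -sumrB; apply: eq_bigr => b' _; rewrite -sumrB; apply: eq_bigr => c _.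
by rewrite -sumrB; apply: eq_bigr => c' _; rewrite !mxE; ring.
Qed.

Definition part_slice nu (E : 'M[F]_N) : 'M[F]_(2 ^ n) := \matrix_(k, l)
  \sum_b \sum_b' E (qjoin k b) (qjoin l b') * nu b' b.

End Slices.

Section SliceTensor.
Variables (R : realType) (n : nat).

(** The two ancillas lie in different tensor factors, so the partial trace factors as well. This
    keeps a sliced test a product test. *)
Lemma slice_qtens (nu xi : 'M[R[i]]_(2 ^ n)) (E G : 'M[R[i]]_(2 ^ (n + n))) :
  slice nu xi (qtens E G) = qtens (part_slice nu E) (part_slice xi G).
Proof.
apply/matrixP => K L; rewrite qtensE !mxE mulr_suml; apply: eq_bigr => b _.
rewrite mulr_suml; apply: eq_bigr => b' _.
rewrite mulr_sumr; apply: eq_bigr => c _; rewrite mulr_sumr; apply: eq_bigr => c' _.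
by rewrite qtensE /anc_join !(qhiK, qloK); ring.
Qed.

Lemma spread_qtens (nu xi sigma rho : 'M[R[i]]_(2 ^ n)) :
  spread nu xi (qtens sigma rho) = qtens (qtens sigma nu) (qtens rho xi).
Proof.
apply/matrixP => i j; rewrite mxE !qtensE /kept /anc1 /anc2 !(qhiK, qloK); ring.
Qed.

End SliceTensor.

(** * Programs for the universal machine *)

Section ReaderClosure.
Context {C : Type} {cC : coded C}.

Lemma comp_pairn (a b : C -> nat) :
  computable a -> computable b -> computable (fun c => pairn (a c) (b c)).
Proof. exact: comp_rec2 rec2_pairn. Qed.

Lemma comp_fstn (a : C -> nat) : computable a -> computable (fun c => fstn (a c)).
Proof. exact: comp_rec1 rec1_fstn. Qed.

Lemma comp_sndn (a : C -> nat) : computable a -> computable (fun c => sndn (a c)).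
Proof. exact: comp_rec1 rec1_sndn. Qed.

Lemma comp_rsim M (y : C -> bits) (t : C -> nat) (s : C -> bits) :
  computable y -> computable t -> computable s ->
  computable (fun c => rsim M (y c) (t c) (s c)).
Proof.
move=> cy ct cs; have cr := comp_run M; have ca := comp_action M.
have crun : computable (fun c => run M (y c) (s c) (t c)) := comp_comp3 cr cy cs ct.
rewrite /rsim; compb.
Qed.

Lemma comp_rtake (n t : C -> nat) (s : C -> bits) :
  computable n -> computable s -> computable (fun c => rtake (n c) (t c) (s c)).
Proof. by move=> cn cs; rewrite /rtake; comp. Qed.

Lemma comp_rsearch (P : C -> nat -> bool) (t : C -> nat) (s : C -> bits) :
  computable2 P -> computable t -> computable s ->
  computable (fun c => rsearch (P c) (t c) (s c)).
Proof. by move=> cP ct cs; rewrite /rsearch; comp. Qed.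

End ReaderClosure.

Lemma read_seqE A (rd : parser A) n s : read_seq rd n s =
  iter n (fun o => oapp (fun p => oapp (fun q => Some (rcons p.1 q.1, q.2)) None
    (rd p.2)) None o) (Some ([::], s)).
Proof. by rewrite /read_seq; elim: n => //= n <-; rewrite {1}/parser_bind. Qed.

Lemma comp_read_crat : computable read_crat.
Proof.
rewrite /read_crat /read_rat /read_int /read_nat /read_bit /parser_bind /parser_map.
by compb.
Qed.

Lemma comp_read_mx : computable read_mx.
Proof.
have cc := comp_read_crat.
apply: (@comp_eq _ _ _ _ (fun s => oapp (fun p => oapp (fun q =>
  iter (p.1 * q.1) (fun o => oapp (fun p => oapp (fun q => Some (rcons p.1 q.1, q.2))
    None (read_crat p.2)) None o) (Some ([::], q.2))) None (read_nat p.2)) None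
  (read_nat s))).
  move=> s; rewrite /read_mx /parser_bind; case: (read_nat s) => //= p.
  by case: (read_nat p.2) => //= q; rewrite read_seqE.
by rewrite /read_nat; compb.
Qed.

Lemma comp_read_all A (cA : coded A) C (cC : coded C) (rd : parser A) (s : C -> bits) :
  computable rd -> computable s -> computable (fun c => read_all rd (s c)).
Proof. by move=> cr cs; rewrite /read_all; comp. Qed.

Lemma comp_code_entries C (cC : coded C) (m n : C -> nat) (es : C -> seq rat[i]) :
  computable m -> computable n -> computable es ->
  computable (fun c => code_entries (m c) (n c) (es c)).
Proof.
move=> cm cn ce; have cz : computable code_int.
  apply: (@comp_eq _ _ _ _ (fun z => (z < 0) ::
    code_nat (if z < 0 then (absz z).-1 else absz z))); first by case.
  by rewrite /code_nat; comp.
by rewrite /code_entries /code_crat /code_rat /code_nat; comp.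
Qed.

Definition entries_of (w : bits) : seq rat[i] := oapp fst [::] (read_mx w).

Lemma entries_ofK m n (A : 'M[rat[i]]_(m, n)) : entries_of (code_mx A) = mx_entries A.
Proof.
rewrite /entries_of code_mxE -[code_entries _ _ _]cats0.
by rewrite (parses_mx (size_mx_entries A)).1.
Qed.

Lemma comp_entries_of C (cC : coded C) (w : C -> bits) :
  computable w -> computable (fun c => entries_of (w c)).
Proof. by move=> cw; have cr := comp_read_mx; rewrite /entries_of; comp. Qed.

Ltac comp_extra :=
  match goal with
  | |- computable (fun c => pairn _ _) => refine (comp_pairn _ _)
  | |- computable (fun c => fstn _) => refine (comp_fstn _)
  | |- computable (fun c => sndn _) => refine (comp_sndn _)
  | |- computable (fun c => rsim _ _ _ _) => refine (comp_rsim _ _ _ _)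
  | |- computable (fun c => rtake _ _ _) => refine (comp_rtake _ _ _)
  | |- computable (fun c => rsearch _ _ _) => refine (comp_rsearch _ _ _)
  | |- computable (fun c => code_entries _ _ _) => refine (comp_code_entries _ _ _)
  | |- computable (fun c => entries_of _) => refine (comp_entries_of _)
  end.

Ltac compx := repeat (unfold computable2, computable3, computable4; cbv beta;
  first [comp_step | comp_bits | comp_ring | comp_extra]).

Lemma mx_entriesE m n (A : 'M[rat[i]]_(m, n)) (f : nat -> rat[i]) :
  (forall i j, A i j = f (i * n + j)%N) -> mx_entries A = mkseq f (m * n).
Proof.
move=> Af; apply: (@eq_from_nth _ 0); rewrite size_mx_entries ?size_mkseq // => k kmn.
have n0 : (0 < n)%N by case: n kmn {A Af} => //; rewrite muln0.
have im : (k %/ n < m)%N by rewrite ltn_divLR.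
have jn : (k %% n < n)%N by rewrite ltn_mod.
rewrite nth_mkseq // {1}(divn_eq k n).
by rewrite (nth_mx_entries A (Ordinal im) (Ordinal jn)) Af /= -divn_eq.
Qed.

Definition half_pow (e : nat) : rat[i] := Complex ((2 ^ e)%N%:R^-1) 0.

(** [anc_join] on plain numbers. *)
Definition anc_index n K b c : nat :=
  (((K %/ 2 ^ n) * 2 ^ n + b) * 2 ^ (n + n) + ((K %% 2 ^ n) * 2 ^ n + c))%N.

Definition slice_entry n e (ev ew ex : seq rat[i]) (k : nat) : rat[i] :=
  half_pow e * sum_upto (2 ^ n) (fun b => sum_upto (2 ^ n) (fun b' =>
    sum_upto (2 ^ n) (fun c => sum_upto (2 ^ n) (fun c' =>
      nth 0 ex (anc_index n (k %/ 2 ^ (n + n)) b c * 2 ^ (n + n + (n + n)) +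
                anc_index n (k %% 2 ^ (n + n)) b' c')%N *
      nth 0 ev (b' * 2 ^ n + b)%N * nth 0 ew (c' * 2 ^ n + c)%N)))).

Definition slice_entries n e ev ew ex : seq rat[i] :=
  mkseq (slice_entry n e ev ew ex) (2 ^ (n + n) * 2 ^ (n + n)).

Lemma slice_entriesE n e (nu xi : 'M[rat[i]]_(2 ^ n))
    (X : 'M[rat[i]]_(2 ^ (n + n + (n + n)))) :
  slice_entries n e (mx_entries nu) (mx_entries xi) (mx_entries X) =
  mx_entries (half_pow e *: slice nu xi X).
Proof.
apply/esym/mx_entriesE => K L; rewrite !mxE /slice_entry /sum_upto.
have p0 : (0 < 2 ^ (n + n))%N by rewrite expn_gt0.
have -> : ((K * 2 ^ (n + n) + L) %/ 2 ^ (n + n) = K)%N.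
  by rewrite divnMDl // divn_small ?addn0.
have -> : ((K * 2 ^ (n + n) + L) %% 2 ^ (n + n) = L)%N.
  by rewrite modnMDl modn_small.
congr (_ * _); apply: eq_bigr => b _; apply: eq_bigr => b' _; apply: eq_bigr => c _.
apply: eq_bigr => c' _; rewrite !nth_mx_entries.
by rewrite -(nth_mx_entries X).
Qed.

Lemma comp_slice_entries C (cC : coded C) (n e : C -> nat)
    (ev ew ex : C -> seq rat[i]) :
  computable n -> computable e -> computable ev -> computable ew -> computable ex ->
  computable (fun c => slice_entries (n c) (e c) (ev c) (ew c) (ex c)).
Proof.
move=> cn ce cv cw cx.
rewrite /slice_entries /slice_entry /half_pow /anc_index; compx.
Qed.

Definition code_stream d (A : nat -> 'M[rat[i]]_d) (N : nat) : bits :=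
  flatten [seq code_mx (A i) | i <- iota 0 N].

(* A slicing task: number of qubits, exponent of the scaling, codes of the two
   ancilla states. *)
Definition slice_task n e (wnu wxi : bits) : nat :=
  pairn (pairn n e) (pairn (nat_of_bits wnu) (nat_of_bits wxi)).

Definition run_slice_task (h : nat) (ex : seq rat[i]) : bits :=
  let n := fstn (fstn h) in
  code_entries (2 ^ (n + n)) (2 ^ (n + n))
    (slice_entries n (sndn (fstn h)) (entries_of (bits_of_nat (fstn (sndn h))))
       (entries_of (bits_of_nat (sndn (sndn h)))) ex).

Lemma run_slice_taskE n e (nu xi : 'M[rat[i]]_(2 ^ n))
    (X : 'M[rat[i]]_(2 ^ (n + n + (n + n)))) :
  run_slice_task (slice_task n e (code_mx nu) (code_mx xi)) (mx_entries X) =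
  code_mx (half_pow e *: slice nu xi X).
Proof.
rewrite /run_slice_task /slice_task !(pairnK1, pairnK2) !nat_of_bitsK !entries_ofK.
by rewrite slice_entriesE code_mxE.
Qed.

Lemma comp_run_slice_task : computable2 run_slice_task.
Proof.
rewrite /run_slice_task; compx; apply: comp_slice_entries; compx.
Qed.

(** The input consists of a task in unary followed by a program of [U]. Nothing is output before the
    task is complete; afterwards all matrices whose codes [U] has completely written are translated.
    Accordingly [slice_need] holds while the task is incomplete, or when [U] itself is blocked at
    the end of the available input. *)
Definition slice_tau (U : machine) (t : nat) (c : bits) : bits :=
  if (index false c < size c)%N then
    flatten (map (run_slice_task (index false c))
      (read_all read_mx (written (run U [::] (drop (index false c).+1 c) t))))
  else [::].

Definition slice_need (U : machine) (t : nat) (c : bits) : bool :=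
  if (index false c < size c)%N then
    let c' := drop (index false c).+1 c in let s := run U [::] c' t in
    (action_code U [::] s == 1%N) && (size c' <= size (consumed s))%N
  else true.

Lemma comp_slice_tau U : computable2 (slice_tau U).
Proof.
have cr := comp_run U; have ct := comp_run_slice_task.
have cm := comp_read_mx; rewrite /slice_tau; compx.
by apply: comp_read_all; compx.
Qed.

Lemma comp_slice_need U : computable2 (slice_need U).
Proof.
have cr := comp_run U; have ca := comp_action U; rewrite /slice_need; compx.
Qed.

Lemma index_code_nat h s : index false (code_nat h ++ s) = h.
Proof. by rewrite /index /code_nat; elim: h => //= h ->. Qed.

Lemma size_code_nat h : size (code_nat h) = h.+1.
Proof. by rewrite /code_nat size_cat size_nseq addn1. Qed.

Section SliceStream.
Variables (U : machine) (n : nat).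
Local Notation D := (2 ^ (n + n + (n + n)))%N.
Variables (h : nat) (q : bits) (A : nat -> 'M[rat[i]]_D).
Hypothesis hA : forall N, emits U [::] q (code_stream A N).

Let trans_stream N := flatten [seq run_slice_task h (mx_entries (A i)) | i <- iota 0 N].

Let stream_prefix N N' : (N <= N')%N -> prefix (code_stream A N) (code_stream A N').
Proof.
by move=> /subnKC <-; rewrite /code_stream iotaD map_cat flatten_cat prefix_prefix.
Qed.

Let trans_prefix N N' : (N <= N')%N -> prefix (trans_stream N) (trans_stream N').
Proof.
by move=> /subnKC <-; rewrite /trans_stream iotaD map_cat flatten_cat prefix_prefix.
Qed.

Let size_stream N : (N <= size (code_stream A N))%N.
Proof.
elim: N => // N IH; rewrite /code_stream -addn1 iotaD map_cat flatten_cat size_cat.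
by rewrite leq_add //= cats0 size_code_mx.
Qed.

(** The whole output of [U] on [q] is the code stream: it contains arbitrarily long streams, and [N]
    codes have at least [N] bits, so the stream of [size w] codes cannot be a proper prefix of
    [w]. *)
Let written_stream t : exists N, prefix (written (run U [::] q t)) (code_stream A N).
Proof.
set w := written _; exists (size w).
have [t' h'] := hA (size w); have := size_stream (size w).
have [le|le] := leqP t t'.
  have := written_mono U [::] q le; rewrite -/w => h1 h2.
  by apply: prefix_le_size => //; exact: prefix_comparable h1 h'.
have h1 := prefix_trans h' (written_mono U [::] q (ltnW le)); rewrite -/w in h1.
by move=> h2; rewrite (prefix_antisym h1 h2) prefix_refl.
Qed.

Let tau_written (w : bits) N : prefix w (code_stream A N) ->
  exists2 j, (j <= N)%N &
   flatten (map (run_slice_task h) (read_all read_mx w)) = trans_stream j /\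
   forall k, (k <= N)%N -> prefix (code_stream A k) w -> (k <= j)%N.
Proof.
have cE k : code_stream A k =
    flatten (map (code_entries D D) [seq mx_entries (A i) | i <- iota 0 k]).
  by rewrite /code_stream -map_comp; congr flatten; apply: eq_map => i /=; rewrite code_mxE.
have tE k : (k <= N)%N -> take k [seq mx_entries (A i) | i <- iota 0 N] =
    [seq mx_entries (A i) | i <- iota 0 k].
  by move=> kN; rewrite -map_take take_iota (minn_idPl kN).
rewrite cE => /(read_all_prefix (rd := read_mx)) [] //.
- by move=> v; rewrite /code_entries /code_nat !size_cat !size_nseq addn1.
- move=> i; rewrite size_map size_iota => iN x0.
  rewrite (nth_map 0%N) ?size_iota // nth_iota //.
  exact: parses_mx (size_mx_entries _).
move=> j; rewrite size_map size_iota => jN [jE jmax]; exists j => //; split.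
  by rewrite jE tE // -map_comp.
by move=> k kN; rewrite cE -tE //; exact: jmax.
Qed.

Let p := code_nat h ++ q.

Let prefix_p (c : bits) : prefix c p ->
  (index false c < size c)%N = false /\ c != p \/
  exists2 c', c = code_nat h ++ c' & prefix c' q.
Proof.
move=> /prefix_catP[/andP[cp ne]|[c' -> c'q]]; [left | by right; exists c'].
have lt : (size c < h.+1)%N.
  rewrite -(size_code_nat h) ltnNge; apply: contraNN ne => ge.
  by rewrite (prefix_antisym cp ge).
split.
  rewrite index_mem; apply/negbTE; apply/negP => fc; have := fc.
  rewrite (prefix_eq_take cp) /code_nat takel_cat ?size_nseq //.
  by move=> /mem_take; rewrite mem_nseq andbF.
by apply: contraTneq lt => ->; rewrite /p size_cat size_code_nat -leqNgt leq_addr.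
Qed.

Let tauE t c : slice_tau U t (code_nat h ++ c) =
  flatten (map (run_slice_task h) (read_all read_mx (written (run U [::] c t)))).
Proof.
rewrite /slice_tau index_code_nat size_cat size_code_nat leq_addr.
by rewrite -{1}(size_code_nat h) drop_size_cat.
Qed.

Let needE t c : slice_need U t (code_nat h ++ c) =
  (action_code U [::] (run U [::] c t) == 1%N) &&
  (size c <= size (consumed (run U [::] c t)))%N.
Proof.
rewrite /slice_need index_code_nat size_cat size_code_nat leq_addr.
by rewrite -{1 2 3}(size_code_nat h) drop_size_cat.
Qed.

(** On a part of [q], [U] writes a prefix of what it writes on [q]. All values of [slice_tau] are
    thus prefixes of a single stream, hence comparable. *)
Let tau_stream t (c : bits) : prefix c p ->
  exists j, slice_tau U t c = trans_stream j.
Proof.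
move=> /prefix_p[[e _]|[c' -> c'q]]; first by exists 0%N; rewrite /slice_tau e.
rewrite tauE; have [N hN] := written_stream t.
have [e|[_ _ _ wp]] := run_prefix U [::] t c'q.
  by have [j _ [jE _]] := tau_written hN; exists j; rewrite e.
by have [j _ [jE _]] := tau_written (prefix_trans wp hN); exists j.
Qed.

Let tau_late N : exists T, forall t, (T <= t)%N ->
  prefix (trans_stream N) (slice_tau U t p).
Proof.
have [T hT] := hA N; exists T => t Tt; rewrite tauE.
have {}hT := prefix_trans hT (written_mono U [::] q Tt).
have [N' hN'] := written_stream t.
have [|j jN' [-> jmax]] := @tau_written (written (run U [::] q t)) (maxn N N').
  exact: prefix_trans hN' (stream_prefix (leq_maxr _ _)).
by apply: trans_prefix; apply: jmax => //; exact: leq_maxl.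
Qed.

Lemma slice_stream M :
  (forall (y p w : bits) T,
    (forall t t' (c c' : bits), prefix c p -> prefix c' p ->
       prefix (slice_tau U t c) (slice_tau U t' c') \/
       prefix (slice_tau U t' c') (slice_tau U t c)) ->
    (forall t (c : bits), prefix c p -> (T <= t)%N ->
       prefix w (slice_tau U t c) \/ slice_need U t c /\ c != p) ->
    (forall t, prefix w (slice_tau U t p) \/ ~~ slice_need U t p) ->
    emits M y p w) ->
  forall N, emits M [::] p (trans_stream N).
Proof.
move=> hM N; have [T hT] := tau_late N; apply: (hM _ _ _ T).
- move=> t t' c c' /(tau_stream t)[j ->] /(tau_stream t')[j' ->].
  by case: (leqP j j') => le; [left | right]; apply: trans_prefix => //; exact: ltnW.
- move=> t c cp Tt; case: (prefix_p cp) => [[e ne]|[c' cE c'q]].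
    by right; rewrite /slice_need e.
  (* The run on the part [c'] either is still the run on [q], or is blocked at the end of [c'],
     which is what [slice_need] detects. *)
  have [e|[a cc lt _]] := run_prefix U [::] t c'q.
    by left; have := hT t Tt; rewrite cE !tauE e.
  right; rewrite cE needE a cc leqnn; split=> //.
  apply: contraTneq (leq_trans lt (size_prefix (consumed_prefix U [::] q t))).
  by rewrite /p => /eqP; rewrite eqseq_cat // eqxx /= => /eqP->; rewrite ltnn.
- move=> t; rewrite needE; case nd: (_ && _); [left | by right].
  have /andP[/eqP a sz] := nd.
  (* If [U] asks for input past the end of [q], it is stuck forever, so the wanted prefix has
     already been written. *)
  have st := step_blocked a sz.
  have := hT _ (leq_maxl T t); rewrite !tauE.
  by rewrite (run_fixed st (leq_maxr T t)).
Qed.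

End SliceStream.

Section Programs.
Variables (U : machine) (hU : universal U).

Lemma reader_program (rd : bits -> reader bits) : computable3 rd ->
  exists s : bits, forall y p x, reads (rd y) p x -> computes U y (s ++ p) x.
Proof.
move=> /machine_of_reader[M hM]; have [s hs] := hU M; exists s => y p x /hM.
by move=> h; apply/((hs y p).1 x).
Qed.

Lemma print_program (x : bits) : exists p : bits, forall y, computes U y p x.
Proof.
have [|s hs] := @reader_program (fun _ => rret x); first by rewrite /rret; comp.
by exists (s ++ [::]) => y; apply: hs; exact: reads_ret.
Qed.

Lemma slice_program : exists s : bits, forall n e (nu xi : 'M[rat[i]]_(2 ^ n)) q A,
  (forall N, emits U [::] q (code_stream A N)) ->
  forall N, emits U [::] (s ++ code_nat (slice_task n e (code_mx nu) (code_mx xi)) ++ q)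
    (code_stream (fun i => half_pow e *: slice nu xi (A i)) N).
Proof.
have [M hM] := machine_of_stream (comp_slice_tau U) (comp_slice_need U).
have [s hs] := hU M; exists s => n e nu xi q A hA N; apply/(hs _ _).2.
have := slice_stream (slice_task n e (code_mx nu) (code_mx xi)) hA hM N.
by congr emits; congr flatten; apply: eq_map => i; exact: run_slice_taskE.
Qed.

(** The three programs delimit themselves, so they are simply concatenated: the first is simulated
    with side information 2n, computed from n, the others with n itself. The exponent of the scaling
    comes from the lengths of the programs read, which is how a quantity bounded by complexities
    becomes available to a program. *)
Lemma task_program (s1 : bits) c0 : exists s : bits, forall n p0 q p1 w1 p2 w2,
  computes U (bits_of_nat (n + n)) p0 q -> computes U (bits_of_nat n) p1 w1 ->
  computes U (bits_of_nat n) p2 w2 ->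
  computes U (bits_of_nat n) (s ++ p0 ++ p1 ++ p2)
    (s1 ++ code_nat (slice_task n (c0 + size p1 + size p2) w1 w2) ++ q).
Proof.
pose rd (y : bits) : reader bits :=
  rbind (rsim U (bits_of_nat (nat_of_bits y + nat_of_bits y))) (fun r0 =>
  rbind (rsim U y) (fun r1 => rbind (rsim U y) (fun r2 =>
  rret (s1 ++ code_nat (slice_task (nat_of_bits y)
    (c0 + size r1.2 + size r2.2) r1.1 r2.1) ++ r0.1)))).
have [|s hs] := @reader_program rd.
  by rewrite /rd /rbind /rret /slice_task /code_nat; compx.
exists s => n p0 q p1 w1 p2 w2 h0 h1 h2; apply: hs.
have -> : p0 ++ p1 ++ p2 = p0 ++ p1 ++ p2 ++ [::] by rewrite cats0.
rewrite /rd bits_of_natK.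
apply: reads_bind (reads_sim h0) _; apply: reads_bind (reads_sim h1) _.
by apply: reads_bind (reads_sim h2) _; exact: reads_ret.
Qed.

End Programs.

(** * Searching for a mixture of unit vectors and naming its members *)

Definition binval (s : bits) : nat := foldr (fun (b : bool) k => b + (k + k))%N 0%N s.
Definition digits (L k : nat) : bits := mkseq (fun i => odd (k %/ 2 ^ i)) L.

Lemma digitsK L k : (k < 2 ^ L)%N -> binval (digits L k) = k.
Proof.
elim: L k => [|L IH] k kL; first by case: k kL.
have -> : digits L.+1 k = odd k :: digits L (k %/ 2).
  rewrite /digits /mkseq /= divn1 (iotaDl 1 0) -map_comp; congr (_ :: _).
  by apply: eq_map => i /=; rewrite add1n expnS divnMA.
rewrite /= IH; last by rewrite ltn_divLR // -expnSr.
by rewrite addnn divn2 odd_double_half.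
Qed.

Lemma size_digits L k : size (digits L k) = L. Proof. exact: size_mkseq. Qed.

Definition stored_crats (m : nat) : seq rat[i] :=
  read_all read_crat (bits_of_nat (sndn m)).

Definition stored_vec n m k j : rat[i] := nth 0 (stored_crats m) (k * 2 ^ n + j).

(* The vectors number 0, ..., 2^L - 1 stored in [m] are unit vectors [phi_k], and
   the further ones are witnesses [v_k] of
   16 sum_k phi_k phi_k^* = 2^L nu + sum_k v_k v_k^*. *)
Definition mixture_test n (ev : seq rat[i]) m : bool :=
  let L := fstn m in let v := stored_vec n m in
  all (fun k => sum_upto (2 ^ n) (fun j => v k j * conjc (v k j)) == 1)
    (iota 0 (2 ^ L)) &&
  all (fun i => all (fun j =>
    16%:R * sum_upto (2 ^ L) (fun k => v k i * conjc (v k j)) ==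
    Complex (2 ^ L)%:R 0 * nth 0 ev (i * 2 ^ n + j) +
    sum_upto (size (stored_crats m)) (fun k =>
      v (2 ^ L + k)%N i * conjc (v (2 ^ L + k)%N j))) (iota 0 (2 ^ n))) (iota 0 (2 ^ n)).

Lemma comp_stored_vec : computable4 stored_vec.
Proof.
have cc := comp_read_crat; rewrite /stored_vec /stored_crats; compx.
by apply: comp_read_all; compx.
Qed.

Lemma comp_mixture_test : computable3 mixture_test.
Proof.
have cs := comp_stored_vec; have cc := comp_read_crat.
rewrite /mixture_test /stored_crats; compx.
by apply: comp_read_all; compx.
Qed.

Definition vec_tens n (phi psi : 'cV[rat[i]]_(2 ^ n)) : 'cV[rat[i]]_(2 ^ (n + n)) :=
  \col_i (phi (qhi i) ord0 * psi (qlo i) ord0).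

(** The mixture found depends on [nu] only, so the number [fstn m] of digits to read is known after
    the search: the digits need no delimiter and cost exactly their number. The side information is
    2n and has to be halved for the two simulations. *)
Lemma mixture_program (U : machine) (hU : universal U) : exists s : bits,
  forall n (nu : 'M[rat[i]]_(2 ^ n)) p1 p0 (phi : 'cV[rat[i]]_(2 ^ n)) m k,
  computes U (bits_of_nat n) p1 (code_mx nu) ->
  computes U (bits_of_nat n) p0 (code_mx phi) ->
  mixture_test n (mx_entries nu) m ->
  (forall m', (m' < m)%N -> ~~ mixture_test n (mx_entries nu) m') ->
  (k < 2 ^ fstn m)%N ->
  computes U (bits_of_nat (n + n)) (s ++ p1 ++ p0 ++ digits (fstn m) k)
    (code_mx (vec_tens phi (\col_j stored_vec n m k j))).
Proof.
pose half (y : bits) := (nat_of_bits y %/ 2)%N.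
pose rd (y : bits) : reader bits := let n := half y in
  rbind (rsim U (bits_of_nat n)) (fun r1 => rbind (rsim U (bits_of_nat n)) (fun r0 =>
  rbind (rsearch (mixture_test n (entries_of r1.1))) (fun m =>
  rbind (rtake (fstn m)) (fun r => rret (code_entries (2 ^ (n + n)) 1
    (mkseq (fun i => nth 0 (entries_of r0.1) (i %/ 2 ^ n) *
       stored_vec n m (binval r) (i %% 2 ^ n)) (2 ^ (n + n) * 1))))))).
have [|s hs] := @reader_program _ hU rd.
  have cm := comp_mixture_test; have cs := comp_stored_vec.
  by rewrite /rd /rbind /rret /half /binval; compx.
exists s => n nu p1 p0 phi m k h1 h0 tm mmin kL; apply: hs.
have hn : half (bits_of_nat (n + n)) = n.
  by rewrite /half bits_of_natK addnn -muln2 mulnK.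
rewrite -[digits _ _]cats0 /rd hn.
apply: reads_bind (reads_sim h1) _; apply: reads_bind (reads_sim h0) _.
rewrite -[digits _ _ ++ _]/([::] ++ _) !entries_ofK.
apply: reads_bind (reads_search tm mmin) _.
rewrite -{1}(size_digits (fstn m) k); apply: reads_bind (reads_take _) _.
rewrite digitsK // code_mxE.
rewrite (@mx_entriesE _ _ (vec_tens _ _) (fun i => nth 0 (mx_entries phi) (i %/ 2 ^ n) *
   stored_vec n m k (i %% 2 ^ n))); first exact: reads_ret.
move=> i j; rewrite !mxE !ord1 muln1 addn0.
by rewrite -(nth_mx_entries phi) /= muln1 addn0.
Qed.

Local Open Scope sesquilinear_scope.

(** * Positive semidefinite matrices *)

Section PositiveSemidefinite.
Variable R : realType.
Implicit Types (d : nat).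

Definition qform d (A : 'M[R[i]]_d) (x : 'I_d -> R[i]) : R[i] :=
  \sum_i \sum_j (x i)^* * A i j * x j.

Lemma qformE d (A : 'M[R[i]]_d) (v : 'cV[R[i]]_d) :
  (v ^t* *m A *m v) ord0 ord0 = qform A (fun i => v i ord0).
Proof.
rewrite mxE /qform exchange_big /=; apply: eq_bigr => j _.
by rewrite mxE mulr_suml; apply: eq_bigr => i _; rewrite !mxE.
Qed.

Lemma psdP d (A : 'M[R[i]]_d) : psd A <-> forall x, 0 <= qform A x.
Proof.
split=> h x; last by rewrite qformE.
have := h (\col_i x i); rewrite qformE; congr (0 <= _).
by apply: eq_bigr => i _; apply: eq_bigr => j _; rewrite !mxE.
Qed.

Lemma qformD d (A B : 'M[R[i]]_d) x : qform (A + B) x = qform A x + qform B x.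
Proof.
rewrite -big_split; apply: eq_bigr => i _; rewrite -big_split; apply: eq_bigr => j _.
by rewrite /= mxE mulrDr mulrDl.
Qed.

Lemma qformZ d a (A : 'M[R[i]]_d) x : qform (a *: A) x = a * qform A x.
Proof.
rewrite mulr_sumr; apply: eq_bigr => i _; rewrite mulr_sumr; apply: eq_bigr => j _.
by rewrite mxE mulrCA !mulrA.
Qed.

Lemma qform0 d x : qform (0 : 'M[R[i]]_d) x = 0.
Proof. by rewrite -(scale0r (0 : 'M[R[i]]_d)) qformZ mul0r. Qed.

Lemma qformB d (A B : 'M[R[i]]_d) x : qform (A - B) x = qform A x - qform B x.
Proof. by rewrite -scaleN1r qformD qformZ mulN1r. Qed.

Lemma qform_sum d (T : Type) (s : seq T) (A : T -> 'M[R[i]]_d) x :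
  qform (\sum_(t <- s) A t) x = \sum_(t <- s) qform (A t) x.
Proof.
by elim: s => [|t s IH]; rewrite ?big_nil ?qform0 // !big_cons qformD IH.
Qed.

Lemma psd_add d (A B : 'M[R[i]]_d) : psd A -> psd B -> psd (A + B).
Proof. by rewrite !psdP => hA hB x; rewrite qformD addr_ge0. Qed.

Lemma psd_scale d a (A : 'M[R[i]]_d) : 0 <= a -> psd A -> psd (a *: A).
Proof. by rewrite !psdP => a0 hA x; rewrite qformZ mulr_ge0. Qed.

Lemma psd_sum d (T : eqType) (s : seq T) (A : T -> 'M[R[i]]_d) :
  (forall t, t \in s -> psd (A t)) -> psd (\sum_(t <- s) A t).
Proof.
move=> h; apply/psdP => x; rewrite qform_sum big_seq; apply: sumr_ge0 => t /h.
by move=> /psdP; apply.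
Qed.

Lemma norm_ge0 (z : R[i]) : 0 <= z * z^*.
Proof. exact: mul_conjC_ge0. Qed.

Definition outer d (u : 'cV[R[i]]_d) : 'M[R[i]]_d := u *m u ^t*.

Lemma outerE d (u : 'cV[R[i]]_d) i j : outer u i j = u i ord0 * (u j ord0)^*.
Proof. by rewrite mxE big_ord1 !mxE. Qed.

Definition dotf d (u x : 'I_d -> R[i]) : R[i] := \sum_i (u i)^* * x i.

Lemma qform_outer d (u : 'cV[R[i]]_d) x :
  qform (outer u) x = (dotf (fun i => u i ord0) x)^* * dotf (fun i => u i ord0) x.
Proof.
rewrite /qform /dotf rmorph_sum mulr_suml; apply: eq_bigr => i _.
rewrite mulr_sumr; apply: eq_bigr => j _; rewrite outerE rmorphM /= conjCK; ring.
Qed.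

Lemma psd_outer d (u : 'cV[R[i]]_d) : psd (outer u).
Proof. by apply/psdP => x; rewrite qform_outer mulrC norm_ge0. Qed.

Lemma tr_mul_outer d (A : 'M[R[i]]_d) (u : 'cV[R[i]]_d) :
  \tr (A *m outer u) = qform A (fun i => u i ord0).
Proof.
rewrite /mxtrace /qform; apply: eq_bigr => i _; rewrite mxE.
by apply: eq_bigr => j _; rewrite outerE; ring.
Qed.

(* The restriction of the form to the span of two basis vectors. *)
Lemma psd_two d (A : 'M[R[i]]_d) i j a b : psd A ->
  0 <= a^* * a * A i i + b^* * b * A j j + a^* * b * A i j + b^* * a * A j i.
Proof.
move=> /psdP/(_ (fun k => a * (k == i)%:R + b * (k == j)%:R)).
congr (0 <= _).
have S (c : 'I_d -> R[i]) k : \sum_l c l * (l == k)%:R = c k :> R[i].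
  rewrite (bigD1 k) //= eqxx mulr1 big1 ?addr0 // => l /negbTE ->.
  by rewrite mulr0.
rewrite /qform.
transitivity (\sum_k (a * (k == i)%:R + b * (k == j)%:R)^* * (A k i * a + A k j * b)).
  apply: eq_bigr => k _; rewrite -(S (fun l => A k l) i) -(S (fun l => A k l) j).
  rewrite !mulr_suml -big_split mulr_sumr; apply: eq_bigr => l _ /=; ring.
transitivity (\sum_k ((a^* * (A k i * a + A k j * b)) * (k == i)%:R
    + (b^* * (A k i * a + A k j * b)) * (k == j)%:R)).
  apply: eq_bigr => k _; rewrite rmorphD !rmorphM /= !conjC_nat; ring.
rewrite big_split /= (S (fun k => a^* * (A k i * a + A k j * b))).
rewrite (S (fun k => b^* * (A k i * a + A k j * b))); ring.
Qed.

Lemma psd_diag_ge0 d (A : 'M[R[i]]_d) i : psd A -> 0 <= A i i.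
Proof.
by move=> /(psd_two i i 1 0); rewrite !rmorph1 rmorph0 !mul0r !mulr0 !mul1r !mul0r !addr0.
Qed.

(** Over the complex numbers positivity implies hermiticity: the form is real at e_i + e_j and at
    e_i + sqrt(-1) e_j. *)
Lemma psd_herm d (A : 'M[R[i]]_d) i j : psd A -> A j i = (A i j)^*.
Proof.
move=> pA; have /ger0_Im := psd_diag_ge0 i pA; have /ger0_Im := psd_diag_ge0 j pA.
have := psd_two i j 1 1 pA; have := psd_two i j 1 (Complex 0 1) pA.
case: (A i i) => a a'; case: (A j j) => b b'; case: (A i j) => c c'.
case: (A j i) => e e' => h1 h2 /= b0 a0.
move: h1 h2; rewrite !lecE => /andP[/eqP + _] /andP[/eqP + _].
rewrite b0 a0 /=; simpc => h1 h2; congr Complex; lra.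
Qed.

Lemma psd_zero_diag d (A : 'M[R[i]]_d) i j : psd A -> A i i = 0 -> A i j = 0.
Proof.
move=> pA ii; apply/eqP; apply: contraT => ne.
pose n2 : R[i] := A i j * (A i j)^*.
have n20 : 0 < n2 by rewrite /n2 mul_conjC_gt0.
(* With this [s], the form at - s A_ij e_i + e_j equals A_jj - 2 s |A_ij|^2 = -1. *)
pose s : R[i] := (A j j + 1) / (n2 *+ 2).
have sr : s^* = s.
  have r1 : (A j j)^* = A j j by rewrite -(psd_herm j j pA).
  have r2 : n2^* = n2 by rewrite /n2 rmorphM /= conjCK mulrC.
  by rewrite /s fmorph_div rmorphD rmorph1 rmorphMn /= r1 r2.
have := psd_two i j (- s * A i j) 1 pA.
have -> : (- s * A i j)^* = - s * (A i j)^* by rewrite rmorphM /= rmorphN /= sr.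
rewrite ii (psd_herm i j pA) rmorph1.
set e := (X in 0 <= X); have -> : e = A j j - s * (n2 *+ 2) by rewrite /e /n2; ring.
rewrite /s divfK ?mulrn_eq0 ?gt_eqF // opprD addNKr.
by rewrite oppr_ge0 ler10.
Qed.

Section Decomposition.
Variables (F : fieldType) (cj : F -> F) (f : {rmorphism F -> R[i]}).
Hypothesis f_cj : forall x, f (cj x) = (f x)^*.

(** The decomposition is carried out inside a field [F] with a conjugation, embedded in R[i], and
    serves both for R[i] and for rat[i]. Pivots are kept as coefficients, so no square root leaves
    [F]. *)
Definition outer_with d (u : 'cV[F]_d) : 'M[F]_d :=
  \matrix_(i, j) (u i ord0 * cj (u j ord0)).

Lemma map_outer_with d (u : 'cV[F]_d) : map_mx f (outer_with u) = outer (map_mx f u).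
Proof. by apply/matrixP => i j; rewrite outerE !mxE rmorphM /= f_cj. Qed.

(* Repeatedly subtracting A e e^* A / (e^* A e) clears one row after another. *)
Lemma psd_schur d (A : 'M[R[i]]_d) k : psd A -> A k k != 0 ->
  psd (A - (A k k)^-1 *: outer (col k A)).
Proof.
move=> pA a0; have := pA; rewrite !psdP => h x.
have ra : (A k k)^* = A k k by rewrite -(psd_herm k k pA).
have [c cE] : exists c : R[i], \sum_j A k j * x j = c by eexists.
have dE : dotf (fun i => col k A i ord0) x = c.
  by rewrite -cE; apply: eq_bigr => j _; rewrite mxE -(psd_herm j k pA).
(* The form of the Schur complement at x is the form of A at x moved along e_k so as to become
   orthogonal, for A, to e_k. *)
have := h (fun i => x i - (A k k)^-1 * c * (i == k)%:R).
congr (0 <= _); rewrite qformB qformZ qform_outer dE.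
have S (g : 'I_d -> R[i]) l : \sum_i g i * (i == l)%:R = g l.
  rewrite (bigD1 l) //= eqxx mulr1 big1 ?addr0 // => i /negbTE ->.
  by rewrite mulr0.
transitivity (\sum_i (x i - (A k k)^-1 * c * (i == k)%:R)^* *
    (\sum_j A i j * x j - (A k k)^-1 * c * A i k)).
  apply: eq_bigr => i _; rewrite -(S (fun j => A i j) k).
  rewrite [_ * \sum_i0 _ * (_ == _)%:R]mulr_sumr -sumrB mulr_sumr.
  apply: eq_bigr => j _; ring.
transitivity (\sum_i ((x i)^* * (\sum_j A i j * x j - (A k k)^-1 * c * A i k) -
    ((A k k)^-1 * c)^* * (\sum_j A i j * x j - (A k k)^-1 * c * A i k) * (i == k)%:R)).
  apply: eq_bigr => i _; rewrite rmorphB rmorphM /= conjC_nat; ring.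
rewrite sumrB (S (fun i => ((A k k)^-1 * c)^* *
  (\sum_j A i j * x j - (A k k)^-1 * c * A i k))) cE.
rewrite [_ * c * A k k]mulrAC mulVf // mul1r subrr mulr0 subr0.
rewrite /qform; transitivity (\sum_i (\sum_j (x i)^* * A i j * x j -
   (A k k)^-1 * c * ((x i)^* * A i k))).
  apply: eq_bigr => i _; rewrite mulrBr mulr_sumr; congr (_ - _); last by ring.
  by apply: eq_bigr => j _; rewrite mulrA.
rewrite sumrB -mulr_sumr; congr (_ - _); rewrite -mulrA [c * _]mulrC; congr (_ * (_ * _)).
rewrite -cE rmorph_sum; apply: eq_bigr => i _.
by rewrite rmorphM /= -(psd_herm k i pA) mulrC.
Qed.

Lemma psd_decomposition d (A : 'M[F]_d) : psd (map_mx f A) ->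
  exists2 s : seq (F * 'cV[F]_d), (forall p, p \in s -> 0 <= f p.1) &
    A = \sum_(p <- s) p.1 *: outer_with p.2.
Proof.
(* Induction on the number [k] of rows that may be nonzero, the first [d - k] rows being cleared
   already. A vanishing pivot needs no work, as its row then vanishes by [psd_zero_diag]. *)
suff H k (B : 'M[F]_d) : (k <= d)%N -> psd (map_mx f B) ->
    (forall i j : 'I_d, (i < d - k)%N -> B i j = 0) ->
    exists2 s : seq (F * 'cV[F]_d), (forall p, p \in s -> 0 <= f p.1) &
      B = \sum_(p <- s) p.1 *: outer_with p.2.
  by move=> pA; apply: (H d) => // i j; rewrite subnn.
elim: k B => [|k IH] B kd pB zB.
  exists [::] => //; rewrite big_nil; apply/matrixP => i j.
  by rewrite zB ?subn0 // mxE.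
have ld : (d - k.+1 < d)%N by rewrite -subn_gt0 subKn.
pose l := Ordinal ld.
have lE (i : 'I_d) : (i < d - k)%N -> (i < d - k.+1)%N \/ i = l :> nat.
  by rewrite /=; lia.
have fl : (map_mx f B) l l = f (B l l) by rewrite mxE.
case: (eqVneq (B l l) 0) => bl.
  apply: (IH _ (ltnW kd) pB) => i j /lE[/zB //|/val_inj ->].
  apply: (fmorph_inj f); rewrite rmorph0; have := @psd_zero_diag _ _ l j pB.
  by rewrite fl mxE bl rmorph0; apply.
have fbl : f (B l l) != 0 by rewrite fmorph_eq0.
pose B' := B - (B l l)^-1 *: outer_with (col l B).
have mB' : map_mx f B' =
    map_mx f B - ((map_mx f B) l l)^-1 *: outer (col l (map_mx f B)).
  rewrite /B' map_mxB map_mxZ map_outer_with fmorphV fl; congr (_ - _ *: outer _).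
  by apply/matrixP => i j; rewrite !mxE.
have herm i j : B j i = cj (B i j).
  by apply: (fmorph_inj f); rewrite f_cj; have := psd_herm i j pB; rewrite !mxE.
have [|i j /lE[il|/val_inj ->]|s s0 sE] := IH B' (ltnW kd).
- by rewrite mB'; apply: psd_schur => //; rewrite fl.
- by rewrite /B' !mxE (zB i j il) (zB i l il) mul0r mulr0 subr0.
- by rewrite /B' !mxE -herm mulrA mulVf // mul1r subrr.
exists (((B l l)^-1, col l B) :: s).
  move=> p; rewrite inE => /orP[/eqP->|/s0 //] /=.
  by rewrite fmorphV invr_ge0 -fl; exact: psd_diag_ge0.
by rewrite big_cons /= -sE /B' addrC subrK.
Qed.

End Decomposition.
End PositiveSemidefinite.

Section PsdProducts.
Variable R : realType.

(** Weaker than a diagonalization: the vectors are pivot columns, in general neither orthogonal nor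
    normalized. Only positivity of the weights is used below. *)
Lemma psd_spectral d (A : 'M[R[i]]_d) : psd A ->
  exists2 s : seq (R[i] * 'cV[R[i]]_d), (forall p, p \in s -> 0 <= p.1) &
    A = \sum_(p <- s) p.1 *: outer p.2.
Proof.
move=> pA; have idE : map_mx idfun A = A by apply/matrixP => i j; rewrite mxE.
have [||s s0 sE] := @psd_decomposition R R[i] Num.conj idfun _ d A.
- by move=> x; reflexivity.
- by rewrite idE.
exists s => //; rewrite sE; apply: eq_bigr => p _; congr (_ *: _).
by apply/matrixP => i j; rewrite outerE mxE.
Qed.

Lemma tr_mul_ge0 d (A B : 'M[R[i]]_d) : psd A -> psd B -> 0 <= \tr (A *m B).
Proof.
move=> pA /psd_spectral[s s0 ->]; rewrite mulmx_sumr raddf_sum big_seq.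
apply: sumr_ge0 => p /s0 p0; rewrite /= -scalemxAr mxtraceZ tr_mul_outer.
by rewrite mulr_ge0 //; move/psdP: pA; apply.
Qed.

(** A tensor product is the entrywise product of two such pullbacks; this reduces [psd_qtens] and
    [psd_spread] to [psd_hadamard]. *)
Lemma psd_pullback d d' (g : 'I_d' -> 'I_d) (A : 'M[R[i]]_d) :
  psd A -> psd (\matrix_(i, j) A (g i) (g j)).
Proof.
move=> /psd_spectral[s s0 ->].
have -> : \matrix_(i, j) (\sum_(p <- s) p.1 *: outer p.2) (g i) (g j) =
    \sum_(p <- s) p.1 *: outer (\col_i p.2 (g i) ord0).
  apply/matrixP => i j; rewrite mxE !summxE; apply: eq_bigr => p _.
  by rewrite !mxE !big_ord1 !mxE.
apply: psd_sum => p /s0 p0; exact: psd_scale p0 (psd_outer _).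
Qed.

(** Schur's product theorem: entrywise multiplication by u u^* is conjugation by a diagonal matrix,
    and A is a positive combination of such u u^*. *)
Lemma psd_hadamard d (A B : 'M[R[i]]_d) :
  psd A -> psd B -> psd (\matrix_(i, j) (A i j * B i j)).
Proof.
move=> /psd_spectral[s s0 ->] pB.
have -> : \matrix_(i, j) ((\sum_(p <- s) p.1 *: outer p.2) i j * B i j) =
    \sum_(p <- s) p.1 *: \matrix_(i, j) (outer p.2 i j * B i j).
  apply/matrixP => i j; rewrite mxE !summxE mulr_suml; apply: eq_bigr => p _.
  by rewrite !mxE mulrA.
apply: psd_sum => p /s0 p0; apply: (psd_scale p0); apply/psdP => x.
move/psdP/(_ (fun i => (p.2 i ord0)^* * x i)): pB; congr (0 <= _).
apply: eq_bigr => i _; apply: eq_bigr => j _.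
by rewrite rmorphM /= conjCK [in RHS]mxE outerE; ring.
Qed.

Lemma psd_qtens k l (A : 'M[R[i]]_(2 ^ k)) (B : 'M[R[i]]_(2 ^ l)) :
  psd A -> psd B -> psd (qtens A B).
Proof.
move=> pA pB; have -> : qtens A B = \matrix_(i, j)
    ((\matrix_(i, j) A (qhi i) (qhi j)) i j * (\matrix_(i, j) B (qlo i) (qlo j)) i j).
  by apply/matrixP => i j; rewrite qtensE !mxE.
by apply: psd_hadamard; exact: psd_pullback.
Qed.

Lemma psd_spread n (nu xi : 'M[R[i]]_(2 ^ n)) Y :
  psd nu -> psd xi -> psd Y -> psd (spread nu xi Y).
Proof.
move=> pn px pY; have -> : spread nu xi Y = \matrix_(i, j)
    ((\matrix_(i, j) ((\matrix_(i, j) Y (kept i) (kept j)) i j *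
      (\matrix_(i, j) nu (anc1 i) (anc1 j)) i j)) i j *
     (\matrix_(i, j) xi (anc2 i) (anc2 j)) i j).
  by apply/matrixP => i j; rewrite !mxE.
by apply: psd_hadamard; first apply: psd_hadamard; exact: psd_pullback.
Qed.

Lemma psd_slice n (nu xi : 'M[R[i]]_(2 ^ n)) X :
  psd nu -> psd xi -> psd X -> psd (slice nu xi X).
Proof.
move=> pn px pX; apply/psdP => x.
have -> : qform (slice nu xi X) x = \tr (slice nu xi X *m outer (\col_i x i)).
  rewrite tr_mul_outer; apply: eq_bigr => i _; apply: eq_bigr => j _.
  by rewrite !mxE.
rewrite tr_slice; apply: (tr_mul_ge0 pX); exact: psd_spread pn px (psd_outer _).
Qed.

Lemma tr_qtens k l (A : 'M[R[i]]_(2 ^ k)) (B : 'M[R[i]]_(2 ^ l)) :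
  \tr (qtens A B) = \tr A * \tr B.
Proof.
rewrite /mxtrace sum_qjoin mulr_suml; apply: eq_bigr => a _.
by rewrite mulr_sumr; apply: eq_bigr => b _; rewrite qtensE !qhiK !qloK.
Qed.

Lemma psd_id d : psd (1%:M : 'M[R[i]]_d).
Proof.
apply/psdP => x; apply: sumr_ge0 => i _; rewrite (bigD1 i) //= big1.
  by rewrite mxE eqxx mulr1 addr0 mulrC norm_ge0.
by move=> j ji; rewrite mxE eq_sym (negbTE ji) mulr0 mul0r.
Qed.

Lemma qform_id d (x : 'I_d -> R[i]) : qform 1%:M x = \sum_i (x i)^* * x i.
Proof.
apply: eq_bigr => i _; rewrite (bigD1 i) //= big1.
  by rewrite mxE eqxx mulr1 addr0.
by move=> j ji; rewrite mxE eq_sym (negbTE ji) mulr0 mul0r.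
Qed.

(* Lagrange's identity: the form at x is half of
   sum_(i, j) |u_i^* x_j^* - u_j^* x_i^*|^2. *)
Lemma psd_cauchy_schwarz d (u : 'cV[R[i]]_d) : psd ((\tr (outer u))%:M - outer u).
Proof.
apply/psdP => x; rewrite -scalemx1 qformB qformZ qform_id qform_outer.
set D := dotf _ x; have -> : \tr (outer u) = \sum_i u i ord0 * (u i ord0)^*.
  by apply: eq_bigr => i _; rewrite outerE.
set e := _ - _.
suff E : e *+ 2 = \sum_i \sum_j
    (u i ord0 * x j - u j ord0 * x i) * (u i ord0 * x j - u j ord0 * x i)^*.
  by rewrite -(pmulrn_lge0 _ (ltn0Sn 1)) E; do 2!apply: sumr_ge0 => ? _; exact: norm_ge0.
pose a i j : R[i] := u i ord0 * (u i ord0)^* * ((x j)^* * x j).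
pose b i j : R[i] := ((u i ord0)^* * x i)^* * ((u j ord0)^* * x j).
have aE : (\sum_i u i ord0 * (u i ord0)^*) * (\sum_i (x i)^* * x i) =
    \sum_i \sum_j a i j.
  by rewrite mulr_suml; apply: eq_bigr => i _; rewrite mulr_sumr.
have bE : D^* * D = \sum_i \sum_j b i j.
  by rewrite /D /dotf rmorph_sum mulr_suml; apply: eq_bigr => i _; rewrite mulr_sumr.
rewrite /e aE bE mulr2n.
rewrite {2}exchange_big [X in _ + (_ - X)]exchange_big /= -!sumrB -big_split /=.
apply: eq_bigr => i _; rewrite -!sumrB -big_split /=; apply: eq_bigr => j _.
rewrite /a /b rmorphB !rmorphM /= !conjCK; ring.
Qed.

Lemma psd_trace_bound d (A : 'M[R[i]]_d) : psd A -> psd ((\tr A)%:M - A).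
Proof.
move=> /psd_spectral[s s0 ->].
have -> : (\tr (\sum_(p <- s) p.1 *: outer p.2))%:M - \sum_(p <- s) p.1 *: outer p.2 =
    \sum_(p <- s) p.1 *: ((\tr (outer p.2))%:M - outer p.2).
  rewrite [\tr _]raddf_sum /= -scalemx1 scaler_suml -sumrB; apply: eq_bigr => p _.
  by rewrite mxtraceZ scalerBr -scalerA scalemx1.
by apply: psd_sum => p /s0 p0; exact: psd_scale p0 (psd_cauchy_schwarz _).
Qed.

Lemma psd_id_sub d (A : 'M[R[i]]_d) : density A -> psd (1%:M - A).
Proof. by case=> pA trA; have := psd_trace_bound pA; rewrite trA. Qed.

(** The spread of the identity is block diagonal, with one block nu (x) xi for each basis state of
    the kept qubits, and a density matrix is at most the identity. *)
Lemma psd_id_spread n (nu xi : 'M[R[i]]_(2 ^ n)) : density nu -> density xi ->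
  psd (1%:M - spread nu xi 1%:M).
Proof.
move=> [pn tn] [px tx]; have /psd_id_sub/psdP h : density (qtens nu xi).
  by split; [exact: psd_qtens | rewrite tr_qtens tn tx mulr1].
apply/psdP => x; rewrite qformB qform_id.
pose y K i := x (anc_join K (qhi i) (qlo i)).
have -> : qform (spread nu xi 1%:M) x = \sum_K qform (qtens nu xi) (y K).
  rewrite /qform sum_anc_join; apply: eq_bigr => K _.
  rewrite [RHS]sum_qjoin; apply: eq_bigr => b _; apply: eq_bigr => c _.
  rewrite sum_anc_join (bigD1 K) //= [X in _ + X]big1 ?addr0.
    rewrite [RHS]sum_qjoin; apply: eq_bigr => b' _; apply: eq_bigr => c' _.
    rewrite /y qtensE mxE !qhiK !qloK !kept_join !anc1_join !anc2_join mxE eqxx.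
    by rewrite mul1r.
  move=> L LK; apply: big1 => b' _; apply: big1 => c' _.
  by rewrite mxE !kept_join mxE eq_sym (negbTE LK) !mul0r mulr0 mul0r.
have -> : \sum_i (x i)^* * x i = \sum_K qform 1%:M (y K).
  rewrite sum_anc_join; apply: eq_bigr => K _; rewrite qform_id sum_qjoin.
  by apply: eq_bigr => b _; apply: eq_bigr => c _; rewrite /y qhiK qloK.
by rewrite -sumrB; apply: sumr_ge0 => K _; rewrite -qformB.
Qed.

(** With [psd_slice], this keeps the approximations of a sliced test semi-density matrices, as lower
    computability demands. *)
Lemma tr_slice_le n (nu xi : 'M[R[i]]_(2 ^ n)) X : density nu -> density xi ->
  psd X -> \tr (slice nu xi X) <= \tr X.
Proof.
move=> dn dx pX; rewrite -[slice nu xi X]mulmx1 tr_slice -[X in _ <= \tr X]mulmx1.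
rewrite -subr_ge0 -raddfB /= -mulmxBr.
exact: tr_mul_ge0 pX (psd_id_spread dn dx).
Qed.

(** The form at e_i + b e_j is nonnegative for b = 1, -1, sqrt(-1), - sqrt(-1), and diagonal entries
    are at most 1. The bound makes weighted sums of semi-density matrices absolutely convergent
    entry by entry. *)
Lemma psd_Re_bound d (A : 'M[R[i]]_d) i j : semi_density A ->
  `|complex.Re (A i j)| <= 1 /\ `|complex.Im (A i j)| <= 1.
Proof.
move=> [pA trA].
have dge k := psd_diag_ge0 k pA.
have dle k : A k k <= 1.
  apply: le_trans trA; rewrite /mxtrace (bigD1 k) //= lerDl.
  by apply: sumr_ge0 => l _.
have h1 := psd_two i j 1 1 pA; have h2 := psd_two i j 1 (-1) pA.
have h3 := psd_two i j 1 (Complex 0 1) pA; have h4 := psd_two i j 1 (Complex 0 (-1)) pA.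
have := dle i; have := dle j; have := dge i; have := dge j.
move: h1 h2 h3 h4; rewrite (psd_herm i j pA).
case: (A i i) => a a'; case: (A j j) => b b'; case: (A i j) => c c'; simpc.
move=> /andP[_ h1] /andP[_ h2] /andP[_ h3] /andP[_ h4].
move=> /andP[_ h5] /andP[_ h6] /andP[_ h7] /andP[_ h8] /=.
rewrite !ler_norml; split; apply/andP; split; lra.
Qed.

End PsdProducts.

(** * Rational matrices and rational points of the unit sphere *)

Section Embedding.
Variable R : realType.

Definition emb_c (z : rat[i]) : R[i] :=
  Complex (ratr (complex.Re z)) (ratr (complex.Im z)).

Lemma emb_c_is_additive : additive emb_c.
Proof. by move=> [a b] [c d]; rewrite /emb_c /= !rmorphB. Qed.

Lemma emb_c_is_multiplicative : multiplicative emb_c.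
Proof.
by split=> [[a b] [c d]|]; rewrite /emb_c /= ?rmorphB ?rmorphD ?rmorphM ?rmorph1 ?rmorph0.
Qed.

HB.instance Definition _ := GRing.isAdditive.Build rat[i] R[i] emb_c emb_c_is_additive.
HB.instance Definition _ :=
  GRing.isMultiplicative.Build rat[i] R[i] emb_c emb_c_is_multiplicative.

Lemma emb_conjc z : emb_c (conjc z) = (emb_c z)^*.
Proof. by case: z => a b; rewrite /emb_c /= rmorphN. Qed.

Lemma emb_c_inj : injective emb_c.
Proof. exact: fmorph_inj. Qed.

Definition ratC (q : rat) : rat[i] := Complex q 0.

Lemma ratC_is_additive : additive ratC.
Proof. by move=> a b; rewrite /ratC; simpc. Qed.

Lemma ratC_is_multiplicative : multiplicative ratC.
Proof. by split=> [a b|]; rewrite /ratC; simpc. Qed.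

HB.instance Definition _ := GRing.isAdditive.Build rat rat[i] ratC ratC_is_additive.
HB.instance Definition _ :=
  GRing.isMultiplicative.Build rat rat[i] ratC ratC_is_multiplicative.

Lemma emb_ratC_ge0 q : (0 <= emb_c (ratC q)) = (0 <= q).
Proof. by rewrite lecE /= rmorph0 eqxx /= ler0q. Qed.

Lemma emb_c_ge0 z : 0 <= emb_c z -> exists2 q, 0 <= q & z = ratC q.
Proof.
case: z => a b; rewrite lecE /= => /andP[/eqP b0 a0]; exists a; first by rewrite -(ler0q R).
by move/eqP: b0; rewrite fmorph_eq0 => /eqP ->.
Qed.

Definition router d (u : 'cV[rat[i]]_d) : 'M[rat[i]]_d := outer_with (@conjc rat) u.

Lemma emb_router d (u : 'cV[rat[i]]_d) : map_mx emb_c (router u) = outer (map_mx emb_c u).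
Proof. exact: (@map_outer_with R rat[i] (@conjc rat) emb_c emb_conjc). Qed.

(* A variant rather than a definition, so that it is not unfolded by mistake. *)
Variant rpsd d (A : 'M[rat[i]]_d) : Prop := Rpsd of psd (map_mx emb_c A).

Lemma rpsd_add d (A B : 'M[rat[i]]_d) : rpsd A -> rpsd B -> rpsd (A + B).
Proof. by move=> [hA] [hB]; split; rewrite map_mxD; exact (psd_add hA hB). Qed.

Lemma rpsd_scale d q (A : 'M[rat[i]]_d) : 0 <= q -> rpsd A -> rpsd (ratC q *: A).
Proof.
move=> q0 [hA]; split; rewrite map_mxZ; refine (psd_scale _ hA).
by rewrite emb_ratC_ge0.
Qed.

Lemma rpsd_router d (u : 'cV[rat[i]]_d) : rpsd (router u).
Proof. by split; rewrite emb_router; exact (psd_outer _). Qed.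

Lemma rpsd_sum d (T : eqType) (s : seq T) (A : T -> 'M[rat[i]]_d) :
  (forall t, rpsd (A t)) -> rpsd (\sum_(t <- s) A t).
Proof.
move=> h; elim: s => [|t s IH]; last by rewrite big_cons; exact (rpsd_add (h t) IH).
rewrite big_nil; split; rewrite map_mx0; apply/psdP => x.
by rewrite qform0.
Qed.

Lemma rpsd_decomposition d (A : 'M[rat[i]]_d) : rpsd A ->
  exists2 s : seq (rat * 'cV[rat[i]]_d), (forall p, p \in s -> 0 <= p.1) &
    A = \sum_(p <- s) ratC p.1 *: router p.2.
Proof.
move=> [/(psd_decomposition emb_conjc)[s s0 ->]].
elim: s s0 => [|[z u] s IH] s0; first by exists [::]; rewrite ?big_nil.
have [q q0 /= ->] := emb_c_ge0 (s0 _ (mem_head _ _)).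
have [|s' s'0 e] := IH; first by move=> p ps; apply: s0; rewrite inE ps orbT.
exists ((q, u) :: s'); last by rewrite !big_cons e.
by move=> p; rewrite inE => /orP[/eqP->|/s'0].
Qed.

Lemma sum_nseq (V : nmodType) (T : Type) (F : T -> V) k x :
  \sum_(v <- nseq k x) F v = F x *+ k.
Proof. by elim: k => [|k IH]; rewrite ?big_nil ?mulr0n // big_cons IH mulrS. Qed.

(* A nonnegative rational a / b is the sum of a b squares (1 / b)^2. *)
Lemma rpsd_sum_outer d (A : 'M[rat[i]]_d) : rpsd A ->
  exists vs : seq 'cV[rat[i]]_d, A = \sum_(v <- vs) router v.
Proof.
move=> /rpsd_decomposition[s s0 ->].
elim: s s0 => [|[q u] s IH] s0; first by exists [::]; rewrite !big_nil.
have [|vs e] := IH; first by move=> p ps; apply: s0; rewrite inE ps orbT.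
have q0 : 0 <= q := s0 _ (mem_head _ _).
pose b := `|denq q|%N; pose a := `|numq q|%N.
exists (nseq (a * b) (ratC b%:R^-1 *: u) ++ vs).
rewrite big_cat /= big_cons -e; congr (_ + _).
rewrite sum_nseq.
have -> : router (ratC b%:R^-1 *: u) = ratC (b%:R^-1 ^+ 2) *: router u.
  apply/matrixP => i j; rewrite !mxE expr2 [ratC (_ * _)]rmorphM /=.
  have -> : conjc (ratC b%:R^-1 * u j ord0) = ratC b%:R^-1 * conjc (u j ord0).
    by case: (u j ord0) => x y; rewrite /ratC; simpc.
  by ring.
rewrite -scaler_nat scalerA -(rmorph_nat ratC) -rmorphM /=; congr (ratC _ *: _).
have b0 : (b%:R : rat) != 0 by rewrite pnatr_eq0 -lt0n absz_gt0.
rewrite natrM expr2 mulrA mulfK // -[LHS]divq_num_den; congr (_ / _).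
  by rewrite /a pmulrn gez0_abs ?numq_ge0.
by rewrite /b pmulrn gtz0_abs ?denq_gt0.
Qed.

Definition sqnorm d (u : 'cV[rat[i]]_d) : rat[i] :=
  \sum_j u j ord0 * conjc (u j ord0).

Lemma conjc_ratC q : conjc (ratC q) = ratC q.
Proof. by rewrite /ratC /= oppr0. Qed.

Lemma ratCconjM (q : rat) (z : rat[i]) : conjc (ratC q * z) = ratC q * conjc z.
Proof. by case: z => x y; rewrite /ratC; simpc. Qed.

Lemma conjcD (z w : rat[i]) : conjc (z + w) = conjc z + conjc w.
Proof. by case: z => a b; case: w => c e; simpc; congr Complex; ring. Qed.

Lemma conjcN (z : rat[i]) : conjc (- z) = - conjc z.
Proof. by case: z. Qed.

Lemma conjcM (z w : rat[i]) : conjc (z * w) = conjc z * conjc w.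
Proof. by case: z => a b; case: w => c e; simpc; congr Complex; ring. Qed.

Lemma mul_conjc_ratC (z : rat[i]) :
  z * conjc z = ratC (complex.Re z ^+ 2 + complex.Im z ^+ 2).
Proof. by case: z => a b; rewrite /ratC; simpc; congr Complex; rewrite /=; ring. Qed.

Lemma sqnorm_ratC d (u : 'cV[rat[i]]_d) : exists2 q, 0 <= q & sqnorm u = ratC q.
Proof.
exists (\sum_j (complex.Re (u j ord0) ^+ 2 + complex.Im (u j ord0) ^+ 2)).
  by apply: sumr_ge0 => j _; rewrite addr_ge0 ?sqr_ge0.
by rewrite rmorph_sum; apply: eq_bigr => j _; rewrite mul_conjc_ratC.
Qed.

(** A rational between half the real square root and the square root itself. *)
Lemma rational_sqrt_approx (N : rat) : 0 < N -> exists2 s : rat, 0 < s &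
  N <= 4 * s ^+ 2 /\ s ^+ 2 <= N.
Proof.
move=> N0; have rN0 : 0 < ratr N :> R by rewrite ltr0q.
have sq0 : 0 < Num.sqrt (ratr N) :> R by rewrite sqrtr_gt0.
have lt : Num.sqrt (ratr N) / 2 < Num.sqrt (ratr N) :> R.
  by rewrite ltr_pdivrMr // ltr_pMr // ltr1n.
have [s hs] := rat_in_itvoo lt; have := hs; rewrite in_itv /= => /andP[h1 h2].
have s0 : 0 < s by rewrite -(ltr0q R); apply: lt_trans h1; rewrite divr_gt0.
have sr0 : 0 < ratr s :> R by rewrite ltr0q.
have e := sqr_sqrtr (ltW rN0).
exists s => //; split.
  rewrite -(ler_rat R) rmorphM rmorphXn /= -e rmorph_nat.
  by move: (Num.sqrt _) h1 h2 sq0 => r h1 h2 r0; nra.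
rewrite -(ler_rat R) rmorphXn /= -e.
by move: (Num.sqrt _) h1 h2 sq0 => r h1 h2 r0; nra.
Qed.


Section UnitCover.
Variables (d : nat) (i0 : 'I_d).

Definition basis_vec : 'cV[rat[i]]_d := \col_i (i == i0)%:R.

(** Pythagoras: [l] is orthogonal to the basis vector. *)
Lemma sqnorm_basis_comb (a b : rat) (l : 'cV[rat[i]]_d) : l i0 ord0 = 0 ->
  sqnorm (ratC a *: basis_vec + ratC b *: l) =
  ratC (a ^+ 2) + ratC (b ^+ 2) * sqnorm l.
Proof.
move=> l0; rewrite /sqnorm.
have e1 : \sum_j (ratC a * (j == i0)%:R) * (ratC a * (j == i0)%:R) = ratC (a ^+ 2).
  rewrite (bigD1 i0) //= big1 ?addr0 ?eqxx ?mulr1 ?expr2 ?rmorphM // => j /negbTE ->.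
  by rewrite mulr0 mul0r.
rewrite -e1 mulr_sumr -big_split; apply: eq_bigr => j _.
rewrite !mxE conjcD !ratCconjM.
have -> : conjc ((j == i0)%:R) = (j == i0)%:R :> rat[i].
  by rewrite -(rmorph_nat ratC) conjc_ratC.
rewrite expr2 [ratC (b * b)]rmorphM.
case: (eqVneq j i0) => [->|ne]; last by rewrite /=; ring.
rewrite l0 (_ : conjc 0 = 0 :> rat[i]); last by rewrite -(rmorph0 ratC) conjc_ratC.
by rewrite /=; ring.
Qed.

Lemma sqnorm0 (u : 'cV[rat[i]]_d) : sqnorm u = 0 -> u = 0.
Proof.
move=> u0; apply/matrixP => j k; rewrite ord1 mxE.
have : \sum_j (complex.Re (u j ord0) ^+ 2 + complex.Im (u j ord0) ^+ 2) = 0 :> rat.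
  apply: (fmorph_inj ratC); rewrite rmorph0 -u0 rmorph_sum.
  by apply: eq_bigr => i _; rewrite mul_conjc_ratC.
move=> /eqP; rewrite psumr_eq0; last by move=> i _; rewrite addr_ge0 ?sqr_ge0.
move=> /allP/(_ j (mem_index_enum _))/=.
rewrite paddr_eq0 ?sqr_ge0 // !sqrf_eq0.
by case: (u j ord0) => a b /= /andP[/eqP-> /eqP->].
Qed.

(* With l = l' + x e, l' orthogonal to e, the rational points
   a e + b l', a e - b l' of the unit sphere (stereographic projection) satisfy
   l l^* <= 2 l' l'^* + 2 |x|^2 e e^* and b is within a factor of 1 / |l'|. *)
Lemma unit_cover (l : 'cV[rat[i]]_d) (N : rat) : sqnorm l = ratC N ->
  exists F : seq 'cV[rat[i]]_d, [/\ size F = 4%N,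
    forall u, u \in F -> sqnorm u = 1 &
    rpsd (ratC (2 * N) *: \sum_(u <- F) router u - router l)].
Proof.
move=> lN; pose x := l i0 ord0.
pose l' := l - x *: basis_vec.
have l'0 : l' i0 ord0 = 0 by rewrite !mxE eqxx mulr1 subrr.
have [N' N'0 l'N] := sqnorm_ratC l'.
pose X := complex.Re x ^+ 2 + complex.Im x ^+ 2.
have X0 : 0 <= X by rewrite addr_ge0 ?sqr_ge0.
have NE : N = N' + X.
  apply: (fmorph_inj ratC); rewrite rmorphD /= -lN -l'N /X -mul_conjc_ratC.
  rewrite /sqnorm (bigD1 i0) //= [in RHS](bigD1 i0) //= l'0 mul0r add0r addrC.
  congr (_ + _); apply: eq_bigr => j /negbTE ji.
  by rewrite !mxE ji mulr0 subr0.
have [a [b [ab hb]]] : exists a b : rat, a ^+ 2 + b ^+ 2 * N' = 1 /\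
    (0 <= 4 * N * b ^+ 2 - 2 \/ l' = 0).
  have [N'z|N'p] := eqVneq N' 0.
    exists 1, 0; rewrite expr0n /= mul0r addr0 expr1n; split=> //; right.
    by apply: sqnorm0; rewrite l'N N'z rmorph0.
  have {}N'p : 0 < N' by rewrite lt_neqAle eq_sym N'p.
  have [s s0 [h1 h2]] := rational_sqrt_approx N'p.
  have q0 : 0 < N' + s ^+ 2 by rewrite addr_gt0 ?exprn_gt0.
  have q1 : N' + s ^+ 2 != 0 by rewrite gt_eqF.
  (* Rational parametrization of the conic a^2 + N' b^2 = 1. The maximum of b is reached at the
     square root of N', which [s] approximates well enough. *)
  exists ((N' - s ^+ 2) / (N' + s ^+ 2)), (2 * s / (N' + s ^+ 2)); split.
    by field.
  left; rewrite subr_ge0 expr_div_n exprMn mulrA ler_pdivlMr ?exprn_gt0 //.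
  rewrite NE; move: (s ^+ 2) (sqr_ge0 s) h1 h2 => t t0 h1 h2.
  have p1 : 0 <= t * (N' - t) by rewrite mulr_ge0 ?subr_ge0.
  have p2 : 0 <= N' * (5 * t - N') by rewrite mulr_ge0 ?ltW //; lra.
  have p3 : 0 <= X * t by rewrite mulr_ge0.
  by nra.
exists [:: ratC a *: basis_vec + ratC b *: l'; ratC a *: basis_vec + ratC (- b) *: l';
  basis_vec; basis_vec]; split=> //.
  have eb : sqnorm basis_vec = 1.
    have := @sqnorm_basis_comb 1 0 l' l'0.
    by rewrite expr1n expr0n /= (rmorph1 ratC) (rmorph0 ratC) scale1r scale0r mul0r !addr0.
  move=> u; rewrite !inE => /or4P[] /eqP -> //; rewrite sqnorm_basis_comb // l'N.
    by rewrite -rmorphM -rmorphD /= ab rmorph1.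
  by rewrite sqrrN -rmorphM -rmorphD /= ab rmorph1.
(* The cross terms of a e + b l' and a e - b l' cancel in the sum, and those of l l^* are absorbed
   by the parallelogram identity l l^* + (l' - x e)(l' - x e)^* = 2 l' l'^* + 2 |x|^2 e e^*. *)
have -> : ratC (2 * N) *: (\sum_(u <- [:: ratC a *: basis_vec + ratC b *: l';
      ratC a *: basis_vec + ratC (- b) *: l'; basis_vec; basis_vec]) router u) -
    router l = ratC (4 * N * a ^+ 2 + 4 * N - 2 * X) *: router basis_vec +
      ratC (4 * N * b ^+ 2 - 2) *: router l' + router (l' - x *: basis_vec).
  have cE j : conjc (basis_vec j ord0) = basis_vec j ord0.
    by rewrite mxE -(rmorph_nat ratC) conjc_ratC.
  have lE : l = l' + x *: basis_vec by rewrite subrK.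
  have XE : ratC X = x * conjc x by rewrite mul_conjc_ratC.
  have xe j : conjc (x * basis_vec j ord0) = conjc x * basis_vec j ord0.
    by rewrite conjcM cE.
  rewrite [in router l]lE; apply/matrixP => i j.
  rewrite !big_cons big_nil; move: basis_vec cE xe l' {hb lE l'0 l'N} => e cE xe l'.
  have E1 (M q Y : rat) : ratC (4 * M * q ^+ 2 + 4 * M - 2 * Y) =
      4 * ratC M * ratC q ^+ 2 + 4 * ratC M - 2 * ratC Y.
    by rewrite rmorphB rmorphD !rmorphM /= !rmorph_nat; ring.
  have E2 (M q : rat) : ratC (4 * M * q ^+ 2 - 2) = 4 * ratC M * ratC q ^+ 2 - 2.
    by rewrite rmorphB !rmorphM /= !rmorph_nat; ring.
  have E3 (M : rat) : ratC (2 * M) = 2 * ratC M by rewrite rmorphM /= rmorph_nat.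
  rewrite !mxE !(conjcD, conjcN) !(ratCconjM, xe) !cE E1 E2 E3 XE.
  by rewrite [ratC (- b)]rmorphN /=; ring.
apply: rpsd_add; last exact: rpsd_router.
apply: rpsd_add.
  apply: rpsd_scale (rpsd_router _).
  by rewrite NE; have := mulr_ge0 (addr_ge0 N'0 X0) (sqr_ge0 a); nra.
case: hb => [c0|->]; first exact: rpsd_scale c0 (rpsd_router _).
have -> : router (0 : 'cV[rat[i]]_d) = 0.
  by apply/matrixP => i j; rewrite !mxE mul0r.
by rewrite scaler0; split; rewrite map_mx0; apply/psdP => y; rewrite qform0.
Qed.

End UnitCover.
End Embedding.

(** * Mixtures of elementary pure states *)

Section Mixtures.
Variable R : realType.
Local Notation rpsd := (rpsd R).

Definition ratnorm d (u : 'cV[rat[i]]_d) : rat := complex.Re (sqnorm u).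

Lemma sqnormE d (u : 'cV[rat[i]]_d) : sqnorm u = ratC (ratnorm u).
Proof. by rewrite /ratnorm; have [q _ ->] := sqnorm_ratC u. Qed.

Lemma ratnorm_ge0 d (u : 'cV[rat[i]]_d) : 0 <= ratnorm u.
Proof. by rewrite /ratnorm; have [q q0 ->] := sqnorm_ratC u. Qed.

(** Each term q l l^* is covered by four unit vectors with weight 2 q |l|^2. The weights are brought
    to a common denominator and replaced by multiplicities, so that the mixture becomes uniform. *)
Lemma mixture_of_terms d (i0 : 'I_d) (s : seq (rat * 'cV[rat[i]]_d)) :
  (forall p, p \in s -> 0 <= p.1) ->
  exists D (P : seq 'cV[rat[i]]_d), [/\ (0 < D)%N, forall u, u \in P -> sqnorm u = 1,
    (size P)%:R = 4 * D%:R * \sum_(p <- s) p.1 * ratnorm p.2 &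
    rpsd (ratC (2 / D%:R) *: \sum_(u <- P) router u -
          \sum_(p <- s) ratC p.1 *: router p.2)].
Proof.
elim: s => [|[q l] s IH] s0.
  exists 1%N, [::]; rewrite !big_nil mulr0 scaler0 subr0; split=> //.
  by split; rewrite map_mx0; apply/psdP => x; rewrite qform0.
have [|D [P [D0 uP sP rP]]] := IH; first by move=> p ps; apply: s0; rewrite inE ps orbT.
have q0 : 0 <= q := s0 _ (mem_head _ _).
have [F [sF uF rF]] := unit_cover R i0 (sqnormE l).
pose lam := q * ratnorm l; have lam0 : 0 <= lam by rewrite mulr_ge0 ?ratnorm_ge0.
pose a := `|numq lam|%N; pose b := `|denq lam|%N.
have b0 : (0 < b)%N by rewrite absz_gt0.
have bQ : (b%:R : rat) != 0 by rewrite pnatr_eq0 -lt0n.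
have DQ : (D%:R : rat) != 0 by rewrite pnatr_eq0 -lt0n.
have lamE : lam = a%:R / b%:R.
  rewrite -[LHS]divq_num_den; congr (_ / _).
    by rewrite /a pmulrn gez0_abs ?numq_ge0.
  by rewrite /b pmulrn gtz0_abs ?denq_gt0.
(* Passing from the denominator [D] to [D * b] repeats the old vectors [b] times; the new weight a /
   b gives [D * a] copies of the new ones. *)
exists (D * b)%N, (flatten (nseq b P) ++ flatten (nseq (D * a) F)).
have mem_rep (T : seq 'cV[rat[i]]_d) k u : u \in flatten (nseq k T) -> u \in T.
  by move=> /flattenP[t]; rewrite mem_nseq => /andP[_ /eqP->].
have sum_rep (T : seq 'cV[rat[i]]_d) k : \sum_(u <- flatten (nseq k T)) router u =
    (\sum_(u <- T) router u) *+ k by rewrite big_flatten sum_nseq.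
have size_rep (T : seq 'cV[rat[i]]_d) k : size (flatten (nseq k T)) = (k * size T)%N.
  by elim: k => //= k IHk; rewrite size_cat IHk mulSn.
split.
- by rewrite muln_gt0 D0.
- by move=> u; rewrite mem_cat => /orP[/mem_rep/uP|/mem_rep/uF].
- rewrite size_cat !size_rep sF !natrD !natrM sP big_cons /= -/lam lamE.
  by field.
rewrite big_cat /= !sum_rep big_cons /=.
set A := \sum_(u <- P) _ in rP *; set B := \sum_(u <- F) _ in rF *.
set S := \sum_(p <- s) _ in rP *.
have -> : ratC (2 / (D * b)%:R) *: (A *+ b + B *+ (D * a)) - (ratC q *: router l + S) =
    (ratC (2 / D%:R) *: A - S) + ratC q *: (ratC (2 * ratnorm l) *: B - router l).
  have E1 : ratC (2 / (D * b)%:R) *: (A *+ b) = ratC (2 / D%:R) *: A.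
    rewrite -scaler_nat scalerA -(rmorph_nat ratC) -rmorphM /=; congr (ratC _ *: _).
    by rewrite natrM; field; rewrite DQ bQ.
  have E2 : ratC (2 / (D * b)%:R) *: (B *+ (D * a)) =
      ratC q *: (ratC (2 * ratnorm l) *: B).
    rewrite -scaler_nat !scalerA -(rmorph_nat ratC) -!rmorphM /=; congr (ratC _ *: _).
    have -> : q * (2 * ratnorm l) = 2 * lam by rewrite /lam; ring.
    by rewrite lamE !natrM; field; rewrite DQ bQ.
  by rewrite scalerDr E1 E2 scalerBr [_ + S]addrC opprD addrACA.
exact: rpsd_add rP (rpsd_scale q0 rF).
Qed.

Lemma tr_router d (u : 'cV[rat[i]]_d) : \tr (router u) = ratC (ratnorm u).
Proof. by rewrite -sqnormE; apply: eq_bigr => j _; rewrite mxE. Qed.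

Lemma sqnorm_basis d (i0 : 'I_d) : sqnorm (basis_vec i0) = 1.
Proof.
rewrite /sqnorm (bigD1 i0) //= big1 ?addr0; first by rewrite mxE eqxx /=; simpc.
by move=> j /negbTE ji; rewrite mxE ji mul0r.
Qed.

(** For trace 1 there are 4D unit vectors with coefficient 2 / D, a factor 8 above the uniform
    mixture; padding to 2^L, at most 8D, vectors at most doubles it. The excess is written as a sum
    of outer products, so that the inequality is certified by rational equations, which a search can
    check. *)
Lemma mixture_data d (i0 : 'I_d) (nu : 'M[rat[i]]_d) : density (emb_mx R nu) ->
  exists L (P vs : seq 'cV[rat[i]]_d), [/\ size P = (2 ^ L)%N,
    forall u, u \in P -> sqnorm u = 1 &
    16%:R *: \sum_(u <- P) router u = (2 ^ L)%:R *: nu + \sum_(v <- vs) router v].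
Proof.
move=> [pnu tnu]; have {pnu}/rpsd_decomposition[s s0 nuE] : rpsd nu by [].
have tr1 : \sum_(p <- s) p.1 * ratnorm p.2 = 1.
  apply: (fmorph_inj ratC); rewrite rmorph1 rmorph_sum.
  transitivity (\tr nu).
    rewrite nuE raddf_sum; apply: eq_bigr => p _.
    by rewrite /= mxtraceZ tr_router rmorphM.
  apply: (@emb_c_inj R); rewrite rmorph1 -tnu /mxtrace rmorph_sum.
  by apply: eq_bigr => i _; rewrite /emb_mx mxE.
have [D [P [D0 uP sP rP]]] := mixture_of_terms i0 s0.
rewrite tr1 mulr1 -nuE in sP rP.
have {}sP : size P = (4 * D)%N.
  by apply/eqP; rewrite -(eqr_nat rat) sP natrM.
pose L := up_log 2 (4 * D).
have D1 : (1 < 4 * D)%N by lia.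
have /andP[L1 L2] := up_log_bounds (ltnSn 1) D1; rewrite -/L in L1 L2.
have {}L1 : (2 ^ L <= 8 * D)%N.
  case: L L1 L2 => [|L] L1 L2; first by rewrite expn0 in L2 *; lia.
  by rewrite expnS; move: L1; rewrite /=; lia.
pose T := nseq (2 ^ L - 4 * D) (basis_vec i0).
have uP' u : u \in P ++ T -> sqnorm u = 1.
  rewrite mem_cat => /orP[/uP //|]; rewrite mem_nseq => /andP[_ /eqP->].
  exact: sqnorm_basis.
have : rpsd (16%:R *: \sum_(u <- P ++ T) router u - (2 ^ L)%:R *: nu).
  have -> : 16%:R *: \sum_(u <- P ++ T) router u - (2 ^ L)%:R *: nu =
      ratC (2 ^ L)%:R *: (ratC (2 / D%:R) *: \sum_(u <- P) router u - nu) +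
      (ratC (16%:R - 2 * (2 ^ L)%:R / D%:R) *: \sum_(u <- P) router u +
       ratC 16%:R *: \sum_(u <- T) router u).
    rewrite big_cat /= scalerDr scalerBr scalerA -rmorphM /= !rmorph_nat.
    have -> : (2 ^ L)%:R * (2 / D%:R) = 2 * (2 ^ L)%:R / D%:R :> rat by ring.
    rewrite rmorphB /= rmorph_nat scalerBl.
    set a := 16 *: _; set b := 16 *: _; set c := _ *: nu; set k := ratC _ *: _.
    by move: a b c k => a b c k; apply/matrixP => i j; rewrite !mxE; ring.
  apply: rpsd_add; first by apply: rpsd_scale rP; rewrite ler0n.
  have r0 (V : seq 'cV[rat[i]]_d) : rpsd (\sum_(u <- V) router u).
    exact: (rpsd_sum V (fun u => rpsd_router R u)).
  refine (rpsd_add (rpsd_scale _ (r0 P)) (rpsd_scale _ (r0 T))); last exact: ler0n.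
  rewrite subr_ge0 ler_pdivrMr ?ltr0n // -!natrM ler_nat; lia.
move=> /rpsd_sum_outer[vs vsE]; exists L, (P ++ T), vs; split=> //.
  by rewrite size_cat size_nseq sP subnKC.
by rewrite -vsE addrC subrK.
Qed.


Section Stored.
Variables (n L : nat) (V : seq 'cV[rat[i]]_(2 ^ n)).

Let es : seq rat[i] := flatten (map (fun v => mx_entries v) V).
Definition store_vecs : nat := pairn L (nat_of_bits (flatten (map code_crat es))).

Lemma size_code_crat z : (0 < size (code_crat z))%N.
Proof. by rewrite /code_crat /code_rat; case: (numq _) => a; rewrite !size_cat. Qed.

Lemma stored_crats_store : stored_crats store_vecs = es.
Proof.
rewrite /stored_crats /store_vecs pairnK2 nat_of_bitsK.
have [||||j js [-> jmax]] := @read_all_prefix _ read_crat code_crat es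
  (flatten (map code_crat es)).
- by [].
- exact: size_code_crat.
- by move=> i _ x0; exact: parses_crat.
- exact: prefix_refl.
have := jmax _ (leqnn _); rewrite take_size prefix_refl => /(_ isT) h.
by rewrite take_oversize.
Qed.

Lemma stored_vec_store k (j : 'I_(2 ^ n)) :
  stored_vec n store_vecs k j = (nth 0 V k) j ord0.
Proof.
rewrite /stored_vec stored_crats_store /es.
elim: V k => [|v V' IH] k /=; first by rewrite !nth_nil mxE.
rewrite nth_cat size_mx_entries muln1; case: k => [|k] /=.
  rewrite mul0n add0n ltn_ord -(nth_mx_entries v j ord0).
  by rewrite muln1 addn0.
by rewrite mulSn -addnA ltnNge leq_addr /= addKn IH.
Qed.

Lemma leq_size_stored : (size V <= size (stored_crats store_vecs))%N.
Proof.
rewrite stored_crats_store /es; elim: V => //= v V' IH.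
rewrite size_cat size_mx_entries muln1 -add1n leq_add // expn_gt0 //.
Qed.

End Stored.

Lemma mixture_exists n (nu : 'M[rat[i]]_(2 ^ n)) : density (emb_mx R nu) ->
  exists m, mixture_test n (mx_entries nu) m.
Proof.
have i0 : 'I_(2 ^ n) := Ordinal (expn_gt0 2 n : (0 < 2 ^ n)%N).
move=> /(mixture_data i0)[L [P [vs [sP uP mixE]]]].
exists (store_vecs L (P ++ vs)); rewrite /mixture_test.
have -> : fstn (store_vecs L (P ++ vs)) = L by rewrite /store_vecs pairnK1.
apply/andP; split; apply/allP => i; rewrite mem_iota add0n => /andP[_ ilt].
  rewrite /sum_upto; apply/eqP; rewrite -(uP (nth 0 P i)) ?mem_nth ?sP //.
  by apply: eq_bigr => j _; rewrite stored_vec_store nth_cat sP ilt.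
apply/allP => j; rewrite mem_iota add0n => /andP[_ jlt].
have := congr1 (fun M : 'M[rat[i]]_(2 ^ n) => M (Ordinal ilt) (Ordinal jlt)) mixE.
rewrite !mxE !summxE /sum_upto.
have -> : Complex (2 ^ L)%:R 0 = (2 ^ L)%:R :> rat[i].
  by rewrite -(rmorph_nat ratC).
rewrite -(nth_mx_entries nu (Ordinal ilt) (Ordinal jlt)) /=.
have -> : \sum_(u <- P) router u (Ordinal ilt) (Ordinal jlt) =
    \sum_(k < 2 ^ L) stored_vec n (store_vecs L (P ++ vs)) k i *
      conjc (stored_vec n (store_vecs L (P ++ vs)) k j).
  rewrite (big_nth 0) big_mkord sP; apply: eq_bigr => k _; rewrite mxE.
  rewrite (stored_vec_store L (P ++ vs) k (Ordinal ilt)).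
  by rewrite (stored_vec_store L (P ++ vs) k (Ordinal jlt)) nth_cat sP ltn_ord.
move=> ->; apply/eqP; congr (_ + _).
(* [mixture_test] sums up to the number of stored entries instead of the number of vectors; the
   indices beyond the list give null vectors. *)
set K := size _; have KV : (size vs <= K)%N.
  by apply: leq_trans (leq_size_stored L _); rewrite size_cat leq_addl.
rewrite (big_nth 0) big_mkord.
rewrite (big_ord_widen K (fun k => router (nth 0 vs k) (Ordinal ilt) (Ordinal jlt))) //.
rewrite big_mkcond; apply: eq_bigr => k _.
rewrite (stored_vec_store L (P ++ vs) _ (Ordinal ilt)).
rewrite (stored_vec_store L (P ++ vs) _ (Ordinal jlt)).
rewrite nth_cat sP [(2 ^ L + k < _)%N]ltnNge leq_addr /= addKn.
case: ltnP => [_|kv]; first by rewrite mxE.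
by rewrite nth_default // mxE mul0r.
Qed.

Definition mixture_vec n m k : 'cV[rat[i]]_(2 ^ n) := \col_j stored_vec n m k j.

Lemma mixture_spec n (nu : 'M[rat[i]]_(2 ^ n)) m :
  mixture_test n (mx_entries nu) m ->
  (forall k, (k < 2 ^ fstn m)%N -> sqnorm (mixture_vec n m k) = 1) /\
  rpsd (16%:R *: \sum_(k < 2 ^ fstn m) router (mixture_vec n m k) -
        (2 ^ fstn m)%:R *: nu).
Proof.
move=> /andP[/allP h1 /allP h2]; split=> [k kL|].
  have /h1/eqP : k \in iota 0 (2 ^ fstn m) by rewrite mem_iota.
  by rewrite /sum_upto => <-; apply: eq_bigr => j _; rewrite mxE.
set K := size (stored_crats m) in h2.
suff -> : 16%:R *: \sum_(k < 2 ^ fstn m) router (mixture_vec n m k) -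
    (2 ^ fstn m)%:R *: nu =
    \sum_(k <- iota 0 K) router (mixture_vec n m (2 ^ fstn m + k)%N).
  exact: (rpsd_sum _ (fun u => rpsd_router R _)).
apply/matrixP => i j; rewrite !mxE !summxE.
have /h2/allP/(_ j) : val i \in iota 0 (2 ^ n) by rewrite mem_iota /= ltn_ord.
rewrite mem_iota /= ltn_ord => /(_ isT)/eqP; rewrite /sum_upto.
rewrite (nth_mx_entries nu).
have -> : Complex (2 ^ fstn m)%:R 0 = (2 ^ fstn m)%:R :> rat[i].
  by rewrite -(rmorph_nat ratC).
have -> : \sum_(k < 2 ^ fstn m) router (mixture_vec n m k) i j =
    \sum_(k < 2 ^ fstn m) stored_vec n m k i * conjc (stored_vec n m k j).
  by apply: eq_bigr => k _; rewrite !mxE.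
move=> ->; rewrite addrC addKr -(big_mkord xpredT (fun k =>
  stored_vec n m (2 ^ fstn m + k) i * conjc (stored_vec n m (2 ^ fstn m + k) j))).
rewrite /index_iota subn0; apply: eq_bigr => k _; rewrite !mxE //.
Qed.

End Mixtures.

Local Open Scope classical_set_scope.
Local Open Scope ring_scope.

(** * Unconditional sums over programs *)

Section Kraft.
Variable R : realType.
Local Notation weight p := (2 ^- size p : R).

Definition prefix_free (P : set bits) := forall p q, P p -> P q -> prefix p q -> p = q.

Lemma weight_gt0 (p : bits) : 0 < weight p.
Proof. by rewrite invr_gt0 exprn_gt0. Qed.

Lemma weight_cat (p q : bits) : weight (p ++ q) = weight p * weight q.
Proof. by rewrite size_cat exprD invfM. Qed.

(* Splitting the strings by their first bit halves the bound. *)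
Lemma kraft_seq (s : seq bits) : uniq s -> prefix_free [set p | p \in s] ->
  \sum_(p <- s) weight p <= 1.
Proof.
suff H n : forall s : seq bits, (forall p, p \in s -> (size p <= n)%N) -> uniq s ->
    prefix_free [set p | p \in s] -> \sum_(p <- s) weight p <= 1.
  apply: (H (\max_(p <- s) size p)) => p ps.
  by rewrite (big_rem p) //= leq_maxl.
elim: n => [|n IH] {}s sz us pf.
  case: s sz us pf => [|p [|q s]] sz us pf; rewrite ?big_nil //.
    by rewrite big_seq1 invf_le1 ?exprn_gt0 // exprn_ege1 // ler1n.
  exfalso; have /nilP ep : nilp p by rewrite /nilp -leqn0 sz // mem_head.
  have /nilP eq : nilp q by rewrite /nilp -leqn0 sz // !inE eqxx orbT.
  by move: us; rewrite ep eq.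
have [e|ne] := boolP ([::] \in s).
  have sE p : p \in s -> p = [::].
    by move=> ps; rewrite (pf [::] p e ps (prefix0s _)).
  case: s sz us pf e sE => [|p [|q s]] // sz us pf e sE.
    by rewrite big_seq1 (sE p (mem_head _ _)) expr0 invr1.
  exfalso; move: us; rewrite (sE p) ?mem_head // (sE q) ?inE ?eqxx ?orbT //.
pose tl (b : bool) := [seq behead p | p <- s & ohead p == Some b].
have tlP b p : (p \in tl b) = (b :: p \in s).
  apply/mapP/idP => [[q]|h]; last first.
    by exists (b :: p) => //; rewrite mem_filter /= eqxx.
  by rewrite mem_filter; case: q => [|c q] //= /andP[/eqP[->] qs] ->.
have bound b : \sum_(p <- tl b) weight p <= 1.
  apply: IH => [p|| p q].
  - by rewrite tlP => /sz.
  - rewrite map_inj_in_uniq ?filter_uniq // => p q; rewrite !mem_filter.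
    by case: p => [|c p] //= /andP[/eqP[->] _]; case: q => [|c' q] //= /andP[/eqP[->] _] ->.
  - rewrite /= !tlP => ps qs pq.
    have pq' : prefix (b :: p) (b :: q) by rewrite /= eqxx.
    by have [] := pf _ _ ps qs pq'.
have -> : \sum_(p <- s) weight p =
    2^-1 * \sum_(p <- tl false) weight p + 2^-1 * \sum_(p <- tl true) weight p.
  rewrite !mulr_sumr !big_map !big_filter.
  rewrite (bigID (fun p => ohead p == Some false)) /=; congr (_ + _).
    by apply: eq_bigr => -[|b p] // _; rewrite /= exprS invfM.
  rewrite -big_filter -[RHS]big_filter.
  have -> : [seq i <- s | ohead i != Some false] = [seq i <- s | ohead i == Some true].
    apply: eq_in_filter => -[|[] p] //; first by rewrite (negbTE ne).
  rewrite !big_filter; apply: eq_bigr => -[|b p] // _; by rewrite /= exprS invfM.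
have := bound false; have := bound true; lra.
Qed.

Lemma kraft (P : set bits) : prefix_free P -> (\esum_(p in P) (weight p)%:E <= 1)%E.
Proof.
move=> pf; apply: ge_ereal_sup => _ [X [finX XP] <-].
rewrite fsbig_finite // sumEFin lee_fin; apply: kraft_seq.
  exact: finmap.fset_uniq.
move=> p q /=; rewrite !in_fset_set // !inE => /XP Pp /XP Pq; exact: pf.
Qed.

Lemma kraft_computes (M : machine) (y : bits) (P : set bits) :
  (forall p, P p -> exists x, computes M y p x) ->
  (\esum_(p in P) (weight p)%:E <= 1)%E.
Proof.
move=> h; apply: kraft => p q /h[x cp] /h[x' cq] pq.
by have [] := computes_prefix_free cp cq pq.
Qed.

End Kraft.

(** * Linearity and comparison of unconditional sums *)

Section Esums.
Variable R : realType.
Local Open Scope ereal_scope.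

(** The form in which translations of programs are used: an injection matches the terms of the left
    sum, and the unmatched terms on the right are nonnegative. *)
Lemma le_esum_inj (T T' : choiceType) (P : set T) (Q : set T') (e : T -> T')
    (a : T -> \bar R) (b : T' -> \bar R) :
  (forall t t', P t -> P t' -> e t = e t' -> t = t') ->
  (forall t, P t -> Q (e t)) -> (forall t, P t -> a t <= b (e t)) ->
  (forall t, Q t -> 0 <= b t) ->
  \esum_(t in P) a t <= \esum_(t in Q) b t.
Proof.
move=> einj PQ ab b0; apply: (@le_trans _ _ (\esum_(t in P) b (e t))); first exact: le_esum.
have inj : set_inj P e by move=> t t' /[!inE] Pt Pt'; exact: einj.
rewrite -(esum_image P e b inj) (esumID (e @` P) Q) //.
have -> : Q `&` e @` P = e @` P.
  by rewrite setIidr // => _ [t Pt <-]; exact: PQ.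
by rewrite leeDl // esum_ge0 // => t [/b0].
Qed.

Let esumZ_le (T : choiceType) (P : set T) (c : R) (a : T -> \bar R) : (0 <= c)%R ->
  (forall t, 0 <= a t) ->
  \esum_(t in P) (c%:E * a t) <= c%:E * \esum_(t in P) a t.
Proof.
move=> c0 a0; apply: ge_ereal_sup => _ [X [finX XP] <-].
rewrite -ge0_mule_fsumr //; apply: lee_wpmul2l; first by rewrite lee_fin.
by apply: ereal_sup_ubound; exists X.
Qed.

Lemma esumZ (T : choiceType) (P : set T) (c : R) (a : T -> \bar R) : (0 <= c)%R ->
  (forall t, P t -> 0 <= a t) ->
  \esum_(t in P) (c%:E * a t) = c%:E * \esum_(t in P) a t.
Proof.
move=> c0 a0; pose b t := maxe (a t) 0.
have ab t : P t -> a t = b t by move=> /a0 h; rewrite /b max_l.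
have b0 t : 0 <= b t by rewrite /b le_max lexx orbT.
rewrite (eq_esum ab) (eq_esum (b := fun t => c%:E * b t)); last by move=> t /ab ->.
move: c0; rewrite le_eqVlt => /orP[/eqP<-|c0].
  by rewrite mul0e; apply: esum1 => t _; rewrite mul0e.
apply/eqP; rewrite eq_le; apply/andP; split.
  by apply: esumZ_le => //; exact: ltW.
(* The reverse inequality is [esumZ_le] for c^-1 and the scaled family. *)
have ci : (0 <= c^-1)%R by rewrite invr_ge0 ltW.
have cb0 t : 0 <= c%:E * b t by rewrite mule_ge0 // lee_fin ltW.
have := esumZ_le P ci cb0.
rewrite (eq_esum (b := b)); last first.
  by move=> t _; rewrite muleA -EFinM mulVf ?gt_eqF // mul1e.
move=> h; have := lee_wpmul2l _ h => /(_ c%:E).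
by rewrite muleA -EFinM mulfV ?gt_eqF // mul1e; apply; rewrite lee_fin; exact: ltW.
Qed.

Definition absum (T : choiceType) (D : set T) (f : T -> R) :=
  \esum_(t in D) `|f t|%:E < +oo.

Lemma absum_le (T : choiceType) (D : set T) (f g : T -> R) :
  (forall t, D t -> (`|f t| <= `|g t|)%R) -> absum D g -> absum D f.
Proof.
by move=> fg; apply: le_lt_trans; apply: le_esum => t Dt; rewrite lee_fin fg.
Qed.

Lemma absumD (T : choiceType) (D : set T) (f g : T -> R) :
  absum D f -> absum D g -> absum D (fun t => f t + g t)%R.
Proof.
move=> hf hg; apply: le_lt_trans (lte_add_pinfty hf hg).
rewrite -esumD; try by move=> t _; rewrite lee_fin.
by apply: le_esum => t _; rewrite -EFinD lee_fin ler_normD.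
Qed.

Lemma absumZ (T : choiceType) (D : set T) c (f : T -> R) :
  absum D f -> absum D (fun t => c * f t)%R.
Proof.
rewrite /absum => hf; rewrite (eq_esum (b := fun t => `|c|%:E * `|f t|%:E)).
  by rewrite esumZ // lte_mul_pinfty // lee_fin.
by move=> t _; rewrite normrM EFinM.
Qed.

Lemma absum0 (T : choiceType) (D : set T) : absum D (fun=> 0%R : R).
Proof. by rewrite /absum esum1 // => t _; rewrite normr0. Qed.

Lemma absum_sum (T : choiceType) (D : set T) (I : Type) (s : seq I) (f : I -> T -> R) :
  (forall i, absum D (f i)) -> absum D (fun t => \sum_(i <- s) f i t)%R.
Proof.
move=> h; elim: s => [|i s IH].
  by rewrite (_ : (fun t => _) = fun=> 0%R); [exact: absum0 | apply/funext => t; rewrite big_nil].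
rewrite (_ : (fun t => _) = fun t => (f i t + \sum_(j <- s) f j t)%R).
  exact: absumD.
by apply/funext => t; rewrite big_cons.
Qed.

Lemma ge0_esum_fin (T : choiceType) (D : set T) (f : T -> R) :
  (forall t, D t -> (0 <= f t)%R) -> absum D f ->
  \esum_(t in D) (f t)%:E \is a fin_num.
Proof.
move=> f0 hf; rewrite ge0_fin_numE; last by apply: esum_ge0 => t Dt; rewrite lee_fin f0.
by rewrite (eq_esum (b := fun t => `|f t|%:E)) // => t Dt; rewrite ger0_norm ?f0.
Qed.

(** Any splitting into nonnegative summable parts gives the same value as the positive and negative
    parts in [real_sum]. Additivity and homogeneity follow, since split parts can be added and
    scaled, unlike positive parts. *)
Lemma real_sum_split (T : choiceType) (D : set T) (f g h : T -> R) :
  (forall t, D t -> f t = g t - h t)%R ->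
  (forall t, D t -> (0 <= g t)%R) -> (forall t, D t -> (0 <= h t)%R) ->
  absum D g -> absum D h ->
  real_sum D f = (fine (\esum_(t in D) (g t)%:E) - fine (\esum_(t in D) (h t)%:E))%R.
Proof.
move=> fE g0 h0 sg sh; rewrite /real_sum.
set p := fun t => Num.max (f t) 0%R; set m := fun t => Num.max (- f t)%R 0%R.
have p0 t : D t -> (0 <= p t)%R by rewrite /p le_max lexx orbT.
have m0 t : D t -> (0 <= m t)%R by rewrite /m le_max lexx orbT.
have sf : absum D f.
  have := absumD sg (absumZ (-1) sh); apply: absum_le => t Dt.
  by rewrite fE // mulN1r.
have sp : absum D p.
  apply: absum_le sf => t Dt; rewrite /p ger0_norm ?p0 //.
  by rewrite ge_max ler_norm normr_ge0.
have sm : absum D m.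
  apply: absum_le sf => t Dt; rewrite /m ger0_norm ?m0 //.
  by rewrite ge_max -normrN ler_norm normr_ge0.
apply/eqP; rewrite subr_eq addrAC eq_sym subr_eq -!fineD ?ge0_esum_fin //.
rewrite -!esumD; try by move=> t Dt; rewrite lee_fin ?p0 ?m0 ?g0 ?h0.
apply/eqP; congr fine; apply: eq_esum => t Dt; rewrite -!EFinD; congr EFin.
rewrite /p /m fE //; case: (leP (g t - h t) 0)%R => c.
  by rewrite max_l; lra.
by rewrite max_r; lra.
Qed.

Lemma real_sum_ge0 (T : choiceType) (D : set T) (f : T -> R) :
  (forall t, D t -> (0 <= f t)%R) -> absum D f ->
  (real_sum D f)%:E = \esum_(t in D) (f t)%:E.
Proof.
move=> f0 sf; rewrite (@real_sum_split _ _ _ f (fun=> 0%R)) //; last exact: absum0.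
  by rewrite (esum1 (a := fun=> 0%:E)) // subr0 fineK // ge0_esum_fin.
by move=> t _; rewrite subr0.
Qed.

Let posp (f : R) := Num.max f 0%R.
Let posp_split (f : R) : f = (posp f - posp (- f))%R.
Proof.
by rewrite /posp; case: (leP f 0)%R => c; [rewrite max_l; lra | rewrite max_r; lra].
Qed.
Let posp_ge0 (f : R) : (0 <= posp f)%R. Proof. by rewrite le_max lexx orbT. Qed.
Let posp_norm (f : R) : (`|posp f| <= `|f|)%R.
Proof. by rewrite ger0_norm ?posp_ge0 // ge_max ler_norm normr_ge0. Qed.

Lemma real_sumD (T : choiceType) (D : set T) (f g : T -> R) : absum D f -> absum D g ->
  real_sum D (fun t => f t + g t)%R = (real_sum D f + real_sum D g)%R.
Proof.
move=> sf sg.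
have s1 (h : T -> R) : absum D h -> absum D (posp \o h).
  by apply: absum_le => t _; exact: posp_norm.
have s2 (h : T -> R) : absum D h -> absum D (fun t => posp (- h t)).
  by apply: absum_le => t _; rewrite -[leRHS]normrN; exact: posp_norm.
have A (u v : T -> R) : (forall t, (0 <= u t)%R) -> (forall t, (0 <= v t)%R) ->
    absum D u -> absum D v -> fine (\esum_(t in D) (u t + v t)%:E) =
    (fine (\esum_(t in D) (u t)%:E) + fine (\esum_(t in D) (v t)%:E))%R.
  move=> u0 v0 su sv; rewrite (eq_esum (fun t _ => EFinD (u t) (v t))).
  rewrite esumD; try by move=> t _; rewrite lee_fin.
  by rewrite fineD // ge0_esum_fin.
rewrite (@real_sum_split _ _ _ (fun t => posp (f t) + posp (g t))%R
  (fun t => posp (- f t) + posp (- g t))%R) //.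
- rewrite (@real_sum_split _ _ f (posp \o f) (fun t => posp (- f t))) //=; last 2 first.
  + exact: s1.
  + exact: s2.
  rewrite (@real_sum_split _ _ g (posp \o g) (fun t => posp (- g t))) //=; last 2 first.
  + exact: s1.
  + exact: s2.
  rewrite (A (fun t => posp (f t)) (fun t => posp (g t)) (fun=> posp_ge0 _)
    (fun=> posp_ge0 _) (s1 _ sf) (s1 _ sg)).
  rewrite (A (fun t => posp (- f t)) (fun t => posp (- g t)) (fun=> posp_ge0 _)
    (fun=> posp_ge0 _) (s2 _ sf) (s2 _ sg)).
  by ring.
- by move=> t _; rewrite {1}(posp_split (f t)) {1}(posp_split (g t)); ring.
- by move=> t _; rewrite addr_ge0 ?posp_ge0.
- by move=> t _; rewrite addr_ge0 ?posp_ge0.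
- by apply: absumD; exact: s1.
- by apply: absumD; exact: s2.
Qed.

Lemma real_sumZ (T : choiceType) (D : set T) c (f : T -> R) : absum D f ->
  real_sum D (fun t => c * f t)%R = (c * real_sum D f)%R.
Proof.
move=> sf.
have s1 : absum D (posp \o f) by apply: absum_le sf => t _; exact: posp_norm.
have s2 : absum D (fun t => posp (- f t)).
  by apply: absum_le sf => t _; rewrite -[leRHS]normrN; exact: posp_norm.
rewrite [in RHS](@real_sum_split _ _ f (posp \o f) (fun t => posp (- f t))) //=.
have Z (d : R) (h : T -> R) : (0 <= d)%R -> (forall t, (0 <= h t)%R) -> absum D h ->
    fine (\esum_(t in D) (d * h t)%:E) = (d * fine (\esum_(t in D) (h t)%:E))%R.
  move=> d0 h0 sh; have e0 t : D t -> 0 <= (h t)%:E by move=> _; rewrite lee_fin.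
  rewrite (eq_esum (fun t _ => EFinM d (h t))) (esumZ d0 e0).
  by rewrite fineM // ge0_esum_fin.
have [c0|c0] := leP 0%R c.
  rewrite (@real_sum_split _ _ _ (fun t => c * posp (f t))%R
    (fun t => c * posp (- f t))%R).
  - by rewrite (Z c (posp \o f) c0 (fun=> posp_ge0 _) s1)
      (Z c _ c0 (fun=> posp_ge0 _) s2); ring.
  - by move=> t _; rewrite {1}(posp_split (f t)); ring.
  - by move=> t _; rewrite mulr_ge0 ?posp_ge0.
  - by move=> t _; rewrite mulr_ge0 ?posp_ge0.
  - exact: (absumZ c s1).
  - exact: (absumZ c s2).
have c0' : (0 <= - c)%R by rewrite oppr_ge0 ltW.
rewrite (@real_sum_split _ _ _ (fun t => (- c) * posp (- f t))%R
  (fun t => (- c) * posp (f t))%R).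
- by rewrite (Z (- c)%R (posp \o f) c0' (fun=> posp_ge0 _) s1)
      (Z (- c)%R _ c0' (fun=> posp_ge0 _) s2); ring.
- by move=> t _; rewrite {1}(posp_split (f t)); ring.
- by move=> t _; rewrite mulr_ge0 ?posp_ge0.
- by move=> t _; rewrite mulr_ge0 ?posp_ge0.
- exact: (absumZ (- c)%R s2).
- exact: (absumZ (- c)%R s1).
Qed.

Lemma real_sum_sum (T : choiceType) (D : set T) (I : Type) (s : seq I) (f : I -> T -> R) :
  (forall i, absum D (f i)) ->
  real_sum D (fun t => \sum_(i <- s) f i t)%R = (\sum_(i <- s) real_sum D (f i))%R.
Proof.
move=> h; elim: s => [|i s IH].
  rewrite big_nil (_ : (fun t => _) = fun=> 0%R); last by apply/funext => t; rewrite big_nil.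
  by apply: EFin_inj; rewrite real_sum_ge0 ?esum1 //; exact: absum0.
rewrite big_cons -IH -real_sumD //; last exact: absum_sum.
by congr real_sum; apply/funext => t; rewrite big_cons.
Qed.

End Esums.

Import numFieldNormedType.Exports.
Local Open Scope sesquilinear_scope.

(** * Traces of weighted sums of matrices *)

Section WeightedMxSum.
Variables (R : realType) (T : choiceType) (D : set T) (d : nat).
Variables (w : T -> R) (G : T -> 'M[R[i]]_d).
Hypothesis w0 : forall t, D t -> 0 <= w t.
Hypothesis sw : absum D w.
Hypothesis G1 : forall t i j, D t ->
  `|complex.Re (G t i j)| <= 1 /\ `|complex.Im (G t i j)| <= 1.

Let M := mx_sum D (fun t => Complex (w t) 0 *: G t).

Lemma Re_mulC (z z' : R[i]) : complex.Re (z * z') =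
  complex.Re z * complex.Re z' - complex.Im z * complex.Im z'.
Proof. by case: z z' => ? ? [? ?]. Qed.

Lemma Re_sum (I : finType) (F : I -> R[i]) :
  complex.Re (\sum_i F i) = \sum_i complex.Re (F i).
Proof.
apply: (big_morph (@complex.Re R)); last by [].
by move=> [? ?] [? ?].
Qed.

Lemma Re_trace_mul (A S : 'M[R[i]]_d) : complex.Re (\tr (A *m S)) =
  \sum_i \sum_j (complex.Re (S j i) * complex.Re (A i j) +
                 - complex.Im (S j i) * complex.Im (A i j)).
Proof.
rewrite /mxtrace Re_sum; apply: eq_bigr => i _; rewrite mxE Re_sum.
by apply: eq_bigr => j _; rewrite Re_mulC; ring.
Qed.

Let Re_entry t i j : complex.Re ((Complex (w t) 0 *: G t) i j) = w t * complex.Re (G t i j).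
Proof. by rewrite mxE Re_mulC /=; ring. Qed.

Let Im_entry t i j : complex.Im ((Complex (w t) 0 *: G t) i j) = w t * complex.Im (G t i j).
Proof. by rewrite mxE; case: (G t i j) => a b; simpc. Qed.

Let sRe i j : absum D (fun t => w t * complex.Re (G t i j)).
Proof.
apply: absum_le sw => t Dt; rewrite normrM ler_piMr //.
by case: (G1 i j Dt).
Qed.

Let sIm i j : absum D (fun t => w t * complex.Im (G t i j)).
Proof.
apply: absum_le sw => t Dt; rewrite normrM ler_piMr //.
by case: (G1 i j Dt).
Qed.

Let trE S t : w t * complex.Re (\tr (G t *m S)) =
  \sum_i \sum_j (complex.Re (S j i) * (w t * complex.Re (G t i j)) +
                 - complex.Im (S j i) * (w t * complex.Im (G t i j))).
Proof.
rewrite Re_trace_mul mulr_sumr; apply: eq_bigr => i _; rewrite mulr_sumr.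
by apply: eq_bigr => j _; ring.
Qed.

Let s_entry S i j : absum D (fun t => complex.Re (S j i) * (w t * complex.Re (G t i j)) +
                 - complex.Im (S j i) * (w t * complex.Im (G t i j)) : R).
Proof. by apply: absumD; apply: absumZ. Qed.

Lemma absum_tr_mx_sum (S : 'M[R[i]]_d) :
  absum D (fun t => w t * complex.Re (\tr (G t *m S))).
Proof.
rewrite (_ : (fun t => _) = fun t => \sum_i \sum_j
  (complex.Re (S j i) * (w t * complex.Re (G t i j)) +
                 - complex.Im (S j i) * (w t * complex.Im (G t i j)))).
  by apply: absum_sum => i; apply: absum_sum => j; exact: s_entry.
by apply/funext => t; rewrite trE.
Qed.

(** The real part of a trace is a finite real combination of real and imaginary parts of entries,
    each of which is an absolutely convergent sum because the entries of [G] are bounded by 1. *)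
Lemma Re_tr_mx_sum (S : 'M[R[i]]_d) : complex.Re (\tr (M *m S)) =
  real_sum D (fun t => w t * complex.Re (\tr (G t *m S))).
Proof.
rewrite (_ : (fun t => w t * _) = fun t => \sum_i \sum_j
  (complex.Re (S j i) * (w t * complex.Re (G t i j)) +
                 - complex.Im (S j i) * (w t * complex.Im (G t i j)))); last first.
  by apply/funext => t; rewrite trE.
rewrite real_sum_sum; last by move=> i; apply: absum_sum => j; exact: s_entry.
rewrite Re_trace_mul; apply: eq_bigr => i _.
rewrite real_sum_sum; last by move=> j; exact: s_entry.
apply: eq_bigr => j _.
rewrite real_sumD; [|by apply: absumZ|by apply: absumZ].
rewrite !real_sumZ // mxE /=; congr (_ * _ + _ * _).
  by congr real_sum; apply/funext => t; rewrite Re_entry.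
by congr real_sum; apply/funext => t; rewrite Im_entry.
Qed.

Lemma Re_tr_mx_sum_ge0 (S : 'M[R[i]]_d) :
  (forall t, D t -> 0 <= complex.Re (\tr (G t *m S))) ->
  (complex.Re (\tr (M *m S)))%:E =
  \esum_(t in D) (w t * complex.Re (\tr (G t *m S)))%:E.
Proof.
move=> h; rewrite Re_tr_mx_sum real_sum_ge0 //; last exact: absum_tr_mx_sum.
by move=> t Dt; rewrite mulr_ge0 ?w0 ?h.
Qed.

Lemma psd_mx_sum : (forall t, D t -> psd (G t)) -> psd M.
Proof.
move=> pG; apply/psdP => x.
have trx (A : 'M[R[i]]_d) : qform A x = \tr (A *m outer (\col_i x i)).
  rewrite tr_mul_outer; apply: eq_bigr => i _; apply: eq_bigr => j _.
  by rewrite !mxE.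
have G0 t : D t -> 0 <= \tr (G t *m outer (\col_i x i)).
  by move=> Dt; rewrite -trx; move/psdP: (pG t Dt); apply.
rewrite trx lecE /=; apply/andP; split.
  (* An imaginary part is a real part after multiplication by - sqrt(-1), so the formula for real
     parts also shows that the imaginary part vanishes. *)
  have ImE (z : R[i]) : complex.Im z = complex.Re (z * Complex 0 (-1)).
    by case: z => a b; rewrite Re_mulC /=; ring.
  have z0 t : D t -> w t * complex.Re (\tr (G t *m (Complex 0 (-1) *: outer (\col_i x i)))) = 0.
    move=> Dt; rewrite -scalemxAr mxtraceZ [Complex _ _ * _]mulrC -ImE.
    by move: (G0 t Dt); rewrite lecE => /andP[/eqP -> _]; rewrite mulr0.
  rewrite ImE mulrC -mxtraceZ scalemxAr Re_tr_mx_sum; apply/eqP; apply: EFin_inj.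
  rewrite real_sum_ge0; last exact: absum_tr_mx_sum.
    by apply: esum1 => t Dt; rewrite z0.
  by move=> t Dt; rewrite z0.
rewrite -lee_fin Re_tr_mx_sum_ge0; last by move=> t /G0; rewrite lecE => /andP[].
by apply: esum_ge0 => t Dt; rewrite lee_fin mulr_ge0 ?w0 //; move: (G0 t Dt); rewrite lecE => /andP[].
Qed.

End WeightedMxSum.

(** * The universal semi-density matrix as a sum over programs *)

Section Programs.
Variables (R : realType) (U : machine).
Local Notation weight p := (2 ^- size p : R).

Definition producing (y x : bits) : set bits := [set p | computes U y p x].

Lemma univ_prob_le1 (x y : bits) : (univ_prob R U x y <= 1)%E.
Proof. by apply: (@kraft_computes R U y) => p cp; exists x. Qed.

Lemma univ_prob_ge0 (x y : bits) : (0 <= univ_prob R U x y)%E.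
Proof. by apply: esum_ge0 => p _; rewrite lee_fin ltW // weight_gt0. Qed.

Lemma univ_prob_fin (x y : bits) : univ_prob R U x y \is a fin_num.
Proof.
rewrite ge0_fin_numE; last exact: univ_prob_ge0.
by apply: le_lt_trans (univ_prob_le1 x y) _; rewrite ltey.
Qed.

Definition unit_vectors k : set 'cV[rat[i]]_(2 ^ k) :=
  [set phi | (emb_mx R phi) ^t* *m emb_mx R phi = 1%:M].

Lemma unit_vectorsP k (phi : 'cV[rat[i]]_(2 ^ k)) :
  unit_vectors phi <-> sqnorm phi = 1.
Proof.
have trE : ((emb_mx R phi) ^t* *m emb_mx R phi) ord0 ord0 = emb_c R (sqnorm phi).
  rewrite mxE rmorph_sum; apply: eq_bigr => j _; rewrite !mxE rmorphM /= emb_conjc.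
  by rewrite mulrC.
split=> h.
  have e : (emb_mx R phi) ^t* *m emb_mx R phi = 1%:M := h.
  by apply: (@emb_c_inj R); rewrite -trE e mxE eqxx (rmorph1 (emb_c R)).
suff : (emb_mx R phi) ^t* *m emb_mx R phi = 1%:M by [].
by apply/matrixP => i j; rewrite !ord1 trE h (rmorph1 (emb_c R)) mxE eqxx.
Qed.

Lemma unit_semi_density k (phi : 'cV[rat[i]]_(2 ^ k)) :
  unit_vectors phi -> semi_density (outer (emb_mx R phi)).
Proof.
move=> u; split; first exact: psd_outer.
have e : (emb_mx R phi) ^t* *m emb_mx R phi = 1%:M := u.
by rewrite /outer mxtrace_mulC e mxtrace1.
Qed.

Definition vector_programs k : set ('cV[rat[i]]_(2 ^ k) * bits) :=
  @unit_vectors k `*`` (fun phi => producing (bits_of_nat k) (code_mx phi)).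

(** A program determines its vector, so projecting to the program is injective and Kraft's
    inequality applies. *)
Lemma esum_vector_programs k :
  (\esum_(z in @vector_programs k) (weight z.2)%:E <= 1)%E.
Proof.
apply: (@le_trans _ _ (\esum_(p in [set p | exists x, computes U (bits_of_nat k) p x])
  (weight p)%:E)%E); last exact: (@kraft_computes R U (bits_of_nat k)).
apply: (le_esum_inj (e := snd)) => //=.
- move=> [phi p] [phi' p'] /= [_ h] [_ h'] e; rewrite -e in h' *.
  by have /code_mx_inj /= -> := computes_inj h h'.
- by move=> [phi p] [_ h]; exists (code_mx phi).
Qed.

Section MuPrograms.
Variable k : nat.
Let w (phi : 'cV[rat[i]]_(2 ^ k)) : R :=
  fine (univ_prob R U (code_mx phi) (bits_of_nat k)).

Let w0 phi : 0 <= w phi.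
Proof. exact/fine_ge0/univ_prob_ge0. Qed.

Let wE phi : (w phi)%:E = univ_prob R U (code_mx phi) (bits_of_nat k).
Proof. by rewrite fineK // univ_prob_fin. Qed.

Let sw : absum (@unit_vectors k) w.
Proof.
apply: (@le_lt_trans _ _ 1%E); last by rewrite ltey.
apply: le_trans (esum_vector_programs k).
rewrite -(esum_esum (a := fun _ p => (weight p)%:E)); last first.
  by move=> *; rewrite lee_fin ltW // weight_gt0.
by apply: le_esum => phi _; rewrite ger0_norm // wE.
Qed.

(** Unfolding each weight of a vector into its programs leaves one nonnegative sum, whose terms can
    be matched program by program. *)
Lemma mu_programs (S : 'M[R[i]]_(2 ^ k)) : psd S ->
  (complex.Re (\tr (univ_semi_density R U k *m S)))%:E =
  \esum_(z in @vector_programs k)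
    (weight z.2 * complex.Re (\tr (outer (emb_mx R z.1) *m S)))%:E.
Proof.
move=> pS.
have t0 phi : 0 <= complex.Re (\tr (outer (emb_mx R phi) *m S)).
  by have := tr_mul_ge0 (psd_outer (emb_mx R phi)) pS; rewrite lecE => /andP[].
rewrite (@Re_tr_mx_sum_ge0 _ _ _ _ w (fun phi => outer (emb_mx R phi))) //.
  rewrite -(esum_esum (a := fun phi p =>
    (weight p * complex.Re (\tr (outer (emb_mx R phi) *m S)))%:E)); last first.
    by move=> *; rewrite lee_fin mulr_ge0 // ltW // weight_gt0.
  apply: eq_esum => phi _; rewrite EFinM wE muleC -esumZ //.
  by apply: eq_esum => p _; rewrite -EFinM mulrC.
by move=> phi i j u; apply: psd_Re_bound; exact: unit_semi_density.
Qed.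

Lemma psd_mu : psd (univ_semi_density R U k).
Proof.
apply: (@psd_mx_sum _ _ _ _ w (fun phi => outer (emb_mx R phi))) => //.
  by move=> phi i j u; apply: psd_Re_bound; exact: unit_semi_density.
by move=> phi _; exact: psd_outer.
Qed.

End MuPrograms.

Lemma emits_comparable q w w' : emits U [::] q w -> emits U [::] q w' ->
  prefix w w' \/ prefix w' w.
Proof.
move=> [t h] [t' h'].
apply: (@prefix_comparable _ _ _ (written (run U [::] q (maxn t t')))).
  exact: prefix_trans h (written_mono _ _ _ (leq_maxl _ _)).
exact: prefix_trans h' (written_mono _ _ _ (leq_maxr _ _)).
Qed.

(** Both streams are made of prefixes of one output, and the code words delimit themselves, so they
    agree matrix by matrix. Hence a program lower computes at most one matrix, on which the
    injectivity of the map on triples rests. *)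
Lemma stream_unique d (A B : nat -> 'M[rat[i]]_d) q :
  (forall N, emits U [::] q (code_stream A N)) ->
  (forall N, emits U [::] q (code_stream B N)) -> A =1 B.
Proof.
move=> hA hB; have S (C : nat -> 'M[rat[i]]_d) N :
    code_stream C N.+1 = code_stream C N ++ code_mx (C N).
  by rewrite /code_stream -{1}addn1 iotaD map_cat flatten_cat /= cats0.
suff H N : code_stream A N = code_stream B N /\ forall i, (i < N)%N -> A i = B i.
  by move=> i; have [_] := H i.+1; apply.
elim: N => [|N [e IH]]; first by [].
have AB : A N = B N.
  have [_ [r er]] : True /\ exists r, code_mx (A N) ++ r = code_mx (B N) \/
      code_mx (B N) ++ r = code_mx (A N).
    split=> //; case: (emits_comparable (hA N.+1) (hB N.+1)) => /prefixP[r];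
      rewrite !S e -catA => /eqP; rewrite eqseq_cat // eqxx /= => /eqP h; exists r;
      [left | right]; by rewrite h.
  have P (X : 'M[rat[i]]_d) := (parses_mx (size_mx_entries X)).1.
  apply: code_mx_inj; case: er => er.
    have := P (A N) r; rewrite -code_mxE er; have := P (B N) [::].
    by rewrite -code_mxE cats0 => -> [ee _]; rewrite !code_mxE ee.
  have := P (B N) r; rewrite -code_mxE er; have := P (A N) [::].
  by rewrite -code_mxE cats0 => -> [ee _]; rewrite !code_mxE ee.
split=> [|i]; first by rewrite !S e AB.
by rewrite ltnS leq_eqVlt => /orP[/eqP->|/IH].
Qed.

Lemma lower_computes_inj d q (X Y : 'M[R[i]]_d) :
  lower_computes U q X -> lower_computes U q Y -> X = Y.
Proof.
move=> [A [hA _ _ cA]] [B [hB _ _ cB]].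
have AB := stream_unique hA hB; apply/matrixP => i j.
have [reA imA] := cA i j; have [reB imB] := cB i j.
have rE : (fun t => complex.Re (emb_mx R (A t) i j)) =
          (fun t => complex.Re (emb_mx R (B t) i j)) by apply/funext => t; rewrite AB.
have iE : (fun t => complex.Im (emb_mx R (A t) i j)) =
          (fun t => complex.Im (emb_mx R (B t) i j)) by apply/funext => t; rewrite AB.
rewrite rE in reA; rewrite iE in imA.
have h1 : complex.Re (X i j) = complex.Re (Y i j) by exact: (cvg_unique _ reA reB).
have h2 : complex.Im (X i j) = complex.Im (Y i j) by exact: (cvg_unique _ imA imB).
by case: (X i j) (Y i j) h1 h2 => [a b] [c e] /= -> ->.
Qed.

End Programs.

(** * Limits of matrices and lower computability of slices *)

Section Limits.
Variable R : realType.

Lemma cvg_sum_seq (I : Type) (s : seq I) (f : I -> nat -> R) (a : I -> R) :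
  (forall i, f i t @[t --> \oo] --> a i) ->
  \sum_(i <- s) f i t @[t --> \oo] --> \sum_(i <- s) a i.
Proof.
move=> h; elim: s => [|i s IH].
  rewrite big_nil (_ : (fun t => _) = fun=> 0 : R); first exact: cvg_cst.
  by apply/funext => t; rewrite big_nil.
rewrite big_cons (_ : (fun t => _) = fun t => f i t + \sum_(j <- s) f j t).
  exact: cvgD (h i) IH.
by apply/funext => t; rewrite big_cons.
Qed.

Lemma cvg_Re_trace d (A : nat -> 'M[R[i]]_d) (X S : 'M[R[i]]_d) : mx_cvg A X ->
  complex.Re (\tr (A t *m S)) @[t --> \oo] --> complex.Re (\tr (X *m S)).
Proof.
move=> h; rewrite Re_trace_mul.
rewrite (_ : (fun t => _) = fun t => \sum_i \sum_j
  (complex.Re (S j i) * complex.Re (A t i j) + - complex.Im (S j i) * complex.Im (A t i j))).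
  apply: cvg_sum_seq => i; apply: cvg_sum_seq => j; have [h1 h2] := h i j.
  by apply: cvgD; apply: cvgM => //; exact: cvg_cst.
by apply/funext => t; rewrite Re_trace_mul.
Qed.

Lemma Im_Re (z : R[i]) : complex.Im z = complex.Re (Complex 0 (-1) * z).
Proof. by case: z => a b; rewrite Re_mulC /=; ring. Qed.

Lemma cvg_Im_trace d (A : nat -> 'M[R[i]]_d) (X S : 'M[R[i]]_d) : mx_cvg A X ->
  complex.Im (\tr (A t *m S)) @[t --> \oo] --> complex.Im (\tr (X *m S)).
Proof.
move=> h; have E (B : 'M[R[i]]_d) :
    complex.Im (\tr (B *m S)) = complex.Re (\tr (B *m (Complex 0 (-1) *: S))).
  by rewrite Im_Re -mxtraceZ scalemxAr.
rewrite E (_ : (fun t => _) = fun t => complex.Re (\tr (A t *m (Complex 0 (-1) *: S)))).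
  exact: cvg_Re_trace.
by apply/funext => t; rewrite E.
Qed.

Lemma cvg_trace_ge0 d (A : nat -> 'M[R[i]]_d) (X S : 'M[R[i]]_d) : mx_cvg A X ->
  (forall t, 0 <= \tr (A t *m S)) -> 0 <= \tr (X *m S).
Proof.
move=> h p; have c1 := cvg_Re_trace (S := S) h; have c2 := cvg_Im_trace (S := S) h.
rewrite lecE; apply/andP; split.
  have e : (fun t => complex.Im (\tr (A t *m S))) = fun=> 0.
    by apply/funext => t; move: (p t); rewrite lecE => /andP[/eqP -> _].
  rewrite e in c2; apply/eqP; exact: (cvg_unique _ c2 (cvg_cst 0)).
rewrite -(cvg_lim _ c1) //; apply: limr_ge; first by apply/cvg_ex; eexists; exact: c1.
by apply: nearW => t; move: (p t); rewrite lecE => /andP[].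
Qed.

Lemma qform_trace d (A : 'M[R[i]]_d) x : qform A x = \tr (A *m outer (\col_i x i)).
Proof.
rewrite tr_mul_outer; apply: eq_bigr => i _; apply: eq_bigr => j _.
by rewrite !mxE.
Qed.

Lemma semi_density_limit d (A : nat -> 'M[R[i]]_d) (X : 'M[R[i]]_d) : mx_cvg A X ->
  (forall t, semi_density (A t)) -> semi_density X.
Proof.
move=> h p; split.
  apply/psdP => x; rewrite qform_trace; apply: (cvg_trace_ge0 h) => t.
  by rewrite -qform_trace; case: (p t) => /psdP pt _; exact: pt.
have c1 := cvg_Re_trace (S := 1%:M) h; have c2 := cvg_Im_trace (S := 1%:M) h.
rewrite lecE -[\tr X]/(\tr X); have E t : \tr (A t *m 1%:M) = \tr (A t) by rewrite mulmx1.
rewrite -[X]mulmx1; apply/andP; split.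
  have e : (fun t => complex.Im (\tr (A t *m 1%:M))) = fun=> 0.
    apply/funext => t; rewrite E; case: (p t) => _.
    by rewrite lecE => /andP[/eqP <- _].
  rewrite e in c2; apply/eqP; exact: esym (cvg_unique _ c2 (cvg_cst 0)).
rewrite -(cvg_lim _ c1) //; apply: limr_le; first by apply/cvg_ex; eexists; exact: c1.
by apply: nearW => t; rewrite E; case: (p t) => _; rewrite lecE => /andP[].
Qed.

Lemma lower_computes_semi_density (U : machine) q d (X : 'M[R[i]]_d) :
  lower_computes U q X -> semi_density X.
Proof. by move=> [A [_ sA _ cA]]; apply: (semi_density_limit cA). Qed.

Lemma trace_delta d (A : 'M[R[i]]_d) i j : \tr (A *m delta_mx j i) = A i j.
Proof.
rewrite /mxtrace (bigD1 i) //= [X in _ + X]big1 => [|k ki]; rewrite ?addr0 !mxE.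
  rewrite (bigD1 j) //= [X in _ + X]big1 => [|l lj]; rewrite ?addr0 !mxE ?eqxx ?mulr1 //.
  by rewrite (negbTE lj) mulr0.
by apply: big1 => l _; rewrite mxE (negbTE ki) andbF mulr0.
Qed.

Definition half_powR (e : nat) : R[i] := Complex (2 ^- e) 0.

Lemma emb_half_pow e : emb_c R (half_pow e) = half_powR e.
Proof.
rewrite /emb_c /half_pow /half_powR /= rmorph0 fmorphV rmorph_nat.
by rewrite natrX.
Qed.

Lemma half_powR_gt0 e : 0 <= half_powR e.
Proof. by rewrite lecE /= eqxx /= invr_ge0 exprn_ge0. Qed.

Lemma half_powR_le1 e : half_powR e <= 1.
Proof. by rewrite lecE /= eqxx /= invf_le1 ?exprn_gt0 // exprn_ege1 // ler1n. Qed.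

Lemma emb_slice n e (nu xi : 'M[rat[i]]_(2 ^ n)) A :
  emb_mx R (half_pow e *: slice nu xi A) =
  half_powR e *: slice (emb_mx R nu) (emb_mx R xi) (emb_mx R A).
Proof.
apply/matrixP => K L; rewrite !mxE -/(emb_c R _) rmorphM /= emb_half_pow; congr (_ * _).
rewrite rmorph_sum; apply: eq_bigr => b _; rewrite rmorph_sum; apply: eq_bigr => b' _.
rewrite rmorph_sum; apply: eq_bigr => c _; rewrite rmorph_sum; apply: eq_bigr => c' _.
by rewrite !rmorphM /= !mxE.
Qed.

Lemma lower_computes_slice (U : machine) s (hs : forall n e (nu xi : 'M[rat[i]]_(2 ^ n)) q A,
    (forall N, emits U [::] q (code_stream A N)) ->
    forall N, emits U [::] (s ++ code_nat (slice_task n e (code_mx nu) (code_mx xi)) ++ q)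
      (code_stream (fun i => half_pow e *: slice nu xi (A i)) N))
    n e (nu xi : 'M[rat[i]]_(2 ^ n)) q X :
  density (emb_mx R nu) -> density (emb_mx R xi) -> lower_computes U q X ->
  lower_computes U (s ++ code_nat (slice_task n e (code_mx nu) (code_mx xi)) ++ q)
    (half_powR e *: slice (emb_mx R nu) (emb_mx R xi) X).
Proof.
move=> dn dx [A [hA sA iA cA]]; have [pn _] := dn; have [px _] := dx.
exists (fun i => half_pow e *: slice nu xi (A i)); split.
- exact: hs.
- move=> i; have [pA tA] := sA i; rewrite emb_slice; split.
    exact: psd_scale (half_powR_gt0 e) (psd_slice pn px pA).
  rewrite mxtraceZ; have := tr_slice_le dn dx pA.
  have t0 : 0 <= \tr (slice (emb_mx R nu) (emb_mx R xi) (emb_mx R (A i))).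
    by have := tr_mul_ge0 (psd_slice pn px pA) (@psd_id R _); rewrite mulmx1.
  move=> le; apply: le_trans (le_trans le tA).
  by rewrite ler_piMl // half_powR_le1.
- move=> i; rewrite !emb_slice -scalerBr -sliceB.
  exact: psd_scale (half_powR_gt0 e) (psd_slice pn px (iA i)).
(* By adjointness each entry of the slice is the trace of the original matrix against a fixed
   matrix, so it converges with such traces. *)
have E (Y : 'M[R[i]]_(2 ^ (n + n + (n + n)))) K L :
    (half_powR e *: slice (emb_mx R nu) (emb_mx R xi) Y) K L =
    \tr (Y *m (half_powR e *: spread (emb_mx R nu) (emb_mx R xi) (delta_mx L K))).
  by rewrite mxE -trace_delta tr_slice -mxtraceZ scalemxAr.
move=> K L; split; rewrite E.
  rewrite (_ : (fun t => _) = fun t => complex.Re (\tr (emb_mx R (A t) *m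
    (half_powR e *: spread (emb_mx R nu) (emb_mx R xi) (delta_mx L K))))).
    exact: cvg_Re_trace.
  by apply/funext => t; rewrite emb_slice E.
rewrite (_ : (fun t => _) = fun t => complex.Im (\tr (emb_mx R (A t) *m
  (half_powR e *: spread (emb_mx R nu) (emb_mx R xi) (delta_mx L K))))).
  exact: cvg_Im_trace.
by apply/funext => t; rewrite emb_slice E.
Qed.

End Limits.

(** * Domination and comparison of the universal tests *)

Section Domination.
Variables (R : realType) (U : machine).
Local Notation weight p := (2 ^- size p : R).

Lemma ler_Re (z z' : R[i]) : z <= z' -> complex.Re z <= complex.Re z'.
Proof. by rewrite lecE => /andP[]. Qed.

Lemma Re_tr_mul_ge0 d (A B : 'M[R[i]]_d) : psd A -> psd B ->
  0 <= complex.Re (\tr (A *m B)).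
Proof. by move=> pA pB; exact (ler_Re (tr_mul_ge0 pA pB)). Qed.

Lemma esum_ord N (f : 'I_N -> \bar R) : (forall i, 0 <= f i)%E ->
  (\esum_(i in [set: 'I_N]) f i = \sum_i f i)%E.
Proof.
move=> f0; have fin : finite_set [set: 'I_N] by exact: finite_finset.
rewrite esum_fset // fsbig_finite //; apply: perm_big.
apply: uniq_perm; [exact: finmap.fset_uniq | exact: index_enum_uniq | move=> i].
by rewrite mem_index_enum in_fset_set // mem_set.
Qed.

Lemma tr_part_slice n (nu : 'M[R[i]]_(2 ^ n)) (E : 'M[R[i]]_(2 ^ (n + n))) A :
  \tr (part_slice nu E *m A) = \tr (E *m qtens A nu).
Proof.
rewrite /mxtrace sum_qjoin; apply: eq_bigr => k _; rewrite mxE.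
transitivity (\sum_l \sum_b \sum_b' (E (qjoin k b) (qjoin l b') * nu b' b) * A l k).
  apply: eq_bigr => l _; rewrite mxE mulr_suml; apply: eq_bigr => b _.
  by rewrite mulr_suml.
rewrite exchange_big /=; apply: eq_bigr => b _; rewrite mxE sum_qjoin.
apply: eq_bigr => l _; apply: eq_bigr => b' _.
by rewrite qtensE !(qhiK, qloK); ring.
Qed.

Lemma psd_part_slice n (nu : 'M[R[i]]_(2 ^ n)) (E : 'M[R[i]]_(2 ^ (n + n))) :
  psd nu -> psd E -> psd (part_slice nu E).
Proof.
move=> pn pE; apply/psdP => x; rewrite qform_trace tr_part_slice.
exact (tr_mul_ge0 pE (psd_qtens (psd_outer _) pn)).
Qed.

Lemma outer_vec_tens n (phi psi : 'cV[rat[i]]_(2 ^ n)) :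
  outer (emb_mx R (vec_tens phi psi)) =
  qtens (outer (emb_mx R phi)) (outer (emb_mx R psi)).
Proof.
apply/matrixP => i j; rewrite qtensE !outerE !mxE.
rewrite -!/(emb_c R _) rmorphM /= rmorphM /=; ring.
Qed.

Lemma unit_vec_tens n (phi psi : 'cV[rat[i]]_(2 ^ n)) :
  unit_vectors R phi -> unit_vectors R psi -> unit_vectors R (vec_tens phi psi).
Proof.
rewrite !unit_vectorsP => h1 h2; rewrite -[RHS]mulr1 -{1}h1 -h2 /sqnorm.
rewrite sum_qjoin mulr_suml; apply: eq_bigr => a _; rewrite mulr_sumr.
by apply: eq_bigr => b _; rewrite !mxE !qhiK !qloK conjcM; ring.
Qed.

Lemma qtensBr k l (A : 'M[R[i]]_(2 ^ k)) (B C : 'M[R[i]]_(2 ^ l)) :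
  qtens A (B - C) = qtens A B - qtens A C.
Proof. by apply/matrixP => i j; rewrite qtensE !mxE !qtensE; ring. Qed.

Lemma qtensBl k l (A B : 'M[R[i]]_(2 ^ k)) (C : 'M[R[i]]_(2 ^ l)) :
  qtens (A - B) C = qtens A C - qtens B C.
Proof. by apply/matrixP => i j; rewrite qtensE !mxE !qtensE; ring. Qed.

Lemma qtensZr k l (A : 'M[R[i]]_(2 ^ k)) a (B : 'M[R[i]]_(2 ^ l)) :
  qtens A (a *: B) = a *: qtens A B.
Proof. by apply/matrixP => i j; rewrite qtensE !mxE !qtensE; ring. Qed.

Lemma qtensZl k l (A : 'M[R[i]]_(2 ^ k)) a (B : 'M[R[i]]_(2 ^ l)) :
  qtens (a *: A) B = a *: qtens A B.
Proof. by apply/matrixP => i j; rewrite qtensE !mxE !qtensE; ring. Qed.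

Lemma qtens_sumr k l (I : finType) (A : 'M[R[i]]_(2 ^ k)) (F : I -> 'M[R[i]]_(2 ^ l)) :
  qtens A (\sum_i F i) = \sum_i qtens A (F i).
Proof.
apply/matrixP => i j; rewrite qtensE !summxE mulr_sumr.
by apply: eq_bigr => t _; rewrite qtensE.
Qed.

Lemma Re_natM m (z : R[i]) : complex.Re (m%:R * z) = m%:R * complex.Re z.
Proof. by rewrite !mulr_natl raddfMn. Qed.

(** Pairs [S] with the positive tensor product of phi phi^* and 16 sum_k phi_k phi_k^* - 2^L nu,
    then divides by 2^L. *)
Lemma mixture_domination n (nu : 'M[rat[i]]_(2 ^ n)) m (phi : 'cV[rat[i]]_(2 ^ n))
    (S : 'M[R[i]]_(2 ^ (n + n))) :
  mixture_test n (mx_entries nu) m -> psd S ->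
  complex.Re (\tr (outer (emb_mx R phi) *m part_slice (emb_mx R nu) S)) <=
  \sum_(k < 2 ^ fstn m) 16%:R / 2 ^+ fstn m *
     complex.Re (\tr (outer (emb_mx R (vec_tens phi (mixture_vec n m k))) *m S)).
Proof.
set L := fstn m; move=> /(mixture_spec R)[_ [h]] pS; move: h; rewrite -/L.
rewrite mxtrace_mulC tr_part_slice map_mxD map_mxN !map_mxZ map_mx_sum.
rewrite !(rmorph_nat (emb_c R)) => h.
have := tr_mul_ge0 pS (psd_qtens (psd_outer (emb_mx R phi)) h).
rewrite qtensBr !qtensZr qtens_sumr mulmxBr -!scalemxAr mulmx_sumr raddfB /=.
rewrite !mxtraceZ subr_ge0 => /ler_Re; rewrite !Re_natM => le.
have L0 : 0 < (2 ^ L)%:R :> R by rewrite ltr0n expn_gt0.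
rewrite -mulr_sumr mulrAC ler_pdivlMr -?natrX //.
rewrite mulrC; apply: (le_trans le); rewrite [\tr (\sum_(_ < _) _)]raddf_sum Re_sum.
rewrite ler_wpM2l ?ler0n // le_eqVlt; apply/orP; left; apply/eqP.
apply: eq_bigr => k _; rewrite [\tr (_ *m S)]mxtrace_mulC outer_vec_tens.
by rewrite emb_router.
Qed.

(* Every program of a vector phi is turned into 2^L programs of the products
   of phi with the vectors of a mixture dominating nu, each longer by L plus a
   constant plus the size of the program of nu. *)
Lemma mu_tens_le_tr (hU : universal U) : exists s3 : bits,
  forall n (nu : 'M[rat[i]]_(2 ^ n)) p1 (S : 'M[R[i]]_(2 ^ (n + n))),
  density (emb_mx R nu) -> computes U (bits_of_nat n) p1 (code_mx nu) -> psd S ->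
  complex.Re (\tr (S *m qtens (univ_semi_density R U n) (emb_mx R nu))) <=
  2 ^+ (4 + (size s3 + size p1)) *
    complex.Re (\tr (S *m univ_semi_density R U (n + n))).
Proof.
have [s3 hs] := mixture_program hU; exists s3 => n nu p1 S.
move=> dn hp1 pS; have [pn _] := dn.
(* The search inside [mixture_program] stops at the least code that passes the test. *)
have [m tm mmin] : exists2 m, mixture_test n (mx_entries nu) m &
    forall m', (m' < m)%N -> ~~ mixture_test n (mx_entries nu) m'.
  have ex := mixture_exists dn; exists (ex_minn ex); first by case: ex_minnP.
  by case: ex_minnP => m _ h m' lt; apply: contraL lt => /h; rewrite -leqNgt.
have [units _] := mixture_spec R tm; set L := fstn m in units.
rewrite -tr_part_slice mxtrace_mulC [\tr (S *m _)]mxtrace_mulC.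
have pP := psd_part_slice pn pS.
rewrite -lee_fin EFinM (mu_programs U pP) (mu_programs U pS) -esumZ; first last.
- move=> z _; rewrite lee_fin mulr_ge0 ?(ltW (weight_gt0 _ _)) //.
  exact (Re_tr_mul_ge0 (psd_outer _) pS).
- by rewrite exprn_ge0.
pose f (phi : 'cV[rat[i]]_(2 ^ n)) k : R := complex.Re
   (\tr (outer (emb_mx R (vec_tens phi (mixture_vec n m k))) *m S)).
have f0 phi k : 0 <= f phi k by exact (Re_tr_mul_ge0 (psd_outer _) pS).
apply: (@le_trans _ _ (\esum_(z in @vector_programs R U n) \esum_(k in [set: 'I_(2 ^ L)])
    (weight z.2 * (16%:R / 2 ^+ L * f z.1 k))%:E)%E).
  apply: le_esum => -[phi p] _; rewrite esum_ord /=; last first.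
    by move=> k; rewrite lee_fin !mulr_ge0 ?(ltW (weight_gt0 _ _)) ?invr_ge0 ?exprn_ge0.
  rewrite sumEFin lee_fin -mulr_sumr ler_wpM2l ?(ltW (weight_gt0 _ _)) //.
  exact: mixture_domination.
rewrite (esum_esum (a := fun z (k : 'I_(2 ^ L)) => (weight z.2 * (16%:R / 2 ^+ L * f z.1 k))%:E)); last first.
  by move=> z k _ _; rewrite lee_fin !mulr_ge0 ?(ltW (weight_gt0 _ _)) ?invr_ge0 ?exprn_ge0.
apply: (le_esum_inj (e := fun t : ('cV[rat[i]]_(2 ^ n) * bits) * 'I_(2 ^ L) =>
  (vec_tens t.1.1 (mixture_vec n m t.2), s3 ++ p1 ++ t.1.2 ++ digits L t.2))).
- move=> [[phi p] k] [[phi' p'] k'] [/= [/= _ h] _] [/= [/= _ h'] _] [_] e.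
  (* The outer parts [s3] and [p1] are fixed and the digits have fixed length [L], so the string can
     be cut again into [p] and [k]. *)
  have {}e : p ++ digits L k = p' ++ digits L k'.
    move/(congr1 (drop (size s3))): e; rewrite !drop_size_cat //.
    by move/(congr1 (drop (size p1))); rewrite !drop_size_cat.
  have sp : size p = size p'.
    by move/(congr1 size): e; rewrite !size_cat !size_digits => /addIn.
  have ep : p = p'.
    by move/(congr1 (take (size p))): e; rewrite take_size_cat // sp take_size_cat.
  have -> : k = k'.
    apply: val_inj; rewrite /= -(digitsK (ltn_ord k)) -(digitsK (ltn_ord k')).
    by congr binval; move/(congr1 (drop (size p))): e; rewrite drop_size_cat // sp drop_size_cat.
  rewrite -ep in h' *.
  by have /code_mx_inj /= -> := computes_inj h h'.
- move=> [[phi p] k] [[/= u h] _]; split.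
    by apply: unit_vec_tens => //; apply/unit_vectorsP; exact: units.
  exact (hs n nu p1 p phi m k hp1 h tm mmin (ltn_ord k)).
(* Both sides are equal: 2^4 is the factor 16, the weight of the digits is 2^-L, and the remaining
   power of 2 offsets the weights of [s3] and [p1]. *)
- move=> [[phi p] k] _ /=; rewrite -EFinM lee_fin !weight_cat size_digits /f.
  rewrite !exprD; set x := complex.Re _.
  rewrite le_eqVlt; apply/orP; left; apply/eqP.
  have d0 (i : nat) : 2 ^+ i != 0 :> R by rewrite expf_neq0 ?pnatr_eq0.
  by field; rewrite !d0.
- move=> z _; rewrite -EFinM lee_fin mulr_ge0 ?exprn_ge0 // mulr_ge0 ?(ltW (weight_gt0 _ _)) //.
  exact (Re_tr_mul_ge0 (psd_outer _) pS).
Qed.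

(** The trace inequality for all S = x x^* is the operator inequality; the traces involved are
    nonnegative, so their real parts suffice. *)
Lemma mu_tens_le (hU : universal U) : exists s3 : bits,
  forall n (nu : 'M[rat[i]]_(2 ^ n)) p1,
  density (emb_mx R nu) -> computes U (bits_of_nat n) p1 (code_mx nu) ->
  psd (Complex (2 ^+ (4 + (size s3 + size p1))) 0 *: univ_semi_density R U (n + n) -
       qtens (univ_semi_density R U n) (emb_mx R nu)).
Proof.
have [s3 h] := mu_tens_le_tr hU; exists s3 => n nu p1 dn hp1.
apply/psdP => x; set S := outer (\col_i x i); rewrite qform_trace -/S mxtrace_mulC.
have pS : psd S by exact (psd_outer _).
have := h n nu p1 S dn hp1 pS; set a := 2 ^+ _ => le.
have t1 := tr_mul_ge0 pS (@psd_mu R U (n + n)).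
have t2 := tr_mul_ge0 pS (psd_qtens (@psd_mu R U n) dn.1).
rewrite mulmxBr -scalemxAr raddfB /= mxtraceZ subr_ge0.
move: le t1 t2; case: (\tr _) => u u'; case: (\tr _) => v v'.
rewrite !lecE /= => le /andP[/eqP -> _] /andP[/eqP -> _]; rewrite !mulr0 mul0r.
by rewrite addr0 subr0 eqxx.
Qed.

End Domination.

(** * The universal test as a sum over programs *)

Section TestPrograms.
Variables (R : realType) (U : machine) (k : nat) (C D : 'M[R[i]]_(2 ^ k)).
Local Notation weight p := (2 ^- size p : R).
Local Notation test := 'M[R[i]]_(2 ^ (k + k)).

Definition test_codes : set (test * bits) :=
  product_tests U C D `*`` (fun X => [set q | lower_computes U q X]).

Definition test_programs : set (test * bits * bits) :=
  test_codes `*`` (fun z => producing U (bits_of_nat k) z.2).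

Let weight_ge0 (p : bits) : 0 <= weight p. Proof. exact/ltW/weight_gt0. Qed.

(** The last component of a triple determines the other two, so the weights are those of distinct
    halting programs. *)
Lemma esum_test_programs : (\esum_(z in test_programs) (weight z.2)%:E <= 1)%E.
Proof.
apply: (@le_trans _ _ (\esum_(p in [set p | exists x, computes U (bits_of_nat k) p x])
  (weight p)%:E)%E); last exact: (@kraft_computes R U (bits_of_nat k)).
apply: (le_esum_inj (e := snd)) => //=.
- move=> [[X q] p] [[X' q'] p'] /= [[_ l] h] [[_ l'] h'] e; rewrite -e in h' *.
  have eq : q = q' := computes_inj h h'; rewrite -eq in l' *.
  by have /= -> := lower_computes_inj l l'.
- by move=> [[X q] p] [_ h]; exists q.
Qed.

Let W (X : test) := lower_univ_prob U X (bits_of_nat k).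
Let w (X : test) : R := fine (W X).

Let W0 X : (0 <= W X)%E.
Proof. by apply: esum_ge0 => q _; exact: univ_prob_ge0. Qed.

Let w0 X : 0 <= w X. Proof. exact/fine_ge0/W0. Qed.

Let WE (f : test -> R) : (forall X, product_tests U C D X -> 0 <= f X) ->
  \esum_(X in product_tests U C D) ((f X)%:E * W X)%E =
  \esum_(z in test_programs) (weight z.2 * f z.1.1)%:E.
Proof.
move=> f0; rewrite -(esum_esum (a := fun z p => (weight p * f z.1)%:E)); last first.
  by move=> [X q] p [TX _] _; rewrite lee_fin mulr_ge0 // f0.
rewrite -(esum_esum (a := fun X q =>
  \esum_(p in producing U (bits_of_nat k) q) (weight p * f X)%:E)); last first.
  move=> X q TX _; apply: esum_ge0 => p _; rewrite lee_fin mulr_ge0 //; exact: f0.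
apply: eq_esum => X TX; rewrite -esumZ; [|exact: f0|by move=> *; exact: univ_prob_ge0].
apply: eq_esum => q _; rewrite -esumZ; [|exact: f0|by move=> *; rewrite lee_fin].
by apply: eq_esum => p _; rewrite -EFinM mulrC.
Qed.

(** The rearrangement for the constant 1. It shows that all weights of tests are finite, so that
    [fine] in the definition of the universal test loses nothing. *)
Let W1 : (\esum_(X in product_tests U C D) W X <= 1)%E.
Proof.
apply: le_trans esum_test_programs.
have /esym := @WE (fun=> 1) (fun _ _ => ler01); under eq_esum do rewrite mulr1.
by move=> ->; apply: le_esum => X _; rewrite mul1e.
Qed.

Let W_fin X : product_tests U C D X -> W X \is a fin_num.
Proof.
move=> TX; rewrite ge0_fin_numE //; apply: (le_lt_trans _ (ltey 1)).
apply: le_trans W1; rewrite (esumID [set X]) // setIC.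
rewrite [X in (_ <= X + _)%E](_ : _ = W X); last first.
  rewrite (_ : _ `&` _ = [set X]) ?esum_set1 //.
  by apply/seteqP; split=> [Y []|Y ->].
by rewrite leeDl // esum_ge0.
Qed.

Let wE X : product_tests U C D X -> (w X)%:E = W X.
Proof. by move=> TX; rewrite fineK // W_fin. Qed.

Let sw : absum (product_tests U C D) w.
Proof.
apply: (@le_lt_trans _ _ 1%E); last by rewrite ltey.
by apply: le_trans W1; apply: le_esum => X TX; rewrite ger0_norm // wE.
Qed.

Lemma product_tests_semi_density X : product_tests U C D X -> semi_density X.
Proof. by move=> [[q lq] _ _]; apply: (lower_computes_semi_density lq). Qed.

Let bound X i j : product_tests U C D X ->
  `|complex.Re (X i j)| <= 1 /\ `|complex.Im (X i j)| <= 1.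
Proof. by move=> TX; apply: psd_Re_bound; exact: product_tests_semi_density. Qed.

Lemma universal_test_programs (S : test) : psd S ->
  (complex.Re (\tr (universal_test U C D *m S)))%:E =
  \esum_(z in test_programs) (weight z.2 * complex.Re (\tr (z.1.1 *m S)))%:E.
Proof.
move=> pS.
have t0 X : product_tests U C D X -> 0 <= complex.Re (\tr (X *m S)).
  by move=> /product_tests_semi_density[pX _]; exact (Re_tr_mul_ge0 pX pS).
rewrite (Re_tr_mx_sum_ge0 (w := w) (G := id)) //.
rewrite -(WE (f := fun X => complex.Re (\tr (X *m S)))) //.
by apply: eq_esum => X TX; rewrite EFinM wE // muleC.
Qed.

End TestPrograms.

Section Comparison.
Variables (R : realType) (U : machine).
Local Notation mu := (univ_semi_density R U).

(** Some program prints [x], so the infimum is taken over a nonempty set of natural numbers. *)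
Lemma complexity_attained (hU : universal U) x y :
  exists2 p, computes U y p x & complexity R U x y = ((size p)%:R)%:E.
Proof.
have ex : exists m, `[< exists2 p, computes U y p x & size p = m >].
  by have [p hp] := print_program hU x; exists (size p); apply/asboolP; exists p.
case: (ex_minnP ex) => m /asboolP[p hp sp] hm; exists p => //.
apply/eqP; rewrite eq_le; apply/andP; split.
  by apply: ereal_inf_lbound; exists p.
apply: le_ereal_inf_tmp => _ [p' hp' <-]; rewrite lee_fin ler_nat sp.
by apply: hm; apply/asboolP; exists p'.
Qed.

(** One factor is replaced at a time: P (x) Q <= a M (x) Q <= a M (x) b M. *)
Lemma tr_qtens_le n (X : 'M[R[i]]_(2 ^ (n + n))) (M P Q : 'M[R[i]]_(2 ^ n)) a b :
  psd X -> psd M -> psd P -> psd Q -> 0 <= a -> 0 <= b ->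
  psd (a *: M - P) -> psd (b *: M - Q) ->
  \tr (X *m qtens P Q) <= a * b * \tr (X *m qtens M M).
Proof.
move=> pX pM pP pQ a0 b0 hP hQ.
have h1 := tr_mul_ge0 pX (psd_qtens hP pQ).
have h2 := tr_mul_ge0 pX (psd_qtens (psd_scale a0 pM) hQ).
move: h1; rewrite qtensBl mulmxBr raddfB subr_ge0 => h1; apply: (le_trans h1).
move: h2; rewrite qtensBr mulmxBr raddfB subr_ge0 => h2; apply: (le_trans h2).
by rewrite /= qtensZr !qtensZl -!scalemxAr !mxtraceZ mulrCA mulrA.
Qed.

Lemma pow2C_ge0 m : 0 <= Complex (2 ^+ m) 0 :> R[i].
Proof. by rewrite lecE /= eqxx exprn_ge0. Qed.

Lemma universal_test_slice (hU : universal U) : exists c : nat,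
  forall n (sigma rho : 'M[R[i]]_(2 ^ n)) (nu xi : 'M[rat[i]]_(2 ^ n)) pnu pxi,
  psd sigma -> psd rho -> density (emb_mx R nu) -> density (emb_mx R xi) ->
  computes U (bits_of_nat n) pnu (code_mx nu) ->
  computes U (bits_of_nat n) pxi (code_mx xi) ->
  complex.Re (\tr (universal_test U (mu (n + n)%N) (mu (n + n)%N) *m
    qtens (qtens sigma (emb_mx R nu)) (qtens rho (emb_mx R xi)))) <=
  2 ^+ (c + (size pnu + size pnu + (size pxi + size pxi))) *
  complex.Re (\tr (universal_test U (mu n) (mu n) *m qtens sigma rho)).
Proof.
have [s1 h1] := slice_program hU; have [s3 h3] := mu_tens_le R hU.
have [s2 h2] := task_program hU s1 (8 + (size s3 + size s3)).
(* The scaling loses e = 8 + 2 |s3| + |pnu| + |pxi|, where each of the two dominations contributes 4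
   + |s3| and the length of a program; the prefix [s2] and the two appended programs lose |s2| +
   |pnu| + |pxi| more. *)
exists (8 + (size s3 + size s3) + size s2)%N => n sigma rho nu xi pnu pxi ps pr dn dx hnu hxi.
have [pn _] := dn; have [px _] := dx.
rewrite -spread_qtens; have pS := psd_qtens ps pr; set S := qtens sigma rho in pS *.
rewrite -lee_fin EFinM (universal_test_programs U _ _ pS) -esumZ; first last.
- move=> [[X q] p] [[TX _] _]; rewrite lee_fin mulr_ge0 ?(ltW (weight_gt0 _ _)) //.
  have [pX _] := product_tests_semi_density TX; exact (Re_tr_mul_ge0 pX pS).
- by rewrite exprn_ge0.
rewrite (universal_test_programs U _ _ (psd_spread pn px pS)).
pose e := (8 + (size s3 + size s3) + size pnu + size pxi)%N.
pose task := code_nat (slice_task n e (code_mx nu) (code_mx xi)).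
pose sl (X : 'M[R[i]]_(2 ^ (n + n + (n + n)))) := slice (emb_mx R nu) (emb_mx R xi) X.
apply: (le_esum_inj (e := fun t : 'M[R[i]]_(2 ^ (n + n + (n + n))) * bits * bits =>
  (half_powR R e *: sl t.1.1, s1 ++ task ++ t.1.2, s2 ++ t.2 ++ pnu ++ pxi))).
(* Only the third components are compared: they give [p], which computes [q], which lower computes
   [X]. The slice itself need not determine [X]. *)
- move=> [[X q] p] [[X' q'] p'] [/= [/= _ l] h] [/= [/= _ l'] h'] [_ _ ep].
  have {}ep : p = p'.
    move/(congr1 (drop (size s2))): ep; rewrite !drop_size_cat // => ep.
    have sp : size p = size p' by move/(congr1 size): ep; rewrite !size_cat => /addIn.
    by move/(congr1 (take (size p))): ep; rewrite take_size_cat // sp take_size_cat.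
  rewrite -ep in h' *; have eq : q = q' := computes_inj h h'.
  rewrite -eq in l' *; by have -> := lower_computes_inj l l'.
- move=> [[X q] p] [[/= TX lq] /= hp]; have [pX _] := product_tests_semi_density TX.
  split; last exact (h2 n p q pnu (code_mx nu) pxi (code_mx xi) hp hnu hxi).
  have lq' := lower_computes_slice h1 e dn dx lq; split; last exact: lq'.
  split; first by eexists; exact: lq'.
    have [_ [E [F EF]] _] := TX.
    exists (half_powR R e *: part_slice (emb_mx R nu) E), (part_slice (emb_mx R xi) F).
    by rewrite qtensZl -slice_qtens -EF.
  have [_ _ t1] := TX; rewrite /= -scalemxAl mxtraceZ tr_slice spread_qtens.
  pose a := Complex (2 ^+ (4 + (size s3 + size pnu))) 0 : R[i].
  pose b := Complex (2 ^+ (4 + (size s3 + size pxi))) 0 : R[i].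
  have pm := @psd_mu R U n; have pm2 := @psd_mu R U (n + n).
  have le := tr_qtens_le pX pm2 (psd_qtens pm pn) (psd_qtens pm px)
    (pow2C_ge0 _) (pow2C_ge0 _) (h3 n nu pnu dn hnu) (h3 n xi pxi dx hxi).
  (* The exponent [e] was chosen so that the scaling cancels both domination constants exactly; the
     trace condition on X is then inherited. *)
  have abe : half_powR R e * (a * b) = 1.
    rewrite /half_powR /a /b; simpc; rewrite -!exprD.
    rewrite (_ : (4 + _ + _)%N = e); last by rewrite /e; lia.
    by rewrite mulVf ?expf_neq0 ?pnatr_eq0.
  have := ler_wpM2l (half_powR_gt0 R e) le; rewrite -/a -/b mulrA abe mul1r.
  move=> le'; exact: le_trans le' t1.
- move=> [[X q] p] _ /=; rewrite -EFinM lee_fin -tr_slice -/(sl X) !weight_cat.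
  rewrite -scalemxAl mxtraceZ Re_mulC /= mul0r subr0 le_eqVlt; apply/orP; left; apply/eqP.
  rewrite /e !exprD; set x := complex.Re _.
  have d0 (i : nat) : 2 ^+ i != 0 :> R by rewrite expf_neq0 ?pnatr_eq0.
  by field; rewrite !d0.
- move=> [[X q] p] [[TX _] _]; rewrite -EFinM lee_fin mulr_ge0 ?exprn_ge0 //.
  rewrite mulr_ge0 ?(ltW (weight_gt0 _ _)) //.
  have [pX _] := product_tests_semi_density TX; exact (Re_tr_mul_ge0 pX pS).
Qed.

End Comparison.

Theorem theorem11 (R : realType) (U : machine) (hU : universal U) :
  exists c : R, forall (n : nat) (sigma rho : 'M[R[i]]_(2 ^ n))
    (nu xi : 'M[rat[i]]_(2 ^ n)),
    density sigma -> density rho ->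
    density (emb_mx R nu) -> density (emb_mx R xi) ->
    (mutual_info U (qtens sigma (emb_mx R nu)) (qtens rho (emb_mx R xi))
     <= mutual_info U sigma rho
        + 2%:E * complexity R U (code_mx nu) (bits_of_nat n)
        + 2%:E * complexity R U (code_mx xi) (bits_of_nat n)
        + c%:E)%E.
Proof.
have [c hc] := universal_test_slice R hU; exists c%:R => n sigma rho nu xi ds dr dn dx.
have [p hp ->] := complexity_attained R hU (code_mx nu) (bits_of_nat n).
have [p' hp' ->] := complexity_attained R hU (code_mx xi) (bits_of_nat n).
have := hc n sigma rho nu xi p p' ds.1 dr.1 dn dx hp hp'; rewrite /mutual_info /=.
set t := complex.Re _; set t' := complex.Re _ => le.
have ln2 : 0 < ln 2 :> R by rewrite ln_gt0 // ltr1n.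
(* If the trace on the left vanishes, its logarithm is -oo. Otherwise the trace on the right is
   positive as well, and both logarithms are finite. *)
have [t0|t0] := leP t 0.
  by rewrite gt0_mulNye ?leNye // lte_fin invr_gt0.
have t'0 : 0 < t'.
  by move: (lt_le_trans t0 le); rewrite pmulr_rgt0 // exprn_gt0.
rewrite (leNgt t') t'0 /= -!EFinM -!EFinD lee_fin ler_pdivrMr // !mulrDl mulfVK ?gt_eqF //.
have := le; rewrite -ler_ln ?posrE ?mulr_gt0 ?exprn_gt0 //.
rewrite lnM ?posrE ?exprn_gt0 // lnXn // -[ln 2 *+ (_ + _)]mulr_natl !natrD; lra.
Qed.
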